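(* Let $X$ be a compact complex 3-manifold endowed with a solution $(\omega,\Omega,E,A,\alpha')$ of the heterotic $\mathrm{SU}(3)$ system, with associated operator $\bar D$ on $Q$-valued $(0,p)$-forms. Then the cohomology group $H^{0,1}_{\bar D}(Q)$ and the Čech cohomology group $\check H^1(Q)$ are isomorphic.
   Context: Data. $X$ is a complex 3-manifold with local holomorphic coordinates $z^j$ (summation convention); $g$ is a Hermitian metric with form $\omega=ig_{j\bar k}dz^j\wedge d\bar z^k$; $\Omega$ is a nowhere vanishing $(3,0)$-form. $\nabla$ is the Chern connection of $g$ on $T^{1,0}X$: $\nabla_jV^l=\partial_jV^l+\Gamma_j{}^l{}_mV^m$ with $\Gamma_j{}^l{}_m=g^{l\bar q}\partial_jg_{m\bar q}$, $\nabla_{\bar k}=\partial_{\bar k}$; its curvature is $R_{\bar kj}{}^l{}_m=\partial_{\bar k}\Gamma_j{}^l{}_m$. $T=i\partial\omega$, with components $T_{jk\bar l}=T(\partial_{z^j},\partial_{z^k},\partial_{\bar z^l})$; $T^l{}_{jk}=\Gamma_j{}^l{}_k-\Gamma_k{}^l{}_j=-g^{l\bar m}T_{jk\bar m}$. $E\to X$ is a holomorphic vector bundle with Hermitian metric, with structure group such that endomorphisms of $E$ are trace-free ($\mathrm{End}(E)$ denotes these); $A$ is its Chern connection with curvature $F=F_{j\bar k}dz^j\wedge d\bar z^k$. $\alpha'\in\mathbb{R}\setminus\{0\}$. Heterotic $\mathrm{SU}(3)$ system: $d\Omega=0$; $2i\partial\bar\partial\omega=\alpha'(\mathrm{tr}(F\wedge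 F)-\mathrm{tr}(R\wedge R))$; $F\wedge\omega\wedge\omega=0$; $d(|\Omega|_\omega\,\omega\wedge\omega)=0$. Operator. $Q=(T^{1,0}X)^*\oplus\mathrm{End}(E)\oplus T^{1,0}X$, $Q^{0,p}=Q\otimes\Lambda^p(T^{0,1}X)^*$. For $s=(\kappa,\gamma,W)\in\Gamma(Q^{0,p})$ (with $\kappa=\kappa_jdz^j$, $W=W^j\partial_{z^j}$, coefficients being $(0,p)$-forms) set $\mathscr{F}\gamma=dz^j\otimes d\bar z^k\wedge\mathrm{tr}(F_{j\bar k}\gamma)$, $\mathscr{F}W=d\bar z^k\wedge F_{j\bar k}W^j$, $\mathscr{T}W=dz^j\otimes d\bar z^k\wedge T_{lj\bar k}W^l$, $\mathcal{R}\nabla^+W=dz^j\otimes d\bar z^k\wedge R_{\bar kj}{}^l{}_m\nabla^+_lW^m$, with $\nabla^+_kW^j=\nabla_kW^j-T^j{}_{kl}W^l$ (acting as the Chern connection on $(0,p)$-form indices). Then $\bar D(\kappa,\gamma,W)=(\bar\partial\kappa+\alpha'\mathscr{F}\gamma+\mathscr{T}W+\alpha'\mathcal{R}\nabla^+W,\ \bar\partial_E\gamma+\mathscr{F}W,\ \bar\partial W)$; $\bar D^2=0$ and $H^{0,p}_{\bar D}(Q)=\ker(\bar D|_{\Gamma(Q^{0,p})})/\bar D\,\Gamma(Q^{0,p-1})$. Below $\bar\partial$ on $Q$-valued forms is the direct sum Dolbeault operator. Local operators. $\mathcal{U}=\{U_i\}$ is an atlas of $X$, refined if necessary, consisting of coordinate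 charts trivialising $E$ and small enough that the $\bar\partial$-Poincaré lemma holds on each $U_i$. On $U_i$, $\Gamma_i$ is the Chern connection matrix, so $\partial_{\bar k}(\Gamma_i)_a{}^c{}_b=R_{\bar ka}{}^c{}_b$; $A_i=(A_i)_adz^a$ is an $\mathrm{End}(E)$-valued $(1,0)$-form with $\partial_{\bar k}(A_i)_a=F_{a\bar k}$ in a holomorphic frame; $\tilde\tau_i$ is a section of $(T^{1,0}X)^*\otimes(T^{1,0}X)^*$ with $\partial_{\bar k}(\tilde\tau_i)_{ab}=T_{ba\bar k}-\alpha'\mathrm{tr}((\Gamma_i)_aR_{\bar kb})+\alpha'\mathrm{tr}((A_i)_aF_{b\bar k})$ (these exist by anomaly cancellation). The invertible operator $\phi_i$ on $Q$-valued forms over $U_i$ is $$\phi_i(\kappa,\gamma,W)=\Big(\big(\kappa_a+\alpha'\mathrm{tr}((A_i)_a\gamma)+(\tilde\tau_i)_{ab}W^b+\alpha'(\Gamma_i)_a{}^c{}_b\nabla^+_cW^b\big)dz^a,\ \gamma+(A_i)_aW^a,\ W\Big),$$ and satisfies $\bar D|_{U_i}=\phi_i^{-1}\circ\bar\partial\circ\phi_i$. Put $\mathcal{P}=\{(U_i,\phi_i)\}$, $U_{i_0\ldots i_p}=U_{i_0}\cap\dots\cap U_{i_p}$, $\psi_{ij}=\phi_i\circ\phi_j^{-1}$ on $U_{ij}$. Čech cohomology. $C^p(Q,\mathcal{P})$ consists of families $\eta=\{\eta_{i_0\ldots i_p}\in\Gamma(U_{i_0\ldots i_p},Q)\}$ with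 $\bar\partial\eta_{i_0\ldots i_p}=0$, antisymmetric under exchange of any two of the indices $i_1,\ldots,i_p$, and with $\eta_{i_0\ldots i_l\ldots i_p}=-\psi_{i_0i_l}\eta_{i_l\ldots i_0\ldots i_p}$ for $l>0$ (exchange of $i_0$ and $i_l$). The differential is $(\delta\eta)_{i_0\ldots i_{p+1}}=\psi_{i_0i_1}\eta_{i_1\ldots i_{p+1}}+\sum_{k=1}^{p+1}(-1)^k\eta_{i_0\ldots\hat{i}_k\ldots i_{p+1}}$, with $\delta^2=0$; $\check H^p(Q)$ is the cohomology of $(C^\bullet(Q,\mathcal{P}),\delta)$. *)

(* Defs.v *)
From HB Require Import structures.
From mathcomp Require Import all_boot all_order all_algebra all_fingroup.
From mathcomp Require Import all_classical all_reals all_analysis.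
From mathcomp Require Import complex.

Set Implicit Arguments.
Unset Strict Implicit.
Unset Printing Implicit Defensive.

Import Order.TTheory GRing.Theory Num.Theory numFieldNormedType.Exports.
Local Open Scope classical_set_scope.
Local Open Scope ring_scope.

(* The quotient num / den inside a vector space.  It is only used when den is a
   subspace of the subspace num. *)

Record subquot (K : pzRingType) := Subquot {
  amb : lmodType K;
  num : set amb;
  den : set amb }.
Arguments num {K} H x : rename.
Arguments den {K} H x : rename.

Definition coset_in (K : pzRingType) (H : subquot K) (x : amb H) : set (amb H) :=
  [set y | num H y /\ den H (y - x)].

Arguments coset_in {K} H x.

Definition cosets (K : pzRingType) (H : subquot K) : set (set (amb H)) :=
  [set coset_in H x | x in num H].

Arguments cosets {K} H x.

(* A K-linear bijection between the two quotient spaces. *)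
Definition isomorphic (K : pzRingType) (H H' : subquot K) : Prop :=
  exists Phi : set (amb H) -> set (amb H'),
    set_bij (cosets H) (cosets H') Phi /\
    forall (a : K) (x y : amb H) (x' y' : amb H'),
      num H x -> num H y -> num H' x' -> num H' y' ->
      Phi (coset_in H x) = coset_in H' x' -> Phi (coset_in H y) = coset_in H' y' ->
      Phi (coset_in H (a *: x + y)) = coset_in H' (a *: x' + y').

(* C^3 as a real normed space: the pair (x, y) stands for x + i y. *)
Notation model R := ('rV[R]_3 * 'rV[R]_3)%type.

(* f is of class C^n on the open set V. *)
Fixpoint Ck (R : realType) (n : nat) (V : set (model R)) (f : model R -> R) : Prop :=
  match n with
  | 0 => forall z, V z -> {for z, continuous f}
  | m.+1 => (forall z, V z -> differentiable f z) /\
            (forall v : model R, Ck m V (fun z => 'D_v f z))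
  end.

Definition alternating (J : Type) (V : zmodType) (p : nat)
    (f : {ffun 'I_p -> J} -> V) : Prop :=
  forall (K : {ffun 'I_p -> J}) (u v : 'I_p), u != v ->
    f [ffun w => K (tperm u v w)] = - f K.

Definition omit (J : Type) (p : nat) (K : {ffun 'I_p.+1 -> J}) (u : 'I_p.+1) :
    {ffun 'I_p -> J} := [ffun w => K (lift u w)].

(* For an atlas, crdV i is the inverse of the coordinate map crd i on its
   image; the values of crd i off dom i, and of crdV i off that image, are
   irrelevant.  The same convention applies below to the local expressions of
   the geometric objects in the chart i. *)
Record charts (R : realType) (X : topologicalType) := Charts {
  idx : Type;
  dom : idx -> set X;
  crd : idx -> X -> model R;
  crdV : idx -> model R -> X }.

Section Calculus.
Context {R : realType} {X : topologicalType} (M : charts R X).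
Notation C := R[i].
Implicit Types (i : idx M) (x y : X).

Definition crdC i (a : 'I_3) x : C := ((crd i x).1 0 a +i* (crd i x).2 0 a)%C.

Definition smooth_on i (V : set X) (f : X -> C) : Prop :=
  forall n, Ck n (crd i @` V) (fun z => complex.Re (f (crdV i z))) /\
            Ck n (crd i @` V) (fun z => complex.Im (f (crdV i z))).

Definition pder i (v : model R) (f : X -> C) x : C :=
  ('D_v (fun z => complex.Re (f (crdV i z))) (crd i x) +i*
   'D_v (fun z => complex.Im (f (crdV i z))) (crd i x))%C.

(* The Wirtinger derivatives with respect to z^a and its conjugate. *)
Definition dz i (a : 'I_3) (f : X -> C) x : C :=
  2^-1 * (pder i (delta_mx 0 a, 0) f x - 'i%C * pder i (0, delta_mx 0 a) f x).
Definition dzb i (a : 'I_3) (f : X -> C) x : C :=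
  2^-1 * (pder i (delta_mx 0 a, 0) f x + 'i%C * pder i (0, delta_mx 0 a) f x).

Definition dzb_mx m n i (k : 'I_3) (f : X -> 'M[C]_(m, n)) x : 'M[C]_(m, n) :=
  \matrix_(a, b) dzb i k (fun y => f y a b) x.

Definition holomorphic_on i (V : set X) (f : X -> C) : Prop :=
  smooth_on i V f /\ forall (k : 'I_3) x, V x -> dzb i k f x = 0.

Record complex_atlas : Prop := ComplexAtlas {
  atlas_cover : forall x, exists i, dom i x;
  dom_open : forall i, open (dom i);
  crd_continuous : forall i x, dom i x -> {for x, continuous (crd i)};
  crd_open : forall i, open (crd i @` dom i);
  crdK : forall i x, dom i x -> crdV i (crd i x) = x;
  crdV_continuous : forall i z, (crd i @` dom i) z ->
    {for z, continuous (crdV i)};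
  crd_holomorphic : forall i j a,
    holomorphic_on i (dom i `&` dom j) (crdC j a) }.

(* (jac i j)^a_b = d z_i^a / d z_j^b: the transition functions of T^{1,0}X. *)
Definition jac i (j : idx M) x : 'M[C]_3 := \matrix_(a, b) dz j b (crdC i a) x.

(* A k-form is given in a chart by its values on the coordinate fields:
   inl j stands for d/dz^j and inr k for d/dzbar^k. *)
Definition form (k : nat) : Type := {ffun 'I_k -> 'I_3 + 'I_3} -> X -> C.

Definition del k i (f : form k) : form k.+1 := fun K x =>
  \sum_(u < k.+1) (if K u is inl a then (-1) ^+ u * dz i a (f (omit K u)) x else 0).
Definition delb k i (f : form k) : form k.+1 := fun K x =>
  \sum_(u < k.+1) (if K u is inr a then (-1) ^+ u * dzb i a (f (omit K u)) x else 0).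
Definition dform k i (f : form k) : form k.+1 := fun K x =>
  del i f K x + delb i f K x.

Definition wedge k q (f : form k) (f' : form q) : form (k + q) := fun K x =>
  (k`! * q`!)%:R^-1 * \sum_(s : 'S_(k + q)) (-1) ^+ s *
    (f [ffun u => K (s (lshift q u))] x * f' [ffun u => K (s (rshift k u))] x).

Definition scalef k (c : X -> C) (f : form k) : form k := fun K x => c x * f K x.

(* c_{jk} dz^j /\ dzbar^k *)
Definition form11 (c : 'I_3 -> 'I_3 -> X -> C) : form 2 := fun K x =>
  match K ord0, K ord_max with
  | inl j, inr k => c j k x
  | inr k, inl j => - c j k x
  | _, _ => 0
  end.

(* c dz^1 /\ dz^2 /\ dz^3 *)
Definition form30 (c : X -> C) : form 3 := fun K x =>
  c x * \det (\matrix_(a < 3, b < 3) ((K a == inl b)%:R : C)).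

(* The trace of the wedge square of a matrix of 2-forms. *)
Definition trwedge n (f : 'I_n -> 'I_n -> form 2) : form 4 := fun K x =>
  \sum_a \sum_b wedge (f a b) (f b a) K x.

(* (sum over k of) dzbar^k /\ P_k s, where P_k acts on the coefficients *)
Definition dzbar_wedge (V : lmodType C) (p : nat)
    (P : 'I_3 -> (X -> V) -> X -> V) (s : {ffun 'I_p -> 'I_3} -> X -> V)
    (K : {ffun 'I_p.+1 -> 'I_3}) x : V :=
  \sum_(u < p.+1) (-1) ^+ u *: P (K u) (s (omit K u)) x.

Definition zero_q_form i (q : nat) (f : {ffun 'I_q -> 'I_3} -> X -> C) : Prop :=
  (forall K, smooth_on i (dom i) (f K)) /\
  (forall x, dom i x -> alternating (f ^~ x)).

(* The dbar-Poincare lemma on the coordinate domain dom i. *)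
Definition dbar_poincare i : Prop :=
  forall (q : nat) (f : {ffun 'I_q.+1 -> 'I_3} -> X -> C),
    zero_q_form i f ->
    (forall K x, dom i x -> dzbar_wedge (V := C^o) (dzb i) f K x = 0) ->
    exists2 b : {ffun 'I_q -> 'I_3} -> X -> C, zero_q_form i b &
      forall K x, dom i x -> dzbar_wedge (V := C^o) (dzb i) b K x = f K x.

(* In the frame over dom i the metric is <u, v> = sum_{jk} u^j conj(v^k) G_{jk};
   components transform by u_i = t_{ij} u_j. *)
Record hermitian_metric n (t : idx M -> idx M -> X -> 'M[C]_n)
    (G : idx M -> X -> 'M[C]_n) : Prop := HermitianMetric {
  metric_smooth : forall i a b, smooth_on i (dom i) (fun x => G i x a b);
  metric_herm : forall i x, dom i x -> G i x = map_mx conjc (G i x)^T;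
  metric_pos : forall i x (v : 'rV[C]_n), dom i x -> v != 0 ->
    0 < (v *m G i x *m map_mx conjc v^T) 0 0;
  metric_transition : forall i j x, dom i x -> dom j x ->
    G j x = (t i j x)^T *m G i x *m map_mx conjc (t i j x) }.

(* Chern connection: (chern i G j)^l_m = G^{l qbar} d_j G_{m qbar}, where
   G^{l qbar} G_{m qbar} = delta^l_m. *)
Definition chern n i (G : X -> 'M[C]_n) (j : 'I_3) x : 'M[C]_n :=
  \matrix_(l, m) \sum_q invmx (G x) q l * dz i j (fun y => G y m q) x.

(* d_kbar of the Chern connection, i.e. the coefficient of dzbar^k /\ dz^j
   in the curvature. *)
Definition curv n i (G : X -> 'M[C]_n) (k j : 'I_3) x : 'M[C]_n :=
  dzb_mx i k (chern i G j) x.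

(* Transition functions of a holomorphic vector bundle of rank r trivialised
   over the charts, with structure group SL(r, C). *)
Record sl_bundle r (t : idx M -> idx M -> X -> 'M[C]_r) : Prop := SLBundle {
  bundle_holomorphic : forall i j a b,
    holomorphic_on i (dom i `&` dom j) (fun x => t i j x a b);
  bundle_id : forall i x, dom i x -> t i i x = 1%:M;
  bundle_cocycle : forall i j l x, dom i x -> dom j x -> dom l x ->
    t i j x *m t j l x = t i l x;
  bundle_det : forall i j x, dom i x -> dom j x -> \det (t i j x) = 1 }.

End Calculus.

Arguments form : clear implicits.

(* The local expressions of a Hermitian metric gX, a (3,0)-form
   Om dz^1 /\ dz^2 /\ dz^3, and a rank r vector bundle with transition functions
   tE and metric gE. *)
Record background (R : realType) (X : topologicalType) (M : charts R X) (r : nat) :=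
  Background {
    gX : idx M -> X -> 'M[R[i]]_3;
    Om : idx M -> X -> R[i];
    tE : idx M -> idx M -> X -> 'M[R[i]]_r;
    gE : idx M -> X -> 'M[R[i]]_r;
    alp : R }.

(* (A_i)_a and the matrices (tau_i)_{ab} *)
Record potentials (R : realType) (X : topologicalType) (M : charts R X) (r : nat) :=
  Potentials {
    Apot : idx M -> 'I_3 -> X -> 'M[R[i]]_r;
    tau : idx M -> X -> 'M[R[i]]_3 }.

Section Heterotic.
Context {R : realType} {X : topologicalType} {M : charts R X} {r : nat}.
Variable B : background M r.
Notation C := R[i].
Implicit Types (i : idx M) (x y : X).

Definition al : C := (alp B)%:C%C.

Definition Gam i (j : 'I_3) x : 'M[C]_3 := chern i (gX B i) j x.
(* R_{kbar j}^l_m is the (l, m) entry *)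
Definition Rm i (k j : 'I_3) x : 'M[C]_3 := curv i (gX B i) k j x.
(* F_{j kbar}, the coefficient of dz^j /\ dzbar^k, hence the sign *)
Definition Fm i (j k : 'I_3) x : 'M[C]_r := - curv i (gE B i) k j x.

Definition omega i : form R X 2 := form11 (fun j k x => 'i%C * gX B i x j k).
Definition Omega i : form R X 3 := form30 (Om B i).
Definition Fform i (a b : 'I_r) : form R X 2 := form11 (fun j k x => Fm i j k x a b).
Definition Rform i (a b : 'I_3) : form R X 2 :=
  form11 (fun j k x => - Rm i k j x a b).
(* Since |Omega|_omega is only defined up to a positive constant depending on
   normalisations, we use |Omega|^2 = Om conj(Om) / det g. *)
Definition normOm i x : C := `|Om B i x| / sqrtC (\det (gX B i x)).

(* T_{jk lbar} = T(d_j, d_k, d_lbar) with T = i del omega *)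
Definition Tcomp i (j k l : 'I_3) x : C :=
  'i%C * del i (omega i)
    [ffun u : 'I_3 => tnth [tuple inl j; inl k; inr l] u] x.

(* The condition det gE = 1, together with det tE = 1, reduces the structure
   group of the Hermitian bundle to SU(r). *)
Record heterotic : Prop := Heterotic {
  het_metric : hermitian_metric (jac (M := M)) (gX B);
  het_bundle : sl_bundle (tE B);
  het_bundle_metric : hermitian_metric (tE B) (gE B);
  het_bundle_unimodular : forall i x, dom i x -> \det (gE B i x) = 1;
  het_Om_smooth : forall i, smooth_on i (dom i) (Om B i);
  het_Om_neq0 : forall i x, dom i x -> Om B i x != 0;
  het_Om_transition : forall i j x, dom i x -> dom j x ->
    Om B i x = \det (jac j i x) * Om B j x;
  het_alp_neq0 : alp B != 0;
  het_dOmega : forall i K x, dom i x -> dform i (Omega i) K x = 0;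
  het_anomaly : forall i K x, dom i x ->
    2 * 'i%C * del i (delb i (omega i)) K x =
    al * (trwedge (Fform i) K x - trwedge (Rform i) K x);
  het_hym : forall i a b K x, dom i x ->
    wedge (wedge (Fform i a b) (omega i)) (omega i) K x = 0;
  het_balanced : forall i K x, dom i x ->
    dform i (scalef (normOm i) (wedge (omega i) (omega i))) K x = 0 }.

(* Components (kappa_a, gamma, W^a) in the frames of a chart *)
Local Notation qfib := ('rV[C]_3 * 'M[C]_r * 'cV[C]_3)%type.
Definition kap (v : qfib) : 'rV[C]_3 := v.1.1.
Definition gam (v : qfib) : 'M[C]_r := v.1.2.
Definition tng (v : qfib) : 'cV[C]_3 := v.2.

(* s x i K is the coefficient at x, in the chart i, of dzbar^K of a Q-valued
   (0,p)-form (1/p!) sum_K s_K dzbar^K. *)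
Definition qform (p : nat) : Type :=
  X -> idx M -> {ffun 'I_p -> 'I_3} -> qfib.

(* Change of components, from the chart j to the chart i. *)
Definition transQ p (j : idx M) i x (s : {ffun 'I_p -> 'I_3} -> qfib)
    (K : {ffun 'I_p -> 'I_3}) : qfib :=
  \sum_(L : {ffun 'I_p -> 'I_3}) (\prod_u conjc (jac j i x (L u) (K u))) *:
    (kap (s L) *m jac j i x,
     tE B i j x *m gam (s L) *m tE B j i x,
     jac i j x *m tng (s L)).

(* Gamma(W, Q^{0,p}) for W open.  Components are extended by 0 outside W and
   outside the chart domains, so that equality of sections is equality. *)
Record sections p (W : set X) (s : qform p) : Prop := Sections {
  sec_support : forall x i, ~ (W `&` dom i) x -> s x i = 0;
  sec_transition : forall i j x, W x -> dom i x -> dom j x ->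
    s x i = transQ j i x (s x j);
  sec_alternating : forall x i, alternating (s x i);
  sec_traceless : forall x i K, \tr (gam (s x i K)) = 0;
  sec_smooth_kap : forall i K a,
    smooth_on i (W `&` dom i) (fun x => kap (s x i K) 0 a);
  sec_smooth_gam : forall i K a b,
    smooth_on i (W `&` dom i) (fun x => gam (s x i K) a b);
  sec_smooth_tng : forall i K a,
    smooth_on i (W `&` dom i) (fun x => tng (s x i K) a 0) }.

(* nabla_l W^m, T^m_{ln} and nabla^+_l W^m.  On (0,p)-form indices the (1,0)
   part of the Chern connection has zero Christoffel symbols, being the
   conjugate of nabla_lbar = d_lbar, so these formulas also apply to each
   coefficient of a T^{1,0}X-valued (0,p)-form. *)
Definition nabla i (W : X -> 'cV[C]_3) (l m : 'I_3) x : C :=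
  dz i l (fun y => W y m 0) x + \sum_n Gam i l x m n * W x n 0.
Definition torsion i (m l n : 'I_3) x : C := Gam i l x m n - Gam i n x m l.
Definition nablap i (W : X -> 'cV[C]_3) (l m : 'I_3) x : C :=
  nabla i W l m x - \sum_n torsion i m l n x * W x n 0.

(* The coefficients of dzbar^k in the operators F, T and R nabla^+. *)
Definition opFgam i (k : 'I_3) (c : X -> 'M[C]_r) x : 'rV[C]_3 :=
  \row_j \tr (Fm i j k x *m c x).
Definition opFtng i (k : 'I_3) (W : X -> 'cV[C]_3) x : 'M[C]_r :=
  \sum_j W x j 0 *: Fm i j k x.
Definition opT i (k : 'I_3) (W : X -> 'cV[C]_3) x : 'rV[C]_3 :=
  \row_j \sum_l Tcomp i l j k x * W x l 0.
Definition opRnabla i (k : 'I_3) (W : X -> 'cV[C]_3) x : 'rV[C]_3 :=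
  \row_j \sum_l \sum_m Rm i k j x l m * nablap i W l m x.

Definition delbar_coef i (k : 'I_3) (s : X -> qfib) x : qfib :=
  (dzb_mx i k (kap \o s) x, dzb_mx i k (gam \o s) x, dzb_mx i k (tng \o s) x).

Definition Dbar_coef i (k : 'I_3) (s : X -> qfib) x : qfib :=
  (dzb_mx i k (kap \o s) x + al *: opFgam i k (gam \o s) x
     + opT i k (tng \o s) x + al *: opRnabla i k (tng \o s) x,
   dzb_mx i k (gam \o s) x + opFtng i k (tng \o s) x,
   dzb_mx i k (tng \o s) x).

(* The operators dbar and Dbar on Q-valued (0,p)-forms over an open set W. *)
Definition delbar p (W : set X) (s : qform p) : qform p.+1 := fun x i K =>
  if x \in W `&` dom i
  then dzbar_wedge (delbar_coef i) (fun L y => s y i L) K x else 0.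
Definition Dbar p (W : set X) (s : qform p) : qform p.+1 := fun x i K =>
  if x \in W `&` dom i
  then dzbar_wedge (Dbar_coef i) (fun L y => s y i L) K x else 0.

(* H^{0,p+1}_Dbar(Q) *)
Definition H_Dbar (p : nat) : subquot C := Subquot (amb := qform p.+1)
  [set s | sections [set: X] s /\ Dbar [set: X] s = 0]
  [set Dbar [set: X] s | s in [set s : qform p | sections [set: X] s]].

Record local_potentials (P : potentials M r) : Prop := LocalPotentials {
  Apot_smooth : forall i a b c, smooth_on i (dom i) (fun x => Apot P i a x b c);
  Apot_traceless : forall i a x, dom i x -> \tr (Apot P i a x) = 0;
  Apot_eq : forall i a k x, dom i x -> dzb_mx i k (Apot P i a) x = Fm i a k x;
  tau_smooth : forall i a b, smooth_on i (dom i) (fun x => tau P i x a b);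
  tau_eq : forall i a b k x, dom i x ->
    dzb i k (fun y => tau P i y a b) x =
      Tcomp i b a k x - al * \tr (Gam i a x *m Rm i k b x)
      + al * \tr (Apot P i a x *m Fm i b k x) }.

Variable P : potentials M r.

(* The part of phi_i(kappa, gamma, W) other than (kappa, gamma, W) itself. *)
Definition phi_kap i (c : X -> 'M[C]_r) (W : X -> 'cV[C]_3) x : 'rV[C]_3 :=
  \row_a (al * \tr (Apot P i a x *m c x) + \sum_b tau P i x a b * W x b 0
          + al * \sum_c \sum_b Gam i a x c b * nablap i W c b x).
Definition phi_gam i (W : X -> 'cV[C]_3) x : 'M[C]_r :=
  \sum_a W x a 0 *: Apot P i a x.

Definition phi_coef i (s : X -> qfib) x : qfib :=
  (kap (s x) + phi_kap i (gam \o s) (tng \o s) x,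
   gam (s x) + phi_gam i (tng \o s) x,
   tng (s x)).
Definition phiV_coef i (s : X -> qfib) x : qfib :=
  let c := fun y => gam (s y) - phi_gam i (tng \o s) y in
  (kap (s x) - phi_kap i c (tng \o s) x, c x, tng (s x)).

Lemma phi_coefK i (s : X -> qfib) : phiV_coef i (phi_coef i s) = s.
Proof.
apply/funext => x; rewrite /phiV_coef /= /tng /=.
have -> : (fun y => gam (phi_coef i s y) - phi_gam i (snd \o phi_coef i s) y)
  = gam \o s by apply/funext => y /=; rewrite /gam /= addrK.
by rewrite /phi_gam /kap /gam /= !addrK; case: (s x) => -[].
Qed.

Lemma phiV_coefK i (s : X -> qfib) : phi_coef i (phiV_coef i s) = s.
Proof.
apply/funext => x; rewrite /phi_coef /phiV_coef /= /kap /gam /tng /=.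
by rewrite !subrK; case: (s x) => -[].
Qed.

Definition phi p i (W : set X) (s : qform p) : qform p := fun x l =>
  if x \in W `&` dom l
  then transQ i l x (fun K => phi_coef i (fun y => s y i K) x) else 0.
Definition phiV p i (W : set X) (s : qform p) : qform p := fun x l =>
  if x \in W `&` dom l
  then transQ i l x (fun K => phiV_coef i (fun y => s y i K) x) else 0.

(* psi_ij = phi_i o phi_j^{-1} on sections over W, a subset of dom i and dom j *)
Definition psi p i (j : idx M) (W : set X) (s : qform p) : qform p :=
  phi i W (phiV j W s).

Definition inter n (J : 'I_n -> idx M) : set X := [set x | forall u, dom (J u) x].

Definition cochains (p : nat) : Type := ('I_p.+1 -> idx M) -> qform 0.

Record cech_cochain p (eta : cochains p) : Prop := CechCochain {
  cech_section : forall J, sections (inter J) (eta J);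
  cech_holomorphic : forall J, delbar (inter J) (eta J) = 0;
  cech_antisym : forall J (k l : 'I_p.+1), k != l -> k != ord0 -> l != ord0 ->
    eta (J \o tperm k l) = - eta J;
  cech_antisym0 : forall J (l : 'I_p.+1), l != ord0 ->
    eta J = - psi (J ord0) (J l) (inter J) (eta (J \o tperm ord0 l)) }.

Definition restr p (W : set X) (s : qform p) : qform p := fun x i =>
  if x \in W then s x i else 0.

Definition cech_d p (eta : cochains p) : cochains p.+1 := fun J =>
  psi (J ord0) (J (lift ord0 ord0)) (inter J) (eta (J \o lift ord0))
  + \sum_(k < p.+2 | k != ord0) (-1) ^+ k *: restr (inter J) (eta (J \o lift k)).

(* The Cech cohomology group in degree p+1 *)
Definition H_Cech (p : nat) : subquot C := Subquot (amb := cochains p.+1)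
  [set eta | cech_cochain eta /\ cech_d eta = 0]
  [set cech_d eta | eta in [set eta : cochains p | cech_cochain eta]].

End Heterotic.

(* Main.v *)
From HB Require Import structures.
From mathcomp Require Import all_boot all_order all_algebra all_fingroup.
From mathcomp Require Import all_classical all_reals all_analysis.
From mathcomp Require Import complex ring lra.
Require Import Defs.

(** The comparison is the one between Dolbeault and Cech cohomology of the sheaf
    of [Dbar]-closed sections of Q, seen through the local isomorphisms [phi].

    In a chart, the correction terms of [phi] are built from potentials of the
    terms by which [Dbar] differs from [dbar]: the Christoffel symbols for the
    Riemannian curvature, the connection form [Apot] for the bundle curvature
    and [tau] for the torsion.  Therefore [phi] intertwines [Dbar] and [dbar]
    ([delbar_phi]); it follows that [Dbar] squares to zero, and the
    dbar-Poincare lemma gives local primitives of [Dbar]-closed forms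
    ([Dbar_primitive]).

    A closed form [s] thus has primitives a_i on the chart domains.  The
    differences a_j - a_i are [Dbar]-closed, and [phi] in the chart i moves them
    to a holomorphic cochain, in which the frame of the first index is
    preferred; this is why the transition operators [psi] occur in the Cech
    differential.  Conversely, undoing [phi] turns a twisted cocycle into an
    ordinary cocycle of smooth sections ([cocycle_untwisted]).  A partition of
    unity splits it ([cocycle_splits]), and the [Dbar]-derivatives of the pieces
    glue to a closed form.  The splitting has to take place before [phi] is
    applied, because [phi] contains derivatives and does not commute with
    multiplication by smooth functions.

    The relation between a form and the cochains of differences of its
    primitives ([dolbeault_cech]) is linear, total on both sides, and relates
    exact forms to coboundaries only and conversely; such a relation induces an
    isomorphism of the quotients ([isomorphic_of_relation]).

    Forms are given by their components in the charts, so this argument needs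
    [Dbar] to be independent of the chart ([Dbar_coef_trans]).  The point is
    that [nabla^+] maps vector fields to tensors ([nablap_transition]): its
    Christoffel symbols occur with the lower indices exchanged, and the
    inhomogeneous term of their transformation law is symmetric.  The partition
    of unity is built from the function exp(-1/x). *)

Set Implicit Arguments.
Unset Strict Implicit.
Unset Printing Implicit Defensive.

Import Order.TTheory GRing.Theory Num.Theory numFieldNormedType.Exports.
Local Open Scope classical_set_scope.
Local Open Scope ring_scope.

(** * Functions of class C^n on the model space *)

Section RealCalculus.
Context {R : realType}.
Notation V := (model R).
Implicit Types (f g : V -> R) (A : set V) (z v : V).

(** The difference of the two functions vanishes near the point, so that its
    differential there is zero. *)
Lemma near_eq_differentiable (V1 W1 : normedModType R) (f g : V1 -> W1) x :
  (\near x, f x = g x) -> differentiable f x -> differentiable g x.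
Proof.
move=> fg df.
suff dh : differentiable (g - f) x.
  have -> : g = f + (g - f) by rewrite addrC subrK.
  exact: differentiableD.
have h0 : \near x, g x - f x = 0.
  by near=> y; rewrite (near fg y _) ?subrr.
have hx : g x - f x = 0 := nbhs_singleton h0.
have hs : \forall y \near (0 : V1), g (y + x) - f (y + x) = 0.
  by rewrite (near_shift 0 x) in h0; move: h0; rewrite subr0.
have lo : (g - f) \o shift x =
    cst ((g - f) x) + (\0 : {linear V1 -> W1}) +o_ (0 : V1) id.
  apply/eqaddoP => e e0; rewrite near_simpl; near=> y.
  rewrite !fctE /= hx.
  have -> : g (y + x) - f (y + x) = 0 by near: y; exact: hs.
  by rewrite addr0 subrr normr0 mulr_ge0 // ltW.
have c0 : continuous (\0 : {linear V1 -> W1}) by move=> ?; apply: cvg_cst.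
by apply/diff_locallyP; rewrite (diff_unique c0 lo).
Unshelve. all: by end_near. Qed.

(** The conditions in [Ck] are imposed point by point, so that they restrict to
    smaller sets and can be tested locally. *)
Lemma Ck_at n A f : Ck n A f <-> (forall z, A z -> Ck n [set z] f).
Proof.
elim: n f => [|n IH] f /=.
  split=> h z Az; first by move=> _ ->; exact: h.
  exact: (h z Az z erefl).
split.
  move=> [h1 h2] z Az; split=> [_ ->|v]; first exact: h1.
  exact: (IH _).1 (h2 v) z Az.
move=> h; split=> [z Az|v]; first exact: (h z Az).1 z erefl.
by apply/IH => z Az; exact: (h z Az).2.
Qed.

Lemma Ck_sub n A A' f : A `<=` A' -> Ck n A' f -> Ck n A f.
Proof. by move=> AA' /Ck_at h; apply/Ck_at => z /AA'; exact: h. Qed.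

Lemma CkS n A f : Ck n.+1 A f -> Ck n A f.
Proof.
elim: n f => [|n IH] f [h1 h2] /=.
  by move=> z /h1; exact: differentiable_continuous.
by split=> // v; apply: IH.
Qed.

Lemma open_near_eq A f g z : open A -> (forall y, A y -> f y = g y) -> A z ->
  \near z, f z = g z.
Proof. by move=> oA fg Az; apply: filterS fg _; exact: open_nbhs_nbhs. Qed.

(** Openness is essential: the derivatives at a point of the set depend on the
    values nearby. *)
Lemma Ck_ext n A f g : open A -> (forall z, A z -> f z = g z) ->
  Ck n A f -> Ck n A g.
Proof.
move=> oA; elim: n f g => [|n IH] f g fg /=.
  move=> h z Az; rewrite /prop_for /continuous_at -(fg z Az).
  by apply: cvg_trans (h z Az); apply: near_eq_cvg; exact: (open_near_eq oA fg Az).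
move=> [h1 h2]; split=> [z Az|v].
  by apply: near_eq_differentiable (h1 z Az); exact: (open_near_eq oA fg Az).
apply: IH (h2 v) => z Az; apply: near_eq_derive; exact: (open_near_eq oA fg Az).
Qed.

Lemma Ck_cst n A (c : R) : Ck n A (fun=> c).
Proof.
elim: n c => [|n IH] c /=; first by move=> z _; exact: cvg_cst.
split=> [z _|v]; first exact: differentiable_cst.
suff -> : (fun z => 'D_v (fun=> c : R) z) = fun=> 0 by exact: IH.
by apply/funext => z; exact: derive_cst.
Qed.

Lemma CkD n A f g : open A -> Ck n A f -> Ck n A g ->
  Ck n A (fun z => f z + g z).
Proof.
move=> oA; elim: n f g => [|n IH] f g /=.
  by move=> hf hg z Az; apply: cvgD; [exact: hf|exact: hg].
move=> [f1 f2] [g1 g2]; split=> [z Az|v].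
  by apply: differentiableD; [exact: f1|exact: g1].
apply: Ck_ext (IH _ _ (f2 v) (g2 v)) => // z Az.
by rewrite deriveD //; apply: diff_derivable; [exact: f1|exact: g1].
Qed.

Lemma CkM n A f g : open A -> Ck n A f -> Ck n A g ->
  Ck n A (fun z => f z * g z).
Proof.
move=> oA; elim: n f g => [|n IH] f g.
  by move=> hf hg z Az; apply: cvgM; [exact: hf|exact: hg].
move=> hf hg; have [f1 f2] := hf; have [g1 g2] := hg; split=> [z Az|v].
  by apply: differentiableM; [exact: f1|exact: g1].
apply: Ck_ext (CkD oA (IH _ _ (CkS hf) (g2 v)) (IH _ _ (CkS hg) (f2 v))) => //.
by move=> z Az; rewrite deriveM //; apply: diff_derivable; [exact: f1|exact: g1].
Qed.

Lemma CkN n A f : open A -> Ck n A f -> Ck n A (fun z => - f z).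
Proof.
move=> oA hf; apply: Ck_ext (CkM oA (Ck_cst n A (-1)) hf) => // z _.
by rewrite mulN1r.
Qed.

Lemma CkV n A f : open A -> (forall z, A z -> f z != 0) -> Ck n A f ->
  Ck n A (fun z => (f z)^-1).
Proof.
move=> oA f0; elim: n => [|n IH] hf.
  by move=> z Az; apply: cvgV; [exact: f0|exact: hf].
have [f1 f2] := hf; split=> [z Az|v].
  by apply: differentiableV; [exact: f1|exact: f0].
have iV := IH (CkS hf).
apply: Ck_ext (CkN oA (CkM oA (CkM oA iV iV) (f2 v))) => // z Az.
rewrite deriveV ?f0 //; last exact/diff_derivable/f1.
by rewrite -expr2 exprVn scaleNr.
Qed.

Definition model_of (p q : 'I_3 -> R) : V := (\row_a p a, \row_a q a).

Lemma model_sum z : z = \sum_a z.1 0 a *: (delta_mx 0 a, 0)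
   + \sum_a z.2 0 a *: (0, delta_mx 0 a) :> V.
Proof.
have sum1 (F : 'I_3 -> V) : \sum_a F a = (\sum_a (F a).1, \sum_a (F a).2).
  rewrite [LHS]surjective_pairing.
  by rewrite (big_morph fst (id1 := 0) (op1 := +%R)) //
     (big_morph snd (id1 := 0) (op1 := +%R)).
rewrite !sum1 /=; case: z => z1 z2; congr pair => /=.
  rewrite [X in _ + X]big1 ?addr0; first exact: row_sum_delta.
  by move=> a _; rewrite scaler0.
rewrite [X in X + _]big1 ?add0r; first exact: row_sum_delta.
by move=> a _; rewrite scaler0.
Qed.

(** In coordinates, because a change of charts is only known through its real
    coordinate functions. *)
Lemma chain_rule (p q : 'I_3 -> V -> R) f z :
  let phi := fun y => model_of (p^~ y) (q^~ y) in
  (forall a, differentiable (p a) z) -> (forall a, differentiable (q a) z) ->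
  differentiable f (phi z) ->
  differentiable (f \o phi) z /\ forall v, 'D_v (f \o phi) z =
    \sum_a 'D_v (p a) z * 'D_(delta_mx 0 a, 0) f (phi z) +
    \sum_a 'D_v (q a) z * 'D_(0, delta_mx 0 a) f (phi z).
Proof.
move=> phi dp dq df.
have drow (s : 'I_3 -> V -> R) : (forall a, differentiable (s a) z) ->
    differentiable (fun y => \row_a s a y : 'rV[R]_3) z.
  move=> ds.
  rewrite (_ : (fun y => _) = \sum_(a < 3) (fun y => s a y *: (delta_mx 0 a : 'rV[R]_3))).
    by apply: differentiable_sum => a; exact: differentiableZl.
  apply/funext => y; rewrite fct_sumE; rewrite [LHS]row_sum_delta.
  by apply: eq_bigr => a _; rewrite mxE.
have drowE (s : 'I_3 -> V -> R) v : (forall a, differentiable (s a) z) ->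
    'd (fun y => \row_a s a y : 'rV[R]_3) z v = \row_a 'D_v (s a) z.
  move=> ds; rewrite -deriveE; last exact: drow.
  rewrite derive_mx; last exact/diff_derivable/drow.
  apply/rowP => a; rewrite !mxE; congr ('D_v _ z); apply/funext => y.
  by rewrite mxE.
have dphi : differentiable phi z by apply: differentiable_pair; exact: drow.
split=> [|v]; first exact: differentiable_comp.
have key w : 'd f (phi z) w = \sum_a w.1 0 a * 'D_(delta_mx 0 a, 0) f (phi z)
    + \sum_a w.2 0 a * 'D_(0, delta_mx 0 a) f (phi z).
  rewrite {1}(model_sum w); set L := 'd f (phi z).
  rewrite (raddfD L) !(raddf_sum L); congr (_ + _).
    by apply: eq_bigr => a _; rewrite deriveE //; exact: (linearZ_LR L).
  by apply: eq_bigr => a _; rewrite deriveE //; exact: (linearZ_LR L).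
have cmp : 'D_v (f \o phi) z = 'd f (phi z) ('d phi z v).
  rewrite deriveE; last exact: differentiable_comp.
  exact: (congr1 (fun h => h v) (diff_comp dphi df)).
have dp' : 'd phi z v = (\row_a 'D_v (p a) z, \row_a 'D_v (q a) z).
  rewrite -!drowE //.
  exact: (congr1 (fun h => h v) (diff_pair (drow _ dp) (drow _ dq))).
rewrite cmp key dp'.
by congr (_ + _); apply: eq_bigr => a _; rewrite mxE.
Qed.

Lemma Ck_sum n A (I : Type) (s : seq I) (F : I -> V -> R) : open A ->
  (forall a, Ck n A (F a)) -> Ck n A (fun z => \sum_(a <- s) F a z).
Proof.
move=> oA hF; elim: s => [|a s IH].
  by rewrite (_ : (fun z => _) = fun=> 0); [exact: Ck_cst|
     apply/funext => z; rewrite big_nil].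
rewrite (_ : (fun z => _) = fun z => F a z + \sum_(b <- s) F b z).
  exact: CkD.
by apply/funext => z; rewrite big_cons.
Qed.

(** By the chain rule the derivatives of the composite are sums of products of
    derivatives of the inner map with composites of partial derivatives of [f], to
    which the induction hypothesis applies. *)
Lemma Ck_comp n A A' (p q : 'I_3 -> V -> R) f :
  let phi := fun y => model_of (p^~ y) (q^~ y) in
  open A -> (forall z, A z -> A' (phi z)) ->
  (forall a, Ck n A (p a)) -> (forall a, Ck n A (q a)) ->
  Ck n A' f -> Ck n A (f \o phi).
Proof.
move=> phi oA; elim: n f => [|n IH] f AA' hp hq hf.
  move=> z Az; apply: continuous_comp; last exact: hf _ (AA' _ Az).
  have crow (s : 'I_3 -> V -> R) : (forall a, Ck 0 A (s a)) ->
      {for z, continuous (fun y => \row_a s a y : 'rV[R]_3)}.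
    move=> cs.
    rewrite (_ : (fun y => _) = fun y => \sum_(a < 3) s a y *: (delta_mx 0 a : 'rV[R]_3)).
      apply: cvg_big => [|a _]; first exact: add_continuous.
      by apply: cvgZr_tmp; exact: cs.
    apply/funext => y; rewrite [LHS]row_sum_delta.
    by apply: eq_bigr => a _; rewrite mxE.
  have cp := crow _ hp; have cq := crow _ hq.
  exact: (cvg_pair cp cq).
have chain z (Az : A z) := @chain_rule p q f z (fun a => (hp a).1 z Az)
  (fun a => (hq a).1 z Az) (hf.1 _ (AA' _ Az)).
split=> [z Az|v]; first exact: (chain z Az).1.
have part w : Ck n A (fun z => 'D_w f (phi z)).
  apply: (IH (fun z => 'D_w f z)) => // [a|a|]; last exact: hf.2.
    exact: CkS.
  exact: CkS.
apply: (Ck_ext oA (f := fun z =>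
    \sum_a 'D_v (p a) z * 'D_(delta_mx 0 a, 0) f (phi z) +
    \sum_a 'D_v (q a) z * 'D_(0, delta_mx 0 a) f (phi z))).
  by move=> z Az; rewrite (chain z Az).2.
by apply: CkD => //; apply: Ck_sum => // a; apply: CkM => //;
  [exact: (hp a).2|exact: (hq a).2].
Qed.
End RealCalculus.

(** * Symmetry of second derivatives *)

Section Schwarz.
Context {R : realType} {V : normedModType R}.
Implicit Types (f : V -> R) (u v z : V).

Lemma is_derive_line f z u (s : R) : differentiable f (z + s *: u) ->
  is_derive s 1 (fun t => f (z + t *: u)) ('D_u f (z + s *: u)).
Proof.
move=> df.
have dl : is_diff s (fun t => z + t *: u) ( *:%R^~ u).
  have := is_diffD (is_diff_cst z s) (is_diff_scalel s u).
  by rewrite add0r.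
have [dlx dlv] := dl.
have dc : differentiable (f \o (fun t => z + t *: u)) s.
  by apply: differentiable_comp.
apply: DeriveDef; first exact/diff_derivable.
rewrite deriveE // (deriveE u df).
have /= -> := congr1 (fun h => h 1) (diff_comp dlx df).
by rewrite dlv scale1r.
Qed.

Lemma mvt_line f z u (t : R) (df := fun s => 'D_u f (z + s *: u)) : 0 < t ->
  (forall s, 0 <= s <= t -> differentiable f (z + s *: u)) ->
  exists2 c, 0 <= c <= t & f (z + t *: u) - f z = df c * t.
Proof.
move=> t0 hd.
have [||c] := @MVT _ (fun s => f (z + s *: u)) df 0 t t0.
- move=> s; rewrite in_itv /= => /andP[s0 st]; apply: is_derive_line.
  by apply: hd; rewrite !ltW.
- apply: derivable_within_continuous => s; rewrite in_itv /= => st.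
  by have [] := is_derive_line (hd s st).
rewrite in_itv /= => /andP[c0 ct]; rewrite scale0r addr0 subr0 => e.
by exists c => //; rewrite !ltW.
Qed.

(** The mean value theorem is used twice: along [u] for the difference of [f]
    across the parallelogram, then along [v] for the derivative of [f] along [u]. *)
Lemma second_difference f z u v (t : R) : 0 < t ->
  (forall a b, 0 <= a <= t -> 0 <= b <= t ->
    differentiable f (z + a *: u + b *: v) /\
    differentiable (fun y => 'D_u f y) (z + a *: u + b *: v)) ->
  exists a b, [/\ 0 <= a <= t, 0 <= b <= t &
    f (z + t *: u + t *: v) - f (z + t *: u) - (f (z + t *: v) - f z) =
    'D_v (fun y => 'D_u f y) (z + a *: u + b *: v) * t * t].
Proof.
move=> t0 hd.
have t0t : 0 <= t <= t by rewrite lexx ltW.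
have o0t : 0 <= (0 : R) <= t by rewrite lexx ltW.
pose g (s : R) := f (z + t *: v + s *: u) - f (z + s *: u).
pose dg (s : R) := 'D_u f (z + t *: v + s *: u) - 'D_u f (z + s *: u).
have dgP s : 0 <= s <= t -> is_derive s 1 g (dg s).
  move=> st; apply: is_deriveB; apply: is_derive_line.
    by rewrite addrAC; exact: (hd _ _ st t0t).1.
  by have := (hd _ _ st o0t).1; rewrite scale0r addr0.
have [||c] := @MVT _ g dg 0 t t0.
- by move=> s; rewrite in_itv /= => /andP[s0 st]; apply: dgP; rewrite !ltW.
- apply: derivable_within_continuous => s; rewrite in_itv /= => st.
  by have [] := dgP _ st.
rewrite in_itv /= => /andP[c0 ct] e.
have cc : 0 <= c <= t by rewrite !ltW.
have [d dd e2] := @mvt_line (fun y => 'D_u f y) (z + c *: u) v t t0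
  (fun s hs => (hd _ _ cc hs).2).
exists c, d; split => //.
transitivity (g t - g 0); first by rewrite /g !scale0r !addr0 (addrAC z); ring.
by rewrite e subr0 /dg (addrAC z) e2.
Qed.

(** The second difference quotient is symmetric in the two directions, and by
    the mean value theorem it equals either mixed derivative at points as close
    to the base point as one likes. *)
Lemma mixed_derivatives_eq f z u v (A : set V) : open A -> A z ->
  (forall y w, A y -> differentiable f y /\ differentiable ('D_w f) y) ->
  {for z, continuous ('D_u (fun y => 'D_v f y))} ->
  {for z, continuous ('D_v (fun y => 'D_u f y))} ->
  'D_u (fun y => 'D_v f y) z = 'D_v (fun y => 'D_u f y) z.
Proof.
move=> oA Az hd cuv cvu; apply/eqP; rewrite -subr_eq0 -normr_le0.
apply/ler_addgt0Pl => e e0; rewrite addr0.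
have e2 : 0 < e / 2 by rewrite divr_gt0.
have nA : \forall y \near z, [/\ A y,
    `|'D_u (fun y => 'D_v f y) z - 'D_u (fun y => 'D_v f y) y| < e / 2 &
    `|'D_v (fun y => 'D_u f y) z - 'D_v (fun y => 'D_u f y) y| < e / 2].
  have h1 : nbhs z A by exact: open_nbhs_nbhs.
  move/pseudometric_normed_Zmodule.cvgr_dist_lt : cuv => /(_ _ e2) h2.
  move/pseudometric_normed_Zmodule.cvgr_dist_lt : cvu => /(_ _ e2) h3.
  exact: filterS3 (fun y a b c => And3 a b c) h1 h2 h3.
move: nA => /nbhs_normP[d /= d0 hball].
pose m := `|u| + `|v| + 1.
have m0 : 0 < m by rewrite ltr_wpDl // addr_ge0.
(* the parallelogram with sides [t *: u] and [t *: v] is in the ball of radius [d] *)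
pose t := d / (2 * m).
have t0 : 0 < t by rewrite divr_gt0 // mulr_gt0.
have near_ab a b : 0 <= a <= t -> 0 <= b <= t ->
    forall u' v', (u' = u /\ v' = v) \/ (u' = v /\ v' = u) ->
    `|z - (z + a *: u' + b *: v')| < d.
  move=> /andP[a0 at1] /andP[b0 bt] u' v' uv.
  rewrite -addrA opprD addrA subrr add0r normrN.
  apply: (le_lt_trans (ler_normD _ _)); rewrite !normrZ !ger0_norm //.
  have -> : d = 2 * (t * m) by rewrite /t; field; rewrite gt_eqF.
  have : `|u'| + `|v'| < m by case: uv => -[-> ->]; rewrite /m; lra.
  have nu := normr_ge0 u'; have nv := normr_ge0 v'.
  have h1 : a * `|u'| <= t * `|u'| by exact: ler_wpM2r.
  have h2 : b * `|v'| <= t * `|v'| by exact: ler_wpM2r.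
  move=> h3; have : t * (`|u'| + `|v'|) < t * m by rewrite ltr_pM2l.
  have : 0 < t * m by exact: mulr_gt0.
  by rewrite mulrDr; lra.
have ball_ab a b (u' v' : V) := fun ha hb h => hball _ (near_ab a b ha hb u' v' h).
have [a [b [ha hb eab]]] := @second_difference f z u v t t0
  (fun a b ha hb => let: And3 Ay _ _ := ball_ab _ _ u v ha hb (or_introl (conj erefl erefl))
     in hd _ u Ay).
have [c [g [hc hg ecg]]] := @second_difference f z v u t t0
  (fun a b ha hb => let: And3 Ay _ _ := ball_ab _ _ v u ha hb (or_intror (conj erefl erefl))
     in hd _ v Ay).
have [_ _ n1] := ball_ab _ _ u v ha hb (or_introl (conj erefl erefl)).
have [_ n2 _] := ball_ab _ _ v u hc hg (or_intror (conj erefl erefl)).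
have eq12 : 'D_v (fun y => 'D_u f y) (z + a *: u + b *: v) =
            'D_u (fun y => 'D_v f y) (z + c *: v + g *: u).
  apply/(mulIf (lt0r_neq0 t0))/(mulIf (lt0r_neq0 t0)).
  apply: (etrans (esym eab)); apply: etrans ecg.
  by rewrite (addrAC z); move: (f _) (f _) (f _) (f _) => f1 f2 f3 f4; ring.
rewrite eq12 in n1; rewrite -(subrKA ('D_u (fun y => 'D_v f y) (z + c *: v + g *: u))).
apply: (le_trans (ler_normD _ _)); rewrite [leRHS](splitr e); apply: lerD.
  exact: ltW n2.
by rewrite distrC; exact: ltW n1.
Qed.
End Schwarz.

(** * A flat function *)

Section Bump.
Context {R : realType}.
Implicit Types (x : R).

(** The powers of 1/x make the family closed under derivation. *)
Definition flat k x : R := if 0 < x then x^-1 ^+ k * expR (- x^-1) else 0.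

Lemma flat_ge0 k x : 0 <= flat k x.
Proof.
rewrite /flat; case: ifP => // x0.
by rewrite mulr_ge0 ?expR_ge0 // exprn_ge0 // invr_ge0 ltW.
Qed.

Lemma flat_le0 k x : x <= 0 -> flat k x = 0.
Proof. by move=> x0; rewrite /flat ltNge x0. Qed.

Lemma flat0_gt0 x : 0 < x -> 0 < flat 0 x.
Proof. by move=> x0; rewrite /flat x0 expr0 mul1r expR_gt0. Qed.

(** An exponential beats every power.  The quadratic bound yields both continuity
    and derivative zero at the origin. *)
Lemma flat_bound k x : flat k x <= (k.+2)`!%:R * x ^+ 2.
Proof.
have [x0|x0] := ltP 0 x; last first.
  by rewrite flat_le0 // mulr_ge0 // sqr_ge0.
rewrite /flat x0; have [y xy y0] : exists2 y, x = y^-1 & 0 < y.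
  by exists x^-1; rewrite ?invrK // invr_gt0.
rewrite xy invrK {xy x0}.
have f0 : 0 < (k.+2)`!%:R :> R by rewrite ltr0n fact_gt0.
have h : y ^+ k.+2 / k.+2`!%:R <= expR y.
  by apply: le_trans (expR_ge1Dxn k.+1 (ltW y0)); rewrite lerDr.
rewrite expRN ler_pdivrMr ?expR_gt0 // (le_trans _ (ler_wpM2l _ h)) //.
  rewrite [leRHS](_ : _ = y ^+ k) // exprVn (exprS y k.+1) (exprS y k).
  by move: f0; move: (_%:R) => F F0; field; rewrite !gt_eqF.
by rewrite mulr_ge0 ?sqr_ge0 ?(ltW f0).
Qed.

Lemma is_derive_flat k x :
  is_derive x 1 (flat k) (- k%:R * flat k.+1 x + flat k.+2 x).
Proof.
have [x0|x0|x0] := ltgtP 0 x; last first.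
- rewrite -x0 !flat_le0 // mulr0 addr0.
  have lim0 : (fun h => h^-1 *: ((flat k \o shift 0) (h *: (1 : R)) - flat k 0)) @ 0^' --> (0 : R).
    apply/cvgr0Pnorm_le => e e0; near=> h.
    have h0 : h != 0 by near: h; exact: nbhs_dnbhs_neq.
    rewrite /= addr0 (flat_le0 k (lexx 0)) subr0 normrZ normrV ?unitfE // [_%:A]mulr1.
    rewrite (ger0_norm (flat_ge0 _ _)) ler_pdivrMl ?normr_gt0 //.
    apply: (le_trans (flat_bound _ _)).
    rewrite -[h ^+ 2]ger0_norm ?sqr_ge0 // normrX expr2 mulrCA ler_wpM2l //.
    have f0 : 0 < (k.+2)`!%:R :> R by rewrite ltr0n fact_gt0.
    rewrite mulrC -ler_pdivlMr //.
    near: h; apply: dnbhs0_le; exact: divr_gt0.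
  by apply: DeriveDef; [apply/cvg_ex; exists 0 | exact: cvg_lim lim0].
- rewrite !flat_le0 ?(ltW x0) // mulr0 addr0.
  apply: (@near_eq_is_derive _ _ _ (fun=> 0)).
  by near=> y; rewrite flat_le0 //; apply: ltW; near: y; exact: lt_nbhsl.
- refine (@near_eq_is_derive R R R (fun y : R => y^-1 ^+ k * expR (- y^-1)) _ _ _ _ _ _).
    near=> y; rewrite /flat ifT //; near: y; exact: lt_nbhsr.
  rewrite /flat x0.
  have xn0 : x != 0 by rewrite gt_eqF.
  have dV : is_derive x 1 (fun y => y^-1) (- x^-1 ^+ 2).
    apply: DeriveDef; first exact: derivableV.
    by rewrite deriveV // derive_id exprVn [_%:A]mulr1.
  have dE : is_derive x 1 (fun y => expR (- y^-1)) (x^-1 ^+ 2 * expR (- x^-1)).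
    have dN : is_derive x 1 (fun y : R => - y^-1) (- (- x^-1 ^+ 2)) by exact: is_deriveN.
    have h := @is_derive1_comp R expR (fun y : R => - y^-1) x _ _ (is_derive_expR (- x^-1)) dN.
    by apply: is_derive_eq h _; rewrite opprK /GRing.scale /= mulrC.
  have dX : is_derive x 1 (fun y => y^-1 ^+ k) (k%:R * x^-1 ^+ k.-1 * (- x^-1 ^+ 2)).
    have h := @is_deriveX _ _ _ k _ _ _ dV.
    by rewrite exprfctE in h.
  have h := @is_deriveM _ _ _ _ _ _ _ _ dX dE.
  apply: is_derive_eq h _.
  rewrite /GRing.scale /=.
  by case: k {dX} => [|k] /=; rewrite ?exprS -?natr1; ring.
Unshelve. all: by end_near. Qed.

(** By induction on [n] for all [k] at once, since the derivative of [flat k]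
    involves [flat k.+1] and [flat k.+2]. *)
Lemma Ck_flat n k (A : set (model R)) g : open A -> Ck n A g ->
  Ck n A (fun z => flat k (g z)).
Proof.
move=> oA; elim: n k => [|n IH] k hg.
  move=> z Az; apply: (continuous_comp (hg z Az)).
  apply/differentiable_continuous/derivable1_diffP.
  by have [] := is_derive_flat k (g z).
have [dg hdg] := hg.
have df z : differentiable (flat k) (g z).
  by apply/derivable1_diffP; have [] := is_derive_flat k (g z).
split=> [z Az|v]; first by apply: differentiable_comp; [exact: dg|exact: df].
have cf j : Ck n A (fun z => flat j (g z)) := IH j (CkS hg).
apply: (Ck_ext oA (f := fun z =>
    (- k%:R * flat k.+1 (g z) + flat k.+2 (g z)) * 'D_v g z)).
  move=> z Az; rewrite (deriveE _ (dg z Az)) deriveE; last first.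
    exact: differentiable_comp (dg z Az) (df z).
  apply: esym; apply: etrans (congr1 (fun h => h v) (diff_comp (dg z Az) (df z))) _.
  rewrite /= diff1E // /GRing.scale /= mulrC derive1E.
  by have [_ ->] := is_derive_flat k (g z).
apply: CkM (hdg v) => //; apply: CkD (cf _) => //.
by apply: CkM (cf _) => //; exact: Ck_cst.
Qed.
End Bump.

(** * Smooth functions in charts *)

Existing Class complex_atlas.

Section ChartCalculus.
Context {R : realType} {X : topologicalType} {M : charts R X}.
Context {hA : complex_atlas M}.
Notation C := R[i].
Implicit Types (i j l : idx M) (x y : X) (V : set X) (f g : X -> C).

Definition rp i f (z : model R) : R := complex.Re (f (crdV i z)).
Definition ip i f (z : model R) : R := complex.Im (f (crdV i z)).

Lemma crd_imgK i V z : V `<=` dom i -> (crd i @` V) z -> crd i (crdV i z) = z.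
Proof. by move=> Vi [x Vx <-]; rewrite (crdK hA) //; exact: Vi. Qed.

Lemma crdV_img i V z : V `<=` dom i -> (crd i @` V) z -> V (crdV i z).
Proof. by move=> Vi [x Vx <-]; rewrite (crdK hA) //; exact: Vi. Qed.

Lemma crd_img_open i V : open V -> V `<=` dom i -> open (crd i @` V).
Proof.
move=> oV Vi; have -> : crd i @` V = (crd i @` dom i) `&` crdV i @^-1` V.
  apply/seteqP; split=> z.
    by move=> zV; split; [case: zV => x /Vi xi <-; exists x|exact: crdV_img zV].
  by case=> -[x xi <-] /=; rewrite (crdK hA) // => Vx; exists x.
rewrite openE => z [zi zV]; rewrite /interior /=; apply: filterI.
  by apply: open_nbhs_nbhs; split=> //; exact: crd_open.
by apply: (crdV_continuous hA zi); apply: open_nbhs_nbhs.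
Qed.

Lemma smooth_at i V f : smooth_on i V f <-> forall x, V x -> smooth_on i [set x] f.
Proof.
split=> h.
  move=> x Vx n; have [hr hi] := h n.
  by split; [apply: Ck_sub hr|apply: Ck_sub hi] => z [y -> <-]; exists x.
move=> n; split; apply/Ck_at => z [x Vx <-].
  by have [hr _] := h x Vx n; apply: Ck_sub hr => _ ->; exists x.
by have [_ hi] := h x Vx n; apply: Ck_sub hi => _ ->; exists x.
Qed.

Lemma smooth_sub i V V' f : V' `<=` V -> smooth_on i V f -> smooth_on i V' f.
Proof. by move=> VV' /smooth_at h; apply/smooth_at => x /VV'; exact: h. Qed.

(** Derivatives are local, so they are computed on open parts of a chart domain;
    as a class, openness and inclusion are inferred. *)
Class chart_domain (i : idx M) (V : set X) : Prop := ChartDomain {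
  domain_open : open V;
  domain_sub : V `<=` dom i }.

#[global] Instance chart_domain_dom i : chart_domain i (dom i).
Proof. by split; [exact: (dom_open hA)|]. Qed.

Lemma chart_domainI i V : open V -> chart_domain i (V `&` dom i).
Proof. by move=> oV; split; [exact: openI oV (dom_open hA i)|by move=> x []]. Qed.

Section OnOpenSet.
Context {i : idx M} {V : set X} {cV : chart_domain i V}.
Let oV : open V := domain_open.
Let Vi : V `<=` dom i := domain_sub.

Let oI : open (crd i @` V) := crd_img_open oV Vi.

Lemma smooth_ext f g : (forall x, V x -> f x = g x) ->
  smooth_on i V f -> smooth_on i V g.
Proof.
move=> fg h n; have [hr hi] := h n.
by split; [apply: Ck_ext hr|apply: Ck_ext hi] => // z /(crdV_img Vi) /fg ->.
Qed.

Lemma smooth_local f : (forall x, V x ->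
   exists2 V', open V' /\ V' x & smooth_on i V' f) -> smooth_on i V f.
Proof.
move=> h; apply/smooth_at => x /h[V' [_ V'x] hf].
by apply: smooth_sub hf => _ ->.
Qed.

Lemma smooth_cst (c : C) : smooth_on i V (fun=> c).
Proof. by move=> n; split; exact: Ck_cst. Qed.

Lemma smoothD f g : smooth_on i V f -> smooth_on i V g ->
  smooth_on i V (fun x => f x + g x).
Proof.
move=> hf hg n; have [fr fi] := hf n; have [gr gi] := hg n.
split; [apply: Ck_ext (CkD oI fr gr)|apply: Ck_ext (CkD oI fi gi)] => // z _ /=;
  by case: (f _) => ??; case: (g _).
Qed.

Lemma smoothM f g : smooth_on i V f -> smooth_on i V g ->
  smooth_on i V (fun x => f x * g x).
Proof.
move=> hf hg n; have [fr fi] := hf n; have [gr gi] := hg n.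
split.
  apply: Ck_ext (CkD oI (CkM oI fr gr) (CkN oI (CkM oI fi gi))) => // z _ /=.
  by case: (f _) => ??; case: (g _).
apply: Ck_ext (CkD oI (CkM oI fr gi) (CkM oI fi gr)) => // z _ /=.
by case: (f _) => ??; case: (g _).
Qed.

Lemma smoothN f : smooth_on i V f -> smooth_on i V (fun x => - f x).
Proof.
move=> hf; apply: smooth_ext (smoothM (smooth_cst (-1)) hf) => x _.
by rewrite mulN1r.
Qed.

Lemma smoothB f g : smooth_on i V f -> smooth_on i V g ->
  smooth_on i V (fun x => f x - g x).
Proof. by move=> hf hg; apply: smoothD hf (smoothN hg). Qed.

Lemma smooth_conj f : smooth_on i V f -> smooth_on i V (fun x => conjc (f x)).
Proof.
move=> hf n; have [fr fi] := hf n.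
by split; [apply: Ck_ext fr|apply: Ck_ext (CkN oI fi)] => // z _ /=; case: (f _).
Qed.

Lemma smoothV f : (forall x, V x -> f x != 0) -> smooth_on i V f ->
  smooth_on i V (fun x => (f x)^-1).
Proof.
move=> f0 hf n; have [fr fi] := hf n.
have ns := CkD oI (CkM oI fr fr) (CkM oI fi fi).
have ns0 z : (crd i @` V) z -> complex.Re (f (crdV i z)) * complex.Re (f (crdV i z)) +
    complex.Im (f (crdV i z)) * complex.Im (f (crdV i z)) != 0.
  move=> /(crdV_img Vi) /f0; apply: contraNneq => /eqP.
  rewrite -!expr2 paddr_eq0 ?sqr_ge0 // !sqrf_eq0 => /andP[/eqP h1 /eqP h2].
  by rewrite eq_complex h1 h2 !eqxx.
have nsV := CkV oI ns0 ns.
split.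
  apply: Ck_ext (CkM oI fr nsV) => // z _ /=.
  by case: (f _) => ?? /=; rewrite !expr2.
apply: Ck_ext (CkN oI (CkM oI fi nsV)) => // z _ /=.
by case: (f _) => ?? /=; rewrite !expr2.
Qed.

Lemma smooth_sum (I : Type) (s : seq I) (Q : pred I) (F : I -> X -> C) :
  (forall a, Q a -> smooth_on i V (F a)) -> smooth_on i V (fun x => \sum_(a <- s | Q a) F a x).
Proof.
move=> hF; elim: s => [|a s IH].
  by apply: smooth_ext (smooth_cst 0) => x _; rewrite big_nil.
case Qa : (Q a); last by apply: smooth_ext IH => x _; rewrite big_cons Qa.
apply: smooth_ext (smoothD (hF a Qa) IH) => x _; by rewrite big_cons Qa.
Qed.

Lemma smooth_prod (I : Type) (s : seq I) (F : I -> X -> C) :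
  (forall a, smooth_on i V (F a)) -> smooth_on i V (fun x => \prod_(a <- s) F a x).
Proof.
move=> hF; elim: s => [|a s IH].
  by apply: smooth_ext (smooth_cst 1) => x _; rewrite big_nil.
by apply: smooth_ext (smoothM (hF a) IH) => x _; rewrite big_cons.
Qed.

Lemma smooth_pder v f : smooth_on i V f -> smooth_on i V (pder i v f).
Proof.
move=> hf n; have [[_ fr] [_ fi]] := hf n.+1.
split; [apply: Ck_ext (fr v)|apply: Ck_ext (fi v)] => // z Vz /=;
  by rewrite (crd_imgK Vi Vz).
Qed.

Lemma smooth_dz a f : smooth_on i V f -> smooth_on i V (dz i a f).
Proof.
move=> hf; apply: smoothM (smooth_cst _) _; apply: smoothB; first exact: smooth_pder.
by apply: smoothM (smooth_cst _) _; exact: smooth_pder.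
Qed.

Lemma smooth_dzb a f : smooth_on i V f -> smooth_on i V (dzb i a f).
Proof.
move=> hf; apply: smoothM (smooth_cst _) _; apply: smoothD; first exact: smooth_pder.
by apply: smoothM (smooth_cst _) _; exact: smooth_pder.
Qed.

(** * Partial derivatives of complex functions *)

Lemma smooth_diff f x : smooth_on i V f -> V x ->
  differentiable (rp i f) (crd i x) /\ differentiable (ip i f) (crd i x).
Proof.
move=> hf Vx; have [[fr _] [fi _]] := hf 1%N.
by split; [apply: fr|apply: fi]; exists x.
Qed.

Lemma pder_ext v f g x : (forall y, V y -> f y = g y) -> V x ->
  pder i v f x = pder i v g x.
Proof.
move=> fg Vx; rewrite /pder; congr (_ +i* _)%C; apply: near_eq_derive;
  apply: (open_near_eq oI) => [z /(crdV_img Vi) /fg -> //|]; by exists x.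
Qed.

Lemma pder_cst v c x : pder i v (fun=> c) x = 0.
Proof. by rewrite /pder !derive_cst. Qed.

Lemma pderD v f g x : smooth_on i V f -> smooth_on i V g -> V x ->
  pder i v (fun y => f y + g y) x = pder i v f x + pder i v g x.
Proof.
move=> hf hg Vx; have [fr fi] := smooth_diff hf Vx; have [gr gi] := smooth_diff hg Vx.
have [dfr dfi] := (@diff_derivable _ _ _ _ _ v fr, @diff_derivable _ _ _ _ _ v fi).
have [dgr dgi] := (@diff_derivable _ _ _ _ _ v gr, @diff_derivable _ _ _ _ _ v gi).
have re : (fun z => complex.Re (f (crdV i z) + g (crdV i z))) = rp i f + rp i g.
  by apply/funext => z; rewrite !fctE /rp; case: (f _) => ??; case: (g _).
have im : (fun z => complex.Im (f (crdV i z) + g (crdV i z))) = ip i f + ip i g.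
  by apply/funext => z; rewrite !fctE /ip; case: (f _) => ??; case: (g _).
by rewrite /pder re im (deriveD dfr dgr) (deriveD dfi dgi).
Qed.

Lemma pderM v f g x : smooth_on i V f -> smooth_on i V g -> V x ->
  pder i v (fun y => f y * g y) x = pder i v f x * g x + f x * pder i v g x.
Proof.
move=> hf hg Vx; have [fr fi] := smooth_diff hf Vx; have [gr gi] := smooth_diff hg Vx.
have [dfr dfi] := (@diff_derivable _ _ _ _ _ v fr, @diff_derivable _ _ _ _ _ v fi).
have [dgr dgi] := (@diff_derivable _ _ _ _ _ v gr, @diff_derivable _ _ _ _ _ v gi).
have re : (fun z => complex.Re (f (crdV i z) * g (crdV i z))) =
    rp i f * rp i g - ip i f * ip i g.
  by apply/funext => z; rewrite !fctE /rp /ip; case: (f _) => ??; case: (g _).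
have im : (fun z => complex.Im (f (crdV i z) * g (crdV i z))) =
    rp i f * ip i g + ip i f * rp i g.
  by apply/funext => z; rewrite !fctE /rp /ip; case: (f _) => ??; case: (g _).
have Dre : 'D_v (rp i f * rp i g - ip i f * ip i g) (crd i x) =
    rp i f (crd i x) * 'D_v (rp i g) (crd i x) + rp i g (crd i x) * 'D_v (rp i f) (crd i x)
    - (ip i f (crd i x) * 'D_v (ip i g) (crd i x) + ip i g (crd i x) * 'D_v (ip i f) (crd i x)).
  by rewrite (deriveB (derivableM dfr dgr) (derivableM dfi dgi)) (deriveM dfr dgr) (deriveM dfi dgi).
have Dim : 'D_v (rp i f * ip i g + ip i f * rp i g) (crd i x) =
    rp i f (crd i x) * 'D_v (ip i g) (crd i x) + ip i g (crd i x) * 'D_v (rp i f) (crd i x)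
    + (ip i f (crd i x) * 'D_v (rp i g) (crd i x) + rp i g (crd i x) * 'D_v (ip i f) (crd i x)).
  by rewrite (deriveD (derivableM dfr dgi) (derivableM dfi dgr)) (deriveM dfr dgi) (deriveM dfi dgr).
rewrite /pder re im Dre Dim /rp /ip (crdK hA (Vi Vx)).
by case: (f x) => ? ?; case: (g x) => ? ?; congr (_ +i* _)%C; rewrite /=; ring.
Qed.

Lemma pder_conj v f x : smooth_on i V f -> V x ->
  pder i v (fun y => conjc (f y)) x = conjc (pder i v f x).
Proof.
move=> hf Vx; have [fr fi] := smooth_diff hf Vx.
have dfi := @diff_derivable _ _ _ _ _ v fi.
have re : (fun z => complex.Re (conjc (f (crdV i z)))) = rp i f.
  by apply/funext => z; rewrite /rp; case: (f _).
have im : (fun z => complex.Im (conjc (f (crdV i z)))) = - ip i f.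
  by apply/funext => z; rewrite !fctE /ip; case: (f _).
by rewrite /pder re im (deriveN dfi).
Qed.

Lemma pderC u v f x : smooth_on i V f -> V x ->
  pder i u (pder i v f) x = pder i v (pder i u f) x.
Proof.
move=> hf Vx; have [hr hi] := hf 2%N.
have Ix : (crd i @` V) (crd i x) by exists x.
have sw (F : model R -> R) : Ck 2 (crd i @` V) F ->
    'D_u ('D_v F) (crd i x) = 'D_v ('D_u F) (crd i x).
  move=> [dF hF]; apply: (mixed_derivatives_eq (A := crd i @` V)) => //.
  - by move=> y w Iy; split; [exact: dF|exact: (hF w).1].
  - exact: ((hF v).2 u) Ix.
  - exact: ((hF u).2 v _ Ix).
have inner w (F : model R -> R) : forall z, (crd i @` V) z ->
    'D_w F (crd i (crdV i z)) = 'D_w F z.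
  by move=> z Iz; rewrite (crd_imgK Vi Iz).
have swp (F : model R -> R) : Ck 2 (crd i @` V) F ->
    'D_u (fun z => 'D_v F (crd i (crdV i z))) (crd i x) =
    'D_v (fun z => 'D_u F (crd i (crdV i z))) (crd i x).
  move=> hF; apply: etrans (near_eq_derive u (open_near_eq oI (inner v F) Ix)) _.
  apply: etrans (sw F hF) _; apply: esym.
  exact: near_eq_derive v (open_near_eq oI (inner u F) Ix).
have e := congr2 (@Complex R) (swp _ hr) (swp _ hi); exact: e.
Qed.
End OnOpenSet.
End ChartCalculus.

(** * Wirtinger derivatives and change of chart *)

(* Derivatives are made atoms, so that [ring] does not unfold them. *)
Ltac pder_ring :=
  repeat match goal with |- context [pder ?i ?v ?f ?x] =>
    let u := fresh in generalize (pder i v f x); intro u end;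
  repeat match goal with |- context [Complex 0 1] =>
    let u := fresh in generalize (Complex 0 1); intro u end;
  repeat match goal with |- context [GRing.inv ?c] =>
    let u := fresh in generalize (GRing.inv c); intro u end;
  ring.

Section Wirtinger.
Context {R : realType} {X : topologicalType} {M : charts R X}.
Context {hA : complex_atlas M}.
Notation C := R[i].
Implicit Types (i j l : idx M) (x y : X) (V : set X) (f g : X -> C).

Lemma dz_cst i a c x : dz i a (fun=> c : C) x = 0.
Proof. by rewrite /dz !pder_cst mulr0 subr0 mulr0. Qed.

Lemma dzb_cst i a c x : dzb i a (fun=> c : C) x = 0.
Proof. by rewrite /dzb !pder_cst mulr0 addr0 mulr0. Qed.

Section OnOpenSet.
Context {i : idx M} {V : set X} {cV : chart_domain i V}.

Lemma dz_ext a f g x : (forall y, V y -> f y = g y) -> V x ->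
  dz i a f x = dz i a g x.
Proof. by move=> fg Vx; rewrite /dz !(pder_ext _ fg Vx). Qed.

Lemma dzb_ext a f g x : (forall y, V y -> f y = g y) -> V x ->
  dzb i a f x = dzb i a g x.
Proof. by move=> fg Vx; rewrite /dzb !(pder_ext _ fg Vx). Qed.

Lemma dzD a f g x : smooth_on i V f -> smooth_on i V g -> V x ->
  dz i a (fun y => f y + g y) x = dz i a f x + dz i a g x.
Proof. by move=> hf hg Vx; rewrite /dz !(pderD _ hf hg Vx); pder_ring. Qed.

Lemma dzbD a f g x : smooth_on i V f -> smooth_on i V g -> V x ->
  dzb i a (fun y => f y + g y) x = dzb i a f x + dzb i a g x.
Proof. by move=> hf hg Vx; rewrite /dzb !(pderD _ hf hg Vx); pder_ring. Qed.

Lemma dzM a f g x : smooth_on i V f -> smooth_on i V g -> V x ->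
  dz i a (fun y => f y * g y) x = dz i a f x * g x + f x * dz i a g x.
Proof. by move=> hf hg Vx; rewrite /dz !(pderM _ hf hg Vx); pder_ring. Qed.

Lemma dzbM a f g x : smooth_on i V f -> smooth_on i V g -> V x ->
  dzb i a (fun y => f y * g y) x = dzb i a f x * g x + f x * dzb i a g x.
Proof. by move=> hf hg Vx; rewrite /dzb !(pderM _ hf hg Vx); pder_ring. Qed.

Lemma dz_sum a (I : Type) (s : seq I) (F : I -> X -> C) x :
  (forall b, smooth_on i V (F b)) -> V x ->
  dz i a (fun y => \sum_(b <- s) F b y) x = \sum_(b <- s) dz i a (F b) x.
Proof.
move=> hF Vx; elim: s => [|b s IH].
  rewrite big_nil (dz_ext a (g := fun=> 0)) ?dz_cst // => y _.
  by rewrite big_nil.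
rewrite big_cons -IH.
apply: etrans (dz_ext a (g := fun y => F b y + \sum_(c <- s) F c y) _ Vx) _.
  by move=> y _; rewrite big_cons.
by apply: dzD => //; exact: smooth_sum.
Qed.

Lemma dzb_sum a (I : Type) (s : seq I) (F : I -> X -> C) x :
  (forall b, smooth_on i V (F b)) -> V x ->
  dzb i a (fun y => \sum_(b <- s) F b y) x = \sum_(b <- s) dzb i a (F b) x.
Proof.
move=> hF Vx; elim: s => [|b s IH].
  rewrite big_nil (dzb_ext a (g := fun=> 0)) ?dzb_cst // => y _.
  by rewrite big_nil.
rewrite big_cons -IH.
apply: etrans (dzb_ext a (g := fun y => F b y + \sum_(c <- s) F c y) _ Vx) _.
  by move=> y _; rewrite big_cons.
by apply: dzbD => //; exact: smooth_sum.
Qed.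

Let conj_half : conjc (2^-1 : C) = 2^-1.
Proof. by rewrite conjc_inv -[2]/(2%:R) conjc_nat. Qed.

Let conj_half_comb (u v c : C) :
  conjc (2^-1 * (u + c * v)) = 2^-1 * (conjc u + conjc c * conjc v).
Proof.
by rewrite -[in RHS]conj_half -[conjc c * _](rmorphM conjc) -(rmorphD conjc)
  -(rmorphM conjc).
Qed.

Lemma dz_conj a f x : smooth_on i V f -> V x ->
  dz i a (fun y => conjc (f y)) x = conjc (dzb i a f x).
Proof.
move=> hf Vx; rewrite /dz /dzb !(pder_conj _ hf Vx) conj_half_comb -mulNr.
congr (_ * (_ + _ * _)); apply/eqP; rewrite eq_complex /= oppr0 !eqxx //.
Qed.

Lemma dzb_conj a f x : smooth_on i V f -> V x ->
  dzb i a (fun y => conjc (f y)) x = conjc (dz i a f x).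
Proof.
move=> hf Vx; rewrite /dz /dzb !(pder_conj _ hf Vx) -mulNr conj_half_comb.
by congr (_ * (_ + _ * _)); apply/eqP; rewrite eq_complex /= oppr0 opprK !eqxx.
Qed.

Let pder_lin u v w (c d : C) f x : smooth_on i V f -> V x ->
  pder i u (fun y => c * (pder i v f y + d * pder i w f y)) x =
  c * (pder i u (pder i v f) x + d * pder i u (pder i w f) x).
Proof.
move=> hf Vx.
have h k : smooth_on i V (pder i k f) by exact: smooth_pder.
have hc e : smooth_on i V (fun=> e) by exact: smooth_cst.
rewrite (pderM (V := V)) //; last by apply: smoothD => //; exact: smoothM.
rewrite (pderD (V := V)) //; last exact: smoothM.
by rewrite (pderM (V := V)) // !pder_cst; pder_ring.
Qed.

Let swap (u1 u2 v1 v2 : model R) (e c d : C) f x : smooth_on i V f -> V x ->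
  let D w1 w2 k g y := e * (pder i w1 g y + k * pder i w2 g y) in
  D u1 u2 c (D v1 v2 d f) x = D v1 v2 d (D u1 u2 c f) x.
Proof.
move=> hf Vx D; rewrite {}/D !(pder_lin _ _ _ _ _ hf Vx).
rewrite (pderC v1 u1 hf Vx) (pderC v1 u2 hf Vx).
rewrite (pderC v2 u1 hf Vx) (pderC v2 u2 hf Vx).
by pder_ring.
Qed.

Let dzE a : dz i a = fun f x =>
  2^-1 * (pder i (delta_mx 0 a, 0) f x + (- 'i%C) * pder i (0, delta_mx 0 a) f x).
Proof. by apply/funext => f; apply/funext => x; rewrite mulNr. Qed.

Lemma dz_dz a b f x : smooth_on i V f -> V x ->
  dz i a (dz i b f) x = dz i b (dz i a f) x.
Proof. by move=> hf Vx; rewrite !dzE; exact: swap. Qed.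

Lemma dzb_dzb a b f x : smooth_on i V f -> V x ->
  dzb i a (dzb i b f) x = dzb i b (dzb i a f) x.
Proof. by move=> hf Vx; exact: swap. Qed.

Lemma dzb_dz a b f x : smooth_on i V f -> V x ->
  dzb i a (dz i b f) x = dz i b (dzb i a f) x.
Proof. by move=> hf Vx; rewrite !dzE; exact: swap. Qed.
End OnOpenSet.

Section ChangeOfChart.
Context {i l : idx M} {V : set X} {cV : chart_domain i V} {cVl : chart_domain l V}.
Let oV : open V := domain_open (chart_domain := cV).
Let Vi : V `<=` dom i := domain_sub.
Let Vl : V `<=` dom l := domain_sub.

(** A real differential, split into its complex linear and antilinear parts. *)
Let wirtinger_split (a b c d e g : R) :
  ((a * c + b * e) +i* (a * d + b * g))%C =
  (a +i* b)%C * (2^-1 * ((c +i* d)%C - 'i%C * (e +i* g)%C)) +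
  conjc (a +i* b)%C * (2^-1 * ((c +i* d)%C + 'i%C * (e +i* g)%C)).
Proof.
set u := (a +i* b)%C; set P := (c +i* d)%C; set Q := (e +i* g)%C.
have h1 : u + conjc u = 2 * a%:C%C.
  by apply/eqP; rewrite eq_complex /= !(mul0r, mulr0, subr0, subrr, addr0) mulrDl !mul1r !eqxx.
have h2 : (conjc u - u) * 'i%C = 2 * b%:C%C.
  apply/eqP; rewrite eq_complex /= !(mul0r, mulr0, mulr1, subr0, subrr, addr0, sub0r).
  by rewrite mulrDl !mul1r opprD opprK !eqxx.
have -> : ((a * c + b * e) +i* (a * d + b * g))%C = a%:C%C * P + b%:C%C * Q.
  by apply/eqP; rewrite eq_complex /= !(mul0r, subr0, addr0) !eqxx.
have -> : u * (2^-1 * (P - 'i%C * Q)) + conjc u * (2^-1 * (P + 'i%C * Q)) =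
  2^-1 * ((u + conjc u) * P + ((conjc u - u) * 'i%C) * Q).
  by move: u (conjc u) P Q 'i%C (2^-1) {h1 h2} => u u' P Q k h; ring.
by rewrite h1 h2 -!mulrA -mulrDr mulKf ?pnatr_eq0.
Qed.

Let p a z : R := complex.Re (crdC i a (crdV l z)).
Let q a z : R := complex.Im (crdC i a (crdV l z)).

Let phiE z : crd i (crdV l z) = model_of (p^~ z) (q^~ z).
Proof.
by rewrite [LHS]surjective_pairing; congr pair; apply/rowP => a; rewrite mxE.
Qed.

Let crdC_smooth a : smooth_on l V (crdC i a).
Proof.
apply: smooth_sub (crd_holomorphic hA l i a).1 => x Vx.
by split; [exact: Vl|exact: Vi].
Qed.

Let rpE (f : X -> C) (h : C -> R) z : (crd l @` V) z ->
  h (f (crdV i (model_of (p^~ z) (q^~ z)))) = h (f (crdV l z)).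
Proof.
move=> lz; rewrite -phiE (crdK hA) //; exact/Vi/(crdV_img Vl lz).
Qed.

Let phiI z : (crd l @` V) z -> (crd i @` V) (model_of (p^~ z) (q^~ z)).
Proof. by move=> lz; rewrite -phiE; exists (crdV l z) => //; exact: crdV_img lz. Qed.

Lemma smooth_chart f : smooth_on i V f -> smooth_on l V f.
Proof.
move=> hf n; have [fr fi] := hf n.
have cp n' a : Ck n' (crd l @` V) (p a) := (crdC_smooth a n').1.
have cq n' a : Ck n' (crd l @` V) (q a) := (crdC_smooth a n').2.
have oI : open (crd l @` V) by exact: crd_img_open.
split.
  have h := @Ck_comp _ n _ _ p q _ oI phiI (cp n) (cq n) fr.
  by apply: Ck_ext oI _ h => z lz; rewrite /= /rp rpE.
have h := @Ck_comp _ n _ _ p q _ oI phiI (cp n) (cq n) fi.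
by apply: Ck_ext oI _ h => z lz; rewrite /= /ip rpE.
Qed.

(** The chain rule in real coordinates, regrouped by [wirtinger_split]. *)
Lemma pder_chart v f x : smooth_on i V f -> V x -> pder l v f x =
  \sum_a (pder l v (crdC i a) x * dz i a f x + conjc (pder l v (crdC i a) x) * dzb i a f x).
Proof.
move=> hf Vx; have [fr fi] := smooth_diff hf Vx.
have oI : open (crd l @` V) by exact: crd_img_open.
have lx : (crd l @` V) (crd l x) by exists x.
have [dp dq] : (forall a, differentiable (p a) (crd l x)) /\
    (forall a, differentiable (q a) (crd l x)).
  by split=> a; have [] := smooth_diff (crdC_smooth a) Vx.
have ex : model_of (p^~ (crd l x)) (q^~ (crd l x)) = crd i x.
  by rewrite -phiE (crdK hA) //; exact: Vl.
rewrite -ex in fr fi.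
have [_ /(_ v) hr] := @chain_rule _ p q _ _ dp dq fr.
have [_ /(_ v) hi] := @chain_rule _ p q _ _ dp dq fi.
have der (h : C -> R) : 'D_v (fun z => h (f (crdV l z))) (crd l x) =
    'D_v ((fun z => h (f (crdV i z))) \o (fun w => model_of (p^~ w) (q^~ w))) (crd l x).
  apply: near_eq_derive; apply: (open_near_eq oI _ lx) => z lz.
  by rewrite /= rpE.
have {}hr := etrans (der (@complex.Re R)) hr; have {}hi := etrans (der (@complex.Im R)) hi.
rewrite {1}/pder hr hi ex.
have cplx (I : Type) (s : seq I) (u w : I -> R) :
    ((\sum_(a <- s) u a) +i* (\sum_(a <- s) w a))%C = \sum_(a <- s) (u a +i* w a)%C :> C.
  elim: s => [|a s IH]; first by rewrite !big_nil.
  rewrite !big_cons -IH; by apply/eqP; rewrite eq_complex /= !eqxx.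
rewrite -!big_split /= cplx; apply: eq_bigr => a _.
rewrite /dz /dzb -/(p a) -/(q a).
have -> : pder l v (crdC i a) x = ('D_v (p a) (crd l x) +i* 'D_v (q a) (crd l x))%C by [].
have -> : pder i (delta_mx 0 a, 0) f x =
  ('D_(delta_mx 0 a, 0) (rp i f) (crd i x) +i* 'D_(delta_mx 0 a, 0) (ip i f) (crd i x))%C by [].
have -> : pder i (0, delta_mx 0 a) f x =
  ('D_(0, delta_mx 0 a) (rp i f) (crd i x) +i* 'D_(0, delta_mx 0 a) (ip i f) (crd i x))%C by [].
exact: wirtinger_split.
Qed.

Let jac_conj b a x : V x -> dzb l b (crdC i a) x = 0.
Proof.
move=> Vx; have [_ h] := crd_holomorphic hA l i a.
by apply: h; split; [exact: Vl|exact: Vi].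
Qed.

Let comb (c d : C) (u v s t : 'I_3 -> C) :
  c * ((\sum_a (u a * s a + conjc (u a) * t a)) + d * \sum_a (v a * s a + conjc (v a) * t a)) =
  \sum_a (c * (u a + d * v a) * s a + c * (conjc (u a) + d * conjc (v a)) * t a).
Proof.
rewrite mulrDr mulrA !mulr_sumr -big_split /=; apply: eq_bigr => a _.
by move: (conjc _) (conjc _) => ? ?; ring.
Qed.

(** The Wirtinger derivatives transform with the holomorphic Jacobian alone,
    because the derivatives of its coordinates by conjugate variables vanish. *)
Lemma dz_chart b f x : smooth_on i V f -> V x ->
  dz l b f x = \sum_a jac i l x a b * dz i a f x.
Proof.
move=> hf Vx; rewrite {1}/dz !(pder_chart _ hf Vx) -mulNr comb //.
apply: eq_bigr => a _; rewrite mxE mulNr -/(dz l b (crdC i a) x).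
have -> : 2^-1 * (conjc (pder l (delta_mx 0 b, 0) (crdC i a) x) +
    - 'i%C * conjc (pder l (0, delta_mx 0 b) (crdC i a) x)) =
    conjc (dzb l b (crdC i a) x).
  rewrite -(dz_conj b (crdC_smooth a) Vx) /dz -mulNr.
  by rewrite !(pder_conj _ (crdC_smooth a) Vx).
by rewrite jac_conj // conjc0 mul0r addr0.
Qed.

Lemma dzb_chart b f x : smooth_on i V f -> V x ->
  dzb l b f x = \sum_a conjc (jac i l x a b) * dzb i a f x.
Proof.
move=> hf Vx; rewrite {1}/dzb !(pder_chart _ hf Vx) comb //.
apply: eq_bigr => a _; rewrite mxE -/(dzb l b (crdC i a) x).
rewrite jac_conj // mul0r add0r; congr (_ * _).
by rewrite -(dzb_conj b (crdC_smooth a) Vx) /dzb !(pder_conj _ (crdC_smooth a) Vx).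
Qed.
End ChangeOfChart.
End Wirtinger.

(** * Matrices of smooth functions *)

Section MatrixCalculus.
Context {R : realType} {X : topologicalType} {M : charts R X}.
Context {hA : complex_atlas M}.
Notation C := R[i].

Definition smooth_mx m n (i : idx M) (V : set X) (A : X -> 'M[C]_(m, n)) : Prop :=
  forall a b, smooth_on i V (fun x => A x a b).

Definition dz_mx m n (i : idx M) (k : 'I_3) (A : X -> 'M[C]_(m, n)) x : 'M[C]_(m, n) :=
  \matrix_(a, b) dz i k (fun y => A y a b) x.

Lemma smooth_mx_sub m n i (V V' : set X) (A : X -> 'M[C]_(m, n)) :
  V' `<=` V -> smooth_mx i V A -> smooth_mx i V' A.
Proof. by move=> VV' h a b; apply: smooth_sub (h a b). Qed.

Lemma smooth_mx_chart m n i l (V : set X) {cV : chart_domain i V}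
    {cVl : chart_domain l V} (A : X -> 'M[C]_(m, n)) :
  smooth_mx i V A -> smooth_mx l V A.
Proof. by move=> h a b; apply: (smooth_chart (i := i)); exact: h. Qed.

Context {i : idx M} {V : set X} {cV : chart_domain i V}.

Section Basic.
Context {m n : nat}.
Implicit Types (A B : X -> 'M[C]_(m, n)).

Lemma smooth_mx_ext A B : (forall x, V x -> A x = B x) ->
  smooth_mx i V A -> smooth_mx i V B.
Proof. by move=> AB h a b; apply: smooth_ext (h a b) => x /AB ->. Qed.

Lemma smooth_mxD A B : smooth_mx i V A -> smooth_mx i V B ->
  smooth_mx i V (fun x => A x + B x).
Proof.
move=> hA' hB a b; apply: smooth_ext (smoothD (hA' a b) (hB a b)) => x _.
by rewrite mxE.
Qed.

Lemma smooth_mxZ (c : X -> C) A : smooth_on i V c -> smooth_mx i V A ->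
  smooth_mx i V (fun x => c x *: A x).
Proof.
move=> hc hA' a b; apply: smooth_ext (smoothM hc (hA' a b)) => x _.
by rewrite mxE.
Qed.

Lemma smooth_mxN A : smooth_mx i V A -> smooth_mx i V (fun x => - A x).
Proof.
by move=> hA' a b; apply: smooth_ext (smoothN (hA' a b)) => x _; rewrite mxE.
Qed.

Lemma smooth_mx_sum (I : Type) (s : seq I) (F : I -> X -> 'M[C]_(m, n)) :
  (forall k, smooth_mx i V (F k)) -> smooth_mx i V (fun x => \sum_(k <- s) F k x).
Proof.
move=> hF a b; apply: smooth_ext (smooth_sum s (Q := xpredT) (fun k _ => hF k a b)) => x _.
by rewrite summxE.
Qed.

Lemma dzb_mx_ext k A B x : (forall y, V y -> A y = B y) -> V x ->
  dzb_mx i k A x = dzb_mx i k B x.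
Proof.
by move=> AB Vx; apply/matrixP => a b; rewrite !mxE; apply: dzb_ext Vx => y /AB ->.
Qed.

Lemma smooth_dzb_mx k A : smooth_mx i V A -> smooth_mx i V (dzb_mx i k A).
Proof.
move=> hA' a b; apply: smooth_ext (smooth_dzb k (hA' a b)) => x _.
by rewrite mxE.
Qed.

Lemma smooth_dz_mx k A : smooth_mx i V A -> smooth_mx i V (dz_mx i k A).
Proof.
move=> hA' a b; apply: smooth_ext (smooth_dz k (hA' a b)) => x _.
by rewrite mxE.
Qed.

Lemma dzb_mxD k A B x : smooth_mx i V A -> smooth_mx i V B -> V x ->
  dzb_mx i k (fun y => A y + B y) x = dzb_mx i k A x + dzb_mx i k B x.
Proof.
move=> hA' hB Vx; apply/matrixP => a b; rewrite !mxE -(dzbD k (hA' a b) (hB a b) Vx).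
by apply: dzb_ext Vx => y _; rewrite mxE.
Qed.

Lemma dzb_mxZ k (c : X -> C) A x : smooth_on i V c -> smooth_mx i V A -> V x ->
  dzb_mx i k (fun y => c y *: A y) x = dzb i k c x *: A x + c x *: dzb_mx i k A x.
Proof.
move=> hc hA' Vx; apply/matrixP => a b; rewrite !mxE -(dzbM k hc (hA' a b) Vx).
by apply: dzb_ext Vx => y _; rewrite mxE.
Qed.

Lemma dzb_mx_sum k (I : Type) (s : seq I) (F : I -> X -> 'M[C]_(m, n)) x :
  (forall a, smooth_mx i V (F a)) -> V x ->
  dzb_mx i k (fun y => \sum_(a <- s) F a y) x = \sum_(a <- s) dzb_mx i k (F a) x.
Proof.
move=> hF Vx; apply/matrixP => a b; rewrite mxE summxE.
under [RHS]eq_bigr do rewrite mxE.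
rewrite -(dzb_sum k s (fun c => hF c a b) Vx).
by apply: dzb_ext Vx => y _; rewrite summxE.
Qed.

Lemma smooth_tr A : smooth_mx i V A -> smooth_mx i V (fun x => (A x)^T).
Proof. by move=> h a b; apply: smooth_ext (h b a) => x _; rewrite mxE. Qed.

Lemma smooth_conj_mx A : smooth_mx i V A -> smooth_mx i V (fun x => map_mx conjc (A x)).
Proof.
by move=> h a b; apply: smooth_ext (smooth_conj (h a b)) => x _; rewrite mxE.
Qed.
End Basic.

Section Product.
Context {m n p : nat}.
Implicit Types (A : X -> 'M[C]_(m, n)) (B : X -> 'M[C]_(n, p)).

Lemma smooth_mxM A B : smooth_mx i V A -> smooth_mx i V B ->
  smooth_mx i V (fun x => A x *m B x).
Proof.
move=> hA' hB a b.
have h c : smooth_on i V (fun x => A x a c * B x c b) by exact: smoothM.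
apply: smooth_ext (smooth_sum (index_enum 'I_n) (Q := xpredT) (fun c _ => h c)) => x _.
by rewrite mxE.
Qed.

Lemma dz_mxM k A B x : smooth_mx i V A -> smooth_mx i V B -> V x ->
  dz_mx i k (fun y => A y *m B y) x = dz_mx i k A x *m B x + A x *m dz_mx i k B x.
Proof.
move=> hA' hB Vx; apply/matrixP => a b; rewrite !mxE -big_split /=.
have h c : smooth_on i V (fun x => A x a c * B x c b) by exact: smoothM.
have e y : V y -> (A y *m B y) a b = \sum_c A y a c * B y c b by rewrite mxE.
rewrite (dz_ext k e Vx) (dz_sum k _ h Vx); apply: eq_bigr => c _.
by rewrite !mxE (dzM k (hA' a c) (hB c b) Vx).
Qed.

Lemma dzb_mxM k A B x : smooth_mx i V A -> smooth_mx i V B -> V x ->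
  dzb_mx i k (fun y => A y *m B y) x = dzb_mx i k A x *m B x + A x *m dzb_mx i k B x.
Proof.
move=> hA' hB Vx; apply/matrixP => a b; rewrite !mxE -big_split /=.
have h c : smooth_on i V (fun x => A x a c * B x c b) by exact: smoothM.
have e y : V y -> (A y *m B y) a b = \sum_c A y a c * B y c b by rewrite mxE.
rewrite (dzb_ext k e Vx) (dzb_sum k _ h Vx); apply: eq_bigr => c _.
by rewrite !mxE (dzbM k (hA' a c) (hB c b) Vx).
Qed.
End Product.

Section Square.
Context {n : nat}.
Implicit Types (A : X -> 'M[C]_n).

Lemma smooth_mxtrace A : smooth_mx i V A -> smooth_on i V (fun x => \tr (A x)).
Proof. by move=> h; exact: (smooth_sum (index_enum 'I_n) (Q := xpredT) (fun c _ => h c c)). Qed.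

Lemma dzb_mxtrace k A x : smooth_mx i V A -> V x ->
  dzb i k (fun y => \tr (A y)) x = \tr (dzb_mx i k A x).
Proof.
move=> h Vx; rewrite (dzb_sum k _ (fun c => h c c) Vx).
by apply: eq_bigr => c _; rewrite mxE.
Qed.

Lemma smooth_det A : smooth_mx i V A -> smooth_on i V (fun x => \det (A x)).
Proof.
move=> h; apply: (smooth_sum (index_enum _) (Q := xpredT)) => s _.
apply: smoothM; first exact: smooth_cst.
by apply: smooth_prod => a; exact: h.
Qed.

(** Cramer's rule makes the entries of the inverse smooth. *)
Lemma smooth_invmx A : (forall x, V x -> A x \in unitmx) -> smooth_mx i V A ->
  smooth_mx i V (fun x => invmx (A x)).
Proof.
move=> uA h a b.
have hd : smooth_on i V (fun x => (\det (A x))^-1).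
  apply: smoothV (smooth_det h) => x /uA; by rewrite unitmxE unitfE.
suff ha : smooth_on i V (fun x => (\adj (A x)) a b).
  apply: smooth_ext (smoothM hd ha) => x /uA ux.
  by rewrite /invmx ux !mxE.
case: n A h {uA hd} a b => [A _ [] //|n' A h a b].
have hc : smooth_on i V (fun x => (-1) ^+ (b + a) * \det (row' b (col' a (A x)))).
  apply: smoothM; first exact: smooth_cst.
  apply: (smooth_sum (index_enum _) (Q := xpredT)) => s _.
  apply: smoothM; first exact: smooth_cst.
  apply: smooth_prod => c; apply: smooth_ext (h (lift b c) (lift a (s c))) => x _.
  by rewrite !mxE.
by apply: smooth_ext hc => x _; rewrite [RHS]mxE.
Qed.
End Square.
End MatrixCalculus.

(** * The connection with torsion in a chart *)

Existing Class heterotic.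
Existing Class local_potentials.

Section ChartOperators.
Context {R : realType} {X : topologicalType} {M : charts R X} {r : nat}.
Context {hA : complex_atlas M} {B : background M r} {hB : heterotic B}.
Notation C := R[i].
Notation qfib := ('rV[C]_3 * 'M[C]_r * 'cV[C]_3)%type.
Implicit Types (i : idx M) (x y : X) (V : set X) (s : X -> qfib) (W : X -> 'cV[C]_3).

Record smooth_q (i : idx M) (V : set X) (s : X -> qfib) : Prop := SmoothQ {
  smooth_kap : smooth_mx i V (fun x => kap (s x));
  smooth_gam : smooth_mx i V (fun x => gam (s x));
  smooth_tng : smooth_mx i V (fun x => tng (s x)) }.

Section MetricInverse.
Variables (n : nat) (t : idx M -> idx M -> X -> 'M[C]_n) (G : idx M -> X -> 'M[C]_n).
Hypothesis hG : hermitian_metric t G.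

(** By positivity no nonzero row vector is in the kernel. *)
Lemma metric_unit i x : dom i x -> G i x \in unitmx.
Proof.
move=> ix; rewrite -row_free_unit -kermx_eq0; apply/eqP/row_matrixP => a.
rewrite row0; apply/eqP/negPn/negP => v0.
have := metric_pos hG ix v0.
have -> : row a (kermx (G i x)) *m G i x = 0 by rewrite -row_mul mulmx_ker row0.
by rewrite mul0mx mxE ltxx.
Qed.

Lemma smooth_metric i : smooth_mx i (dom i) (G i).
Proof. by move=> a b; exact: metric_smooth hG i a b. Qed.

Lemma smooth_chern i j : smooth_mx i (dom i) (chern i (G i) j).
Proof.
have hi : smooth_mx i (dom i) (fun x => invmx (G i x)).
  by apply: smooth_invmx (@smooth_metric i) => x; exact: metric_unit.
move=> l m.
have h q : smooth_on i (dom i) (fun x => invmx (G i x) q l * dz i j (fun y => G i y m q) x).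
  by apply: smoothM; [exact: hi|apply: smooth_dz; exact: smooth_metric].
apply: smooth_ext (smooth_sum (index_enum _) (Q := xpredT) (fun q _ => h q)) => x _.
by rewrite mxE.
Qed.
End MetricInverse.

Lemma smooth_Gam i j : smooth_mx i (dom i) (Gam B i j).
Proof. exact: smooth_chern (het_metric hB) i j. Qed.

(** The matrix with entries [nabla^+_c W^b]: in the combination of connection
    and torsion only the Christoffel symbols with exchanged lower indices
    survive, so that the connection enters through the matrices [Gam n]. *)
Definition nablap_mx i W x : 'M[C]_3 :=
  \matrix_(b, c) dz i c (fun y => W y b 0) x + \sum_n W x n 0 *: Gam B i n x.

Lemma nablapE i W l m x : nablap B i W l m x = nablap_mx i W x m l.
Proof.
rewrite /nablap /nabla /torsion [RHS]mxE [X in _ = X + _]mxE summxE -addrA -sumrB.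
congr (_ + _); apply: eq_bigr => n _.
by rewrite [RHS]mxE -mulrBl opprB addrCA subrr addr0 mulrC.
Qed.

Lemma opRnablaE i k W x :
  opRnabla B i k W x = \row_j \tr (Rm B i k j x *m nablap_mx i W x).
Proof.
apply/rowP => j; rewrite !mxE; apply: eq_bigr => l _; rewrite mxE.
by apply: eq_bigr => m _; rewrite nablapE.
Qed.

Section OnChartDomain.
Context {i : idx M} {V : set X} {cV : chart_domain i V}.

Let Vi : V `<=` dom i := domain_sub.
Let Gam_V j : smooth_mx i V (Gam B i j).
Proof. by apply: smooth_mx_sub (smooth_Gam i j). Qed.

Lemma smooth_nablap W : smooth_mx i V W -> smooth_mx i V (nablap_mx i W).
Proof.
move=> hW; apply: smooth_mxD.
  by move=> a b; apply: smooth_ext (smooth_dz b (hW a 0)) => x _; rewrite mxE.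
by apply: smooth_mx_sum => n; apply: smooth_mxZ => //; exact: hW.
Qed.

Lemma nablap_ext W W' x : (forall y, V y -> W y = W' y) -> V x ->
  nablap_mx i W x = nablap_mx i W' x.
Proof.
move=> WW Vx; apply: (congr2 +%R); last by apply: eq_bigr => n _; rewrite WW.
by apply/matrixP => a b; rewrite !mxE; apply: dz_ext Vx => y /WW ->.
Qed.

Lemma nablapD W W' x : smooth_mx i V W -> smooth_mx i V W' -> V x ->
  nablap_mx i (fun y => W y + W' y) x = nablap_mx i W x + nablap_mx i W' x.
Proof.
move=> hW hW' Vx; rewrite /nablap_mx addrACA -big_split /=; congr (_ + _).
  apply/matrixP => a b; rewrite !mxE -(dzD b (hW a 0) (hW' a 0) Vx).
  by apply: dz_ext Vx => y _; rewrite mxE.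
by apply: eq_bigr => n _; rewrite mxE scalerDl.
Qed.

Lemma nablapZ (c : C) W x : smooth_mx i V W -> V x ->
  nablap_mx i (fun y => c *: W y) x = c *: nablap_mx i W x.
Proof.
move=> hW Vx; rewrite /nablap_mx scalerDr; congr (_ + _).
  apply/matrixP => a b; rewrite !mxE.
  have hc : smooth_on i V (fun=> c) by exact: smooth_cst.
  have := dzM b hc (hW a 0) Vx; rewrite dz_cst mul0r add0r => <-.
  by apply: dz_ext Vx => y _; rewrite mxE.
by rewrite scaler_sumr; apply: eq_bigr => n _; rewrite mxE scalerA.
Qed.

(** Differentiating the Christoffel symbols in [nabla^+] produces curvature. *)
Lemma dzb_nablap k W x : smooth_mx i V W -> V x ->
  dzb_mx i k (nablap_mx i W) x =
  nablap_mx i (dzb_mx i k W) x + \sum_n W x n 0 *: Rm B i k n x.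
Proof.
move=> hW Vx.
have hs n : smooth_mx i V (fun y => W y n 0 *: Gam B i n y).
  by apply: smooth_mxZ => //; exact: hW.
have hd : smooth_mx i V (fun y => \matrix_(b, c) dz i c (fun y => W y b 0) y).
  by move=> a b; apply: smooth_ext (smooth_dz b (hW a 0)) => y _; rewrite mxE.
rewrite (dzb_mxD k hd (smooth_mx_sum _ hs) Vx) (dzb_mx_sum k _ hs Vx).
rewrite /nablap_mx -addrA -big_split /=; congr (_ + _).
  apply/matrixP => a b; rewrite !mxE.
  have e1 y : V y -> (\matrix_(b, c) dz i c (fun y => W y b 0) y) a b =
     dz i b (fun y => W y a 0) y by rewrite mxE.
  rewrite (dzb_ext k e1 Vx) (dzb_dz k b (hW a 0) Vx).
  by apply: dz_ext Vx => y _; rewrite mxE.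
apply: eq_bigr => n _; rewrite (dzb_mxZ k (hW n 0) (Gam_V n) Vx).
by have -> : dzb_mx i k W x n 0 = dzb i k (fun y => W y n 0) x by rewrite mxE.
Qed.
End OnChartDomain.
End ChartOperators.
Arguments nablap_mx {R X M r} B i W x.

(** * Conjugation of Dbar to dbar in a chart *)

Section ChartConjugation.
Context {R : realType} {X : topologicalType} {M : charts R X} {r : nat}.
Context {hA : complex_atlas M} {B : background M r} {hB : heterotic B}.
Notation C := R[i].
Notation qfib := ('rV[C]_3 * 'M[C]_r * 'cV[C]_3)%type.
Implicit Types (i : idx M) (x y : X) (V : set X) (s : X -> qfib) (W : X -> 'cV[C]_3).

Lemma smooth_Rm i k j : smooth_mx i (dom i) (Rm B i k j).
Proof. by apply: smooth_dzb_mx; exact: smooth_Gam. Qed.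

Lemma smooth_Fm i j k : smooth_mx i (dom i) (Fm B i j k).
Proof.
apply: smooth_mxN; apply: smooth_dzb_mx.
exact: smooth_chern (het_bundle_metric hB) i j.
Qed.

(** The two factors i, of T and of [omega], multiply to -1. *)
Lemma TcompE i j k l x : dom i x -> Tcomp B i j k l x =
  dz i k (fun y => gX B i y j l) x - dz i j (fun y => gX B i y k l) x.
Proof.
move=> ix; rewrite /Tcomp /del !big_ord_recl big_ord0 !ffunE /=.
set K := finfun _.
have e1 : omega B i (omit K ord0) = fun y => 'i%C * gX B i y k l.
  by apply/funext => y; rewrite /omega /form11 !ffunE.
have e2 : omega B i (omit K (lift ord0 ord0)) = fun y => 'i%C * gX B i y j l.
  by apply/funext => y; rewrite /omega /form11 !ffunE.
have hg a b : smooth_on i (dom i) (fun y => gX B i y a b).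
  exact: smooth_metric (het_metric hB) i a b.
have hi : smooth_on i (dom i) (fun=> 'i%C) by exact: smooth_cst.
rewrite e1 e2 (dzM j hi (hg k l) ix) (dzM k hi (hg j l) ix) !dz_cst.
have i2 : 'i%C * 'i%C = -1 :> C.
  apply/eqP; rewrite eq_complex /=.
  by rewrite !(mul0r, mulr0, mulr1, sub0r, addr0, oppr0) !eqxx.
have c1 : (-1) ^+ bump 0 0 = -1 :> C by [].
have alg (u v w : C) : w * w = -1 ->
    w * (1 * (0 * 0 + w * u) + (-1 * (0 + w * v) + 0)) = v - u.
  move=> ww; transitivity (w * w * (u - v)); first ring.
  by rewrite ww mulN1r opprB.
rewrite expr0 c1; move: (dz i j _ x) (dz i k _ x) => u v.
by rewrite -[RHS](alg u v _ i2); ring.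
Qed.

Lemma smooth_Tcomp i j k l : smooth_on i (dom i) (Tcomp B i j k l).
Proof.
have hg a b : smooth_on i (dom i) (fun y => gX B i y a b).
  exact: smooth_metric (het_metric hB) i a b.
apply: smooth_ext (smoothB (smooth_dz k (hg j l)) (smooth_dz j (hg k l))) => x ix.
by rewrite TcompE.
Qed.

Section OnChartDomain.
Context {i : idx M} {V : set X} {cV : chart_domain i V}.
Context {P : potentials M r} {hP : local_potentials B P}.

Let Vi : V `<=` dom i := domain_sub.
Let Gam_V j : smooth_mx i V (Gam B i j).
Proof. by apply: smooth_mx_sub (smooth_Gam i j). Qed.
Let Rm_V k j : smooth_mx i V (Rm B i k j).
Proof. by apply: smooth_mx_sub (smooth_Rm i k j). Qed.
Let Fm_V j k : smooth_mx i V (Fm B i j k).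
Proof. by apply: smooth_mx_sub (smooth_Fm i j k). Qed.
Let T_V j k l : smooth_on i V (Tcomp B i j k l).
Proof. by apply: smooth_sub (smooth_Tcomp i j k l). Qed.
Let A_V a : smooth_mx i V (Apot P i a).
Proof. by move=> b c; apply: smooth_sub (Apot_smooth hP i a b c). Qed.
Let tau_V a b : smooth_on i V (fun x => tau P i x a b).
Proof. by apply: smooth_sub (tau_smooth hP i a b). Qed.

Lemma phi_kapE c W x : phi_kap B P i c W x =
  \row_a (al B * \tr (Apot P i a x *m c x) + \sum_b tau P i x a b * W x b 0
          + al B * \tr (Gam B i a x *m nablap_mx B i W x)).
Proof.
apply/rowP => a; rewrite !mxE; congr (_ + _ * _).
apply: eq_bigr => c' _; rewrite [RHS]mxE; apply: eq_bigr => b _.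
by rewrite nablapE.
Qed.

Lemma smooth_phi_kap c W : smooth_mx i V c -> smooth_mx i V W ->
  smooth_mx i V (phi_kap B P i c W).
Proof.
move=> hc hW o a.
have hal : smooth_on i V (fun=> al B) by exact: smooth_cst.
have h1 : smooth_on i V (fun x => al B * \tr (Apot P i a x *m c x)).
  by apply: smoothM => //; apply: smooth_mxtrace; exact: smooth_mxM.
have h2 b : smooth_on i V (fun x => tau P i x a b * W x b 0) by apply: smoothM.
have h3 : smooth_on i V (fun x => al B * \tr (Gam B i a x *m nablap_mx B i W x)).
  apply: smoothM => //; apply: smooth_mxtrace; apply: smooth_mxM => //.
  exact: smooth_nablap.
have h2s : smooth_on i V (fun x => \sum_b tau P i x a b * W x b 0) by exact: smooth_sum.
apply: smooth_ext (smoothD (smoothD h1 h2s) h3) => x _.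
by rewrite phi_kapE mxE.
Qed.

Lemma smooth_phi_gam W : smooth_mx i V W -> smooth_mx i V (phi_gam P i W).
Proof. by move=> hW; apply: smooth_mx_sum => a; apply: smooth_mxZ. Qed.

Lemma smooth_phi s : smooth_q i V s -> smooth_q i V (phi_coef B P i s).
Proof.
move=> [hk hg ht]; split => //; apply: smooth_mxD => //.
  exact: smooth_phi_kap.
exact: smooth_phi_gam.
Qed.

Lemma smooth_phiV s : smooth_q i V s -> smooth_q i V (phiV_coef B P i s).
Proof.
move=> [hk hg ht].
have hc : smooth_mx i V (fun y => gam (s y) - phi_gam P i (@tng _ _ \o s) y).
  by apply: smooth_mxD => //; apply: smooth_mxN; exact: smooth_phi_gam.
by split => //; apply: smooth_mxD => //; apply: smooth_mxN; exact: smooth_phi_kap.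
Qed.

Lemma smooth_delbar_coef k s : smooth_q i V s -> smooth_q i V (delbar_coef i k s).
Proof. by move=> [hk hg ht]; split; exact: smooth_dzb_mx. Qed.

Lemma smooth_Dbar_coef k s : smooth_q i V s -> smooth_q i V (Dbar_coef B i k s).
Proof.
move=> [hk hg ht]; split; [|apply: smooth_mxD|]; try exact: smooth_dzb_mx.
- have hal : smooth_on i V (fun=> al B) by exact: smooth_cst.
  apply: smooth_mxD; [apply: smooth_mxD; [apply: smooth_mxD|]|].
  + exact: smooth_dzb_mx.
  + apply: smooth_mxZ => // o j.
    have h : smooth_on i V (fun x => \tr (Fm B i j k x *m gam (s x))).
      by apply: smooth_mxtrace; exact: smooth_mxM.
    by apply: smooth_ext h => x _; rewrite mxE.
  + move=> o j.
    have h l : smooth_on i V (fun x => Tcomp B i l j k x * tng (s x) l 0).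
      by apply: smoothM => //; exact: ht.
    apply: smooth_ext (smooth_sum (index_enum _) (Q := xpredT) (fun b _ => h b)) => x _.
    by rewrite mxE.
  + apply: smooth_mxZ => // o j.
    have h : smooth_on i V (fun x => \tr (Rm B i k j x *m nablap_mx B i (@tng _ _ \o s) x)).
      by apply: smooth_mxtrace; apply: smooth_mxM => //; exact: smooth_nablap.
    by apply: smooth_ext h => x _; rewrite opRnablaE mxE.
- by apply: smooth_mx_sum => j; apply: smooth_mxZ.
Qed.

(** The correction terms in [phi] are potentials for the additional terms of
    [Dbar].  The equation for [tau] contains tr(Gam R) and tr(A F) because
    differentiating [nabla^+] produces curvature, and because [Dbar] couples
    the endomorphism component to the tangent one. *)
Lemma delbar_phi k s x : smooth_q i V s -> V x ->
  delbar_coef i k (phi_coef B P i s) x = phi_coef B P i (Dbar_coef B i k s) x.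
Proof.
move=> [hk hg ht] Vx; have ix := Vi Vx.
have [dA dtau] := (fun a => Apot_eq hP a k ix, fun a b => tau_eq hP a b k ix).
set c := fun y => gam (s y); set W := fun y => tng (s y).
have hAc a : smooth_mx i V (fun y => Apot P i a y *m c y) by exact: smooth_mxM.
have hN : smooth_mx i V (nablap_mx B i W) by exact: smooth_nablap.
have hGN a : smooth_mx i V (fun y => Gam B i a y *m nablap_mx B i W y) by exact: smooth_mxM.
have hal : smooth_on i V (fun=> al B) by exact: smooth_cst.
congr (_, _, _).
- have hpk : smooth_mx i V (phi_kap B P i c W) by exact: smooth_phi_kap.
  apply: etrans (dzb_mxD k hk hpk Vx) _.
  rewrite phi_kapE -!addrA; congr (_ + _).
  apply/rowP => a; rewrite !mxE.
  have e y : V y -> phi_kap B P i c W y 0 a = al B * \tr (Apot P i a y *m c y) +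
      \sum_b tau P i y a b * W y b 0 + al B * \tr (Gam B i a y *m nablap_mx B i W y).
    by rewrite phi_kapE mxE.
  have hW b : smooth_on i V (fun y => W y b 0) by exact: ht.
  have h1 : smooth_on i V (fun y => \tr (Apot P i a y *m c y)) by exact: smooth_mxtrace.
  have h3 : smooth_on i V (fun y => \tr (Gam B i a y *m nablap_mx B i W y)) by exact: smooth_mxtrace.
  have h2 b : smooth_on i V (fun y => tau P i y a b * W y b 0) by exact: smoothM.
  have h2s : smooth_on i V (fun y => \sum_b tau P i y a b * W y b 0) by exact: smooth_sum.
  have h1a : smooth_on i V (fun y => al B * \tr (Apot P i a y *m c y)) by exact: smoothM.
  have h3a : smooth_on i V (fun y => al B * \tr (Gam B i a y *m nablap_mx B i W y)) by exact: smoothM.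
  rewrite (dzb_ext k e Vx) (dzbD k (smoothD h1a h2s) h3a Vx) (dzbD k h1a h2s Vx).
  rewrite (dzbM k hal h1 Vx) (dzbM k hal h3 Vx) !dzb_cst !mul0r !add0r.
  rewrite (dzb_sum k _ h2 Vx) (dzb_mxtrace k (hAc a) Vx) (dzb_mxtrace k (hGN a) Vx).
  rewrite (dzb_mxM k (A_V a) hg Vx) (dzb_mxM k (Gam_V a) hN Vx) (dzb_nablap k ht Vx) dA.
  under eq_bigr => b _ do rewrite (dzbM k (tau_V a b) (hW b) Vx) dtau.
  have -> : \sum_l \sum_m Rm B i k a x l m * nablap B i (@tng _ _ \o s) l m x =
      \tr (Rm B i k a x *m nablap_mx B i W x).
    apply: eq_bigr => l _; rewrite [RHS]mxE.
    by apply: eq_bigr => m _; rewrite nablapE.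
  have eg : (@gam _ _ \o Dbar_coef B i k s) x =
      dzb_mx i k c x + \sum_j W x j 0 *: Fm B i j k x by [].
  have -> : nablap_mx B i (@tng _ _ \o Dbar_coef B i k s) x = nablap_mx B i (dzb_mx i k W) x by [].
  have -> : \sum_l Tcomp B i l a k x * (@tng _ _ \o s) x l 0 =
     \sum_b Tcomp B i b a k x * W x b 0 by [].
  have -> : dzb_mx i k (Gam B i a) x = Rm B i k a x by [].
  have -> : \sum_(b < 3) ((Tcomp B i b a k x - al B * \tr (Gam B i a x *m Rm B i k b x)
      + al B * \tr (Apot P i a x *m Fm B i b k x)) * W x b 0
      + tau P i x a b * dzb i k (fun y => W y b 0) x) =
    \sum_b Tcomp B i b a k x * W x b 0
    - al B * \sum_b W x b 0 * \tr (Gam B i a x *m Rm B i k b x)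
    + al B * \sum_b W x b 0 * \tr (Apot P i a x *m Fm B i b k x)
    + \sum_b tau P i x a b * (@tng _ _ \o Dbar_coef B i k s) x b 0.
    rewrite !mulr_sumr -sumrB -!big_split /=; apply: eq_bigr => b _.
    have -> : tng (Dbar_coef B i k s x) b 0 = dzb i k (fun y => W y b 0) x.
      by rewrite /tng /= mxE.
    move: (Tcomp _ _ _ _ _ _) (\tr _) (\tr _) (dzb _ _ _ _) (tau _ _ _ _ _) (W x b 0).
    by move=> ? ? ? ? ? ?; ring.
  rewrite eg -/(c x) -/c -/W -[(@gam _ _ \o s) x]/(c x).
  move: (nablap_mx B i (dzb_mx i k W) x) (nablap_mx B i W x) (Fm B i a k x) (Rm B i k a x)
    (Apot P i a x) (Gam B i a x) (c x) (dzb_mx i k c x) => N' N F Ra A G g dg.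
  rewrite !mulmxDr !mulmx_sumr !mxtraceD !raddf_sum /=.
  under [\sum_(j < 3) \tr (A *m _)]eq_bigr do rewrite -scalemxAr mxtraceZ.
  under [\sum_(j < 3) \tr (G *m _)]eq_bigr do rewrite -scalemxAr mxtraceZ.
  move: (\tr (F *m _)) (\tr (A *m dg)) (\tr (Ra *m _)) (\tr (G *m N')).
  move: (\sum_b Tcomp _ _ _ _ _ _ * _) (\sum_b tau _ _ _ _ _ * _).
  move: (\sum_(b < 3) _ * \tr (A *m _)) (\sum_(b < 3) _ * \tr (G *m _)).
  by move: (al B) => *; ring.
- have hpg : smooth_mx i V (phi_gam P i W) by exact: smooth_phi_gam.
  apply: etrans (dzb_mxD k hg hpg Vx) _.
  have hWA a : smooth_mx i V (fun y => W y a 0 *: Apot P i a y).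
    by apply: smooth_mxZ => //; exact: ht.
  rewrite (dzb_mx_sum k _ hWA Vx) -[gam (Dbar_coef B i k s x)]/(dzb_mx i k c x + _).
  rewrite -addrA; congr (_ + _); rewrite -big_split /=; apply: eq_bigr => a _.
  rewrite (dzb_mxZ k (ht a 0) (A_V a) Vx) dA addrC; congr (_ + _ *: _).
  by rewrite /tng /= mxE.
Qed.
End OnChartDomain.
End ChartConjugation.

(** * Algebra of the chart operators *)

Section ChartAlgebra.
Context {R : realType} {X : topologicalType} {M : charts R X} {r : nat}.
Context {hA : complex_atlas M} {B : background M r} {hB : heterotic B}.
Context {P : potentials M r} {hP : local_potentials B P}.
Context {i : idx M} {V : set X} {cV : chart_domain i V}.
Notation C := R[i].
Notation qfib := ('rV[C]_3 * 'M[C]_r * 'cV[C]_3)%type.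
Implicit Types (x y : X) (s u : X -> qfib) (W : X -> 'cV[C]_3).

Lemma smooth_q_ext s s' : (forall x, V x -> s x = s' x) -> smooth_q i V s -> smooth_q i V s'.
Proof.
move=> e [h1 h2 h3]; split.
- by apply: smooth_mx_ext h1 => x /e ->.
- by apply: smooth_mx_ext h2 => x /e ->.
- by apply: smooth_mx_ext h3 => x /e ->.
Qed.

Lemma smooth_q_lin (c : C) s s' : smooth_q i V s -> smooth_q i V s' ->
  smooth_q i V (fun x => c *: s x + s' x).
Proof.
move=> [h1 h2 h3] [k1 k2 k3].
have hc : smooth_on i V (fun=> c) by exact: smooth_cst.
by split; apply: smooth_mxD => //; exact: smooth_mxZ.
Qed.

Lemma delbar_coef_ext k s s' x : (forall y, V y -> s y = s' y) -> V x ->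
  delbar_coef i k s x = delbar_coef i k s' x.
Proof.
move=> e Vx; apply: (congr2 pair); first apply: (congr2 pair);
  by apply: dzb_mx_ext Vx => y Vy /=; rewrite e.
Qed.

Lemma phi_coef_ext s s' x : (forall y, V y -> s y = s' y) -> V x ->
  phi_coef B P i s x = phi_coef B P i s' x.
Proof.
move=> e Vx; have ex := e x Vx.
rewrite /phi_coef /phi_gam !phi_kapE /= -ex.
have -> // : nablap_mx B i (@tng _ _ \o s) x = nablap_mx B i (@tng _ _ \o s') x.
by apply: nablap_ext Vx => y Vy /=; rewrite e.
Qed.

Lemma phiV_coef_ext s s' x : (forall y, V y -> s y = s' y) -> V x ->
  phiV_coef B P i s x = phiV_coef B P i s' x.
Proof.
move=> e Vx; have ex := e x Vx.
rewrite /phiV_coef /phi_gam !phi_kapE /= -ex.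
have -> // : nablap_mx B i (@tng _ _ \o s) x = nablap_mx B i (@tng _ _ \o s') x.
by apply: nablap_ext Vx => y Vy /=; rewrite e.
Qed.

Lemma delbar_coef_lin k (c : C) s s' x : smooth_q i V s -> smooth_q i V s' -> V x ->
  delbar_coef i k (fun y => c *: s y + s' y) x =
  c *: delbar_coef i k s x + delbar_coef i k s' x.
Proof.
move=> [h1 h2 h3] [k1 k2 k3] Vx.
have hc : smooth_on i V (fun=> c) by exact: smooth_cst.
have lin m n (A A' : X -> 'M[C]_(m, n)) : smooth_mx i V A -> smooth_mx i V A' ->
    dzb_mx i k (fun y => c *: A y + A' y) x = c *: dzb_mx i k A x + dzb_mx i k A' x.
  move=> hA' hA''.
  rewrite (dzb_mxD k (smooth_mxZ hc hA') hA'' Vx) (dzb_mxZ k hc hA' Vx).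
  by rewrite dzb_cst scale0r add0r.
by congr (_, _, _); apply: lin.
Qed.

Lemma phi_coef_lin (c : C) s s' x : smooth_q i V s -> smooth_q i V s' -> V x ->
  phi_coef B P i (fun y => c *: s y + s' y) x =
  c *: phi_coef B P i s x + phi_coef B P i s' x.
Proof.
move=> [h1 h2 h3] [k1 k2 k3] Vx.
have hc : smooth_on i V (fun=> c) by exact: smooth_cst.
have eN : nablap_mx B i (@tng _ _ \o (fun y => c *: s y + s' y)) x =
    c *: nablap_mx B i (@tng _ _ \o s) x + nablap_mx B i (@tng _ _ \o s') x.
  apply: etrans (nablapD (smooth_mxZ hc h3) k3 Vx) _.
  by rewrite (nablapZ c h3 Vx).
rewrite /phi_coef !phi_kapE eN /phi_gam; congr (_, _, _).
  have reassoc (a a' b b' b'' : 'rV[C]_3) : b'' = c *: b + b' ->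
    c *: a + a' + b'' = c *: (a + b) + (a' + b') by move=> ->; rewrite scalerDr addrACA.
  apply: reassoc; apply/rowP => a; rewrite !mxE.
  move: (nablap_mx _ _ _ _) (nablap_mx _ _ _ _) (Gam _ _ _ _) (Apot _ _ _ _) => N1 N2 G A.
  rewrite /= -[gam (c *: s x + s' x)]/(c *: gam (s x) + gam (s' x)).
  rewrite !mulmxDr -!scalemxAr !mxtraceD !mxtraceZ.
  have -> : \sum_b tau P i x a b * tng (c *: s x + s' x) b 0 =
     c * (\sum_b tau P i x a b * tng (s x) b 0) + \sum_b tau P i x a b * tng (s' x) b 0.
    rewrite mulr_sumr -big_split /=; apply: eq_bigr => b _.
    by rewrite /tng /= !mxE; ring.
  move: (\sum_b _) (\sum_b _) (\tr _) (\tr _) (\tr _) (\tr _) (al B) => *; ring.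
rewrite [RHS]/=; set K := \sum_a _; set K1 := \sum_a _; set K2 := \sum_a _.
suff -> : K = c *: K1 + K2 by rewrite scalerDr addrACA.
rewrite scaler_sumr -big_split /=; apply: eq_bigr => a _.
by rewrite /tng /= !mxE scalerDl scalerA.
Qed.

(** The inverse of a linear operator is linear. *)
Lemma phiV_coef_lin (c : C) s s' x : smooth_q i V s -> smooth_q i V s' -> V x ->
  phiV_coef B P i (fun y => c *: s y + s' y) x =
  c *: phiV_coef B P i s x + phiV_coef B P i s' x.
Proof.
move=> hs hs' Vx; have hu : smooth_q i V (phiV_coef B P i s) by exact: smooth_phiV.
have hu' : smooth_q i V (phiV_coef B P i s') by exact: smooth_phiV.
set u := phiV_coef B P i s; set u' := phiV_coef B P i s'.
rewrite -[RHS](congr1 (fun h => h x) (phi_coefK B P i (fun y => c *: u y + u' y))).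
apply: phiV_coef_ext Vx => y Vy; rewrite (phi_coef_lin c hu hu' Vy).
by rewrite !phiV_coefK.
Qed.

Lemma smooth_q0 : smooth_q i V (fun=> 0 : qfib).
Proof. by split=> a b; exact: smooth_cst. Qed.

Lemma phi_coef0 x : V x -> phi_coef B P i (fun=> 0) x = 0.
Proof.
move=> Vx; have h0 := smooth_q0.
have := phi_coef_lin (-1) h0 h0 Vx; rewrite (_ : (fun y => _) = fun=> 0).
  by rewrite scaleN1r addNr.
by apply/funext => y; rewrite scaler0 addr0.
Qed.

Lemma phiV_coef0 x : V x -> phiV_coef B P i (fun=> 0) x = 0.
Proof.
move=> Vx; rewrite -[RHS](congr1 (fun h => h x) (phi_coefK B P i (fun=> 0))).
by apply: phiV_coef_ext Vx => y Vy; rewrite phi_coef0.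
Qed.

(** The intertwining relation solved for [Dbar]: linearity and commutation of the
    operators [Dbar_coef] follow from the same properties of [delbar_coef]. *)
Lemma Dbar_coefE k s x : smooth_q i V s -> V x ->
  Dbar_coef B i k s x = phiV_coef B P i (delbar_coef i k (phi_coef B P i s)) x.
Proof.
move=> hs Vx.
rewrite -[LHS](congr1 (fun h => h x) (phi_coefK B P i (Dbar_coef B i k s))).
by apply: phiV_coef_ext Vx => y Vy; rewrite delbar_phi.
Qed.

Lemma Dbar_phiV k s x : smooth_q i V s -> V x ->
  Dbar_coef B i k (phiV_coef B P i s) x = phiV_coef B P i (delbar_coef i k s) x.
Proof. by move=> hs Vx; rewrite Dbar_coefE ?phiV_coefK //; exact: smooth_phiV. Qed.

Lemma Dbar_coef_ext k s s' x : (forall y, V y -> s y = s' y) -> V x ->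
  Dbar_coef B i k s x = Dbar_coef B i k s' x.
Proof.
move=> e Vx; have ex := e x Vx.
have eN : nablap_mx B i (@tng _ _ \o s) x = nablap_mx B i (@tng _ _ \o s') x.
  by apply: nablap_ext Vx => y Vy /=; rewrite e.
have e1 := congr1 (fun v : qfib => v.1.1) (delbar_coef_ext k e Vx).
have e2 := congr1 (fun v : qfib => v.1.2) (delbar_coef_ext k e Vx).
have e3 := congr1 (fun v : qfib => v.2) (delbar_coef_ext k e Vx).
rewrite /= in e1 e2 e3.
by rewrite /Dbar_coef !opRnablaE eN e1 e2 e3 /opFgam /opT /opFtng /= ex.
Qed.

Lemma Dbar_coef_lin k (c : C) s s' x : smooth_q i V s -> smooth_q i V s' -> V x ->
  Dbar_coef B i k (fun y => c *: s y + s' y) x =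
  c *: Dbar_coef B i k s x + Dbar_coef B i k s' x.
Proof.
move=> hs hs' Vx; rewrite !Dbar_coefE //; last exact: smooth_q_lin.
rewrite -phiV_coef_lin //; try by apply: smooth_delbar_coef; exact: smooth_phi.
apply: phiV_coef_ext Vx => y Vy.
have hp : smooth_q i V (phi_coef B P i s) by exact: smooth_phi.
have hp' : smooth_q i V (phi_coef B P i s') by exact: smooth_phi.
apply: etrans (delbar_coef_lin k c hp hp' Vy).
by apply: delbar_coef_ext Vy => z Vz; exact: phi_coef_lin.
Qed.

Lemma delbar_coefC k l s x : smooth_q i V s -> V x ->
  delbar_coef i k (delbar_coef i l s) x = delbar_coef i l (delbar_coef i k s) x.
Proof.
move=> [h1 h2 h3] Vx.
have sym m n (A : X -> 'M[C]_(m, n)) : smooth_mx i V A ->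
    dzb_mx i k (dzb_mx i l A) x = dzb_mx i l (dzb_mx i k A) x.
  move=> hA'; apply/matrixP => a b; rewrite [LHS]mxE [RHS]mxE.
  have e k' y : V y -> dzb_mx i k' A y a b = dzb i k' (fun z => A z a b) y.
    by rewrite mxE.
  by rewrite (dzb_ext k (e l) Vx) (dzb_ext l (e k) Vx) (dzb_dzb k l (hA' a b) Vx).
exact: (congr2 pair (congr2 pair (sym _ _ _ h1) (sym _ _ _ h2)) (sym _ _ _ h3)).
Qed.

(** This is what makes [Dbar] square to zero. *)
Lemma Dbar_coefC k l s x : smooth_q i V s -> V x ->
  Dbar_coef B i k (Dbar_coef B i l s) x = Dbar_coef B i l (Dbar_coef B i k s) x.
Proof.
move=> hs Vx.
have e k' l' : Dbar_coef B i k' (Dbar_coef B i l' s) x =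
    phiV_coef B P i (delbar_coef i k' (delbar_coef i l' (phi_coef B P i s))) x.
  have hd : smooth_q i V (Dbar_coef B i l' s) by exact: smooth_Dbar_coef.
  apply: etrans (Dbar_coefE k' hd Vx) _.
  apply: phiV_coef_ext Vx => y Vy; apply: delbar_coef_ext Vy => z Vz.
  by apply/esym; exact: delbar_phi.
have hp : smooth_q i V (phi_coef B P i s) by exact: smooth_phi.
apply: etrans (e k l) _; apply: etrans _ (esym (e l k)).
by apply: phiV_coef_ext Vx => y Vy; exact: delbar_coefC.
Qed.
End ChartAlgebra.

(** * Transformation of Chern connections and curvatures *)

Section Jacobians.
Context {R : realType} {X : topologicalType} {M : charts R X}.
Context {hA : complex_atlas M}.
Notation C := R[i].
Implicit Types (i j : idx M) (x y : X) (V : set X).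

Lemma crdC_smooth i j V {cVi : chart_domain i V} {cVj : chart_domain j V} a :
  smooth_on i V (crdC j a).
Proof.
apply: smooth_sub (crd_holomorphic hA i j a).1 => x Vx.
by split; [exact: (domain_sub (chart_domain := cVi))|exact: (domain_sub (chart_domain := cVj))].
Qed.

Lemma smooth_jac i j V {cVi : chart_domain i V} {cVj : chart_domain j V} :
  smooth_mx i V (jac j i).
Proof.
move=> a b; have h : smooth_on i V (dz i b (crdC j a)) by apply: smooth_dz; exact: crdC_smooth.
by apply: smooth_ext h => x _; rewrite mxE.
Qed.

Lemma jac_holomorphic i j V {cVi : chart_domain i V} {cVj : chart_domain j V} k x :
  V x -> dzb_mx i k (jac j i) x = 0.
Proof.
move=> Vx; apply/matrixP => a b; rewrite !mxE.
have e y : V y -> jac j i y a b = dz i b (crdC j a) y by rewrite mxE.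
have hs : smooth_on i V (crdC j a) by exact: crdC_smooth.
rewrite (dzb_ext k e Vx) (dzb_dz k b hs Vx).
have z y : V y -> dzb i k (crdC j a) y = 0.
  move=> Vy; apply: (crd_holomorphic hA i j a).2.
  by split; [exact: (domain_sub (chart_domain := cVi))|exact: (domain_sub (chart_domain := cVj))].
by rewrite (dz_ext b z Vx) dz_cst.
Qed.

Lemma jac_cocycle i j (l : idx M) x : dom i x -> dom j x -> dom l x ->
  jac i j x *m jac j l x = jac i l x.
Proof.
move=> ix jx lx; apply/matrixP => a b; rewrite !mxE.
pose V := dom i `&` dom j `&` dom l.
have oV : open V by do 2 (apply: openI; last exact: dom_open hA _); exact: dom_open hA _.
have ci : chart_domain i V by split=> // y [[]].
have cj : chart_domain j V by split=> // y [[]].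
have cl : chart_domain l V by split=> // y [].
have hs : smooth_on j V (crdC i a) by exact: crdC_smooth.
rewrite (dz_chart (i := j) b hs (conj (conj ix jx) lx)).
by apply: eq_bigr => c _; rewrite !mxE mulrC.
Qed.

Lemma pder_crdC i a v x : dom i x ->
  pder i v (crdC i a) x = (v.1 0 a +i* v.2 0 a)%C.
Proof.
move=> ix.
have lin (g : model R -> R) : (forall (h : R) z, g (h *: v + z) = h * g v + g z) ->
    'D_v (fun z => g (crd i (crdV i z))) (crd i x) = g v.
  move=> hg.
  have e z : (crd i @` dom i) z -> g (crd i (crdV i z)) = g z.
    by move=> iz; rewrite (crd_imgK _ iz).
  have Ix : (crd i @` dom i) (crd i x) by exists x.
  have oI : open (crd i @` dom i) by exact: crd_open.
  rewrite (near_eq_derive v (open_near_eq oI e Ix)).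
  apply: cvg_lim => //; apply: cvg_near_cst.
  near=> h; rewrite /= hg addrK /GRing.scale /= mulKf //.
  by near: h; exact: nbhs_dnbhs_neq.
rewrite /pder; congr (_ +i* _)%C.
  by apply: (lin (fun z => z.1 0 a)) => // h z; rewrite !mxE.
by apply: (lin (fun z => z.2 0 a)) => // h z; rewrite !mxE.
Unshelve. all: by end_near. Qed.

Lemma jac_id i x : dom i x -> jac i i x = 1%:M.
Proof.
move=> ix; apply/matrixP => a b; rewrite !mxE /dz !pder_crdC //=.
have -> : (delta_mx 0 b : 'rV[R]_3) 0 a = (a == b)%:R by rewrite mxE.
rewrite mxE; have n2 : 2 != 0 :> C by rewrite pnatr_eq0.
have -> : 'i%C * (0 +i* (a == b)%:R)%C = - ((a == b)%:R +i* 0)%C :> C.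
  by apply/eqP; rewrite eq_complex /= !(mul0r, mulr0, mul1r, sub0r, addr0, oppr0) !eqxx.
set d := (_ +i* _)%C; rewrite opprK; have -> : 2^-1 * (d + d) = d.
  by rewrite -[d + d]mulr2n -[d *+ 2]mulr_natl mulKf.
by rewrite /d; case: (a == b).
Qed.

Section Bundle.
Variables (n : nat) (t : idx M -> idx M -> X -> 'M[C]_n) (G : idx M -> X -> 'M[C]_n).
Hypothesis hG : hermitian_metric t G.
Variables (i j : idx M) (V : set X).
Context {cVi : chart_domain i V} {cVj : chart_domain j V}.
Hypothesis smt : smooth_mx i V (t i j).
Hypothesis smt' : smooth_mx i V (t j i).
Hypothesis tt' : forall x, V x -> t i j x *m t j i x = 1%:M.
Hypothesis holt : forall k x, V x -> dzb_mx i k (t i j) x = 0.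
Hypothesis holt' : forall k x, V x -> dzb_mx i k (t j i) x = 0.

Let Vi x : V x -> dom i x. Proof. exact: domain_sub. Qed.
Let Vj x : V x -> dom j x. Proof. exact: domain_sub. Qed.
Let sG : smooth_mx j V (G j).
Proof. by apply: smooth_mx_sub (smooth_metric hG j) => x; exact: Vj. Qed.

Lemma dz_mx_chart m p (A : X -> 'M[C]_(m, p)) k x : smooth_mx j V A -> V x ->
  dz_mx i k A x = \sum_l jac j i x l k *: dz_mx j l A x.
Proof.
move=> hs Vx; apply/matrixP => a b; rewrite [LHS]mxE summxE (dz_chart k (hs a b) Vx).
by apply: eq_bigr => l _; rewrite [RHS]mxE; congr (_ * _); rewrite mxE.
Qed.

Lemma dzb_mx_chart m p (A : X -> 'M[C]_(m, p)) k x : smooth_mx j V A -> V x ->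
  dzb_mx i k A x = \sum_l conjc (jac j i x l k) *: dzb_mx j l A x.
Proof.
move=> hs Vx; apply/matrixP => a b; rewrite [LHS]mxE summxE (dzb_chart k (hs a b) Vx).
by apply: eq_bigr => l _; rewrite [RHS]mxE; congr (_ * _); rewrite mxE.
Qed.

Lemma chernE (l : idx M) k (H : X -> 'M[C]_n) x :
  chern l H k x = (dz_mx l k H x *m invmx (H x))^T.
Proof.
apply/matrixP => a b; rewrite !mxE; apply: eq_bigr => q _.
by rewrite mulrC; congr (_ * _); rewrite mxE.
Qed.

Let gauge_algebra (D D' T T' H H' S : 'M[C]_n) : T' *m T = 1%:M -> H' *m H = 1%:M ->
  (D *m H + T *m D') *m S = (D *m T' + T *m (D' *m H') *m T') *m (T *m H *m S).
Proof.
move=> hT hH; rewrite !mulmxA; congr (_ *m S).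
rewrite mulmxDl -[D *m T' *m T]mulmxA hT mulmx1 -[_ *m T' *m T]mulmxA hT mulmx1.
by rewrite mulmxDl -[_ *m H' *m H]mulmxA hH mulmx1.
Qed.

(** Differentiate the transformation law of the metric.  The conjugate transition
    matrix is antiholomorphic and is not differentiated; the derivative of the
    other one gives the inhomogeneous term. *)
Lemma chern_transition k x : V x -> chern i (G i) k x =
  t i j x *m dz_mx i k (t j i) x +
  \sum_l jac j i x l k *: (t i j x *m chern j (G j) l x *m t j i x).
Proof.
move=> Vx; have [ix jx] := (Vi Vx, Vj Vx).
have [ui uj] := (metric_unit hG ix, metric_unit hG jx).
have -> : \sum_l jac j i x l k *: (t i j x *m chern j (G j) l x *m t j i x) =
   ((t j i x)^T *m (dz_mx i k (G j) x *m invmx (G j x)) *m (t i j x)^T)^T.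
  rewrite (dz_mx_chart k sG Vx) mulmx_suml mulmx_sumr mulmx_suml raddf_sum.
  apply: eq_bigr => l _; rewrite /= -!scalemxAl -scalemxAr -scalemxAl chernE.
  have trZ (c : C) (A : 'M[C]_n) : (c *: A)^T = c *: A^T by exact: linearZ.
  by rewrite trZ !trmx_mul !trmxK !mulmxA.
rewrite chernE -[_ *m dz_mx i k (t j i) x]trmxK -linearD /=; congr (_^T).
rewrite trmx_mul; set E := _ + _; suff -> : dz_mx i k (G i) x = E *m G i x by rewrite mulmxK.
have hT : smooth_mx i V (fun y => (t j i y)^T) by exact: smooth_tr.
have hc : smooth_mx i V (fun y => map_mx conjc (t j i y)) by exact: smooth_conj_mx.
have sGi : smooth_mx i V (G j) by exact: smooth_mx_chart sG.
have e y : V y -> G i y = (t j i y)^T *m G j y *m map_mx conjc (t j i y).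
  by move=> Vy; rewrite (metric_transition hG (Vj Vy) (Vi Vy)).
have hTG : smooth_mx i V (fun y => (t j i y)^T *m G j y) by exact: smooth_mxM.
have dc : dz_mx i k (fun y => map_mx conjc (t j i y)) x = 0.
  apply/matrixP => a b; rewrite !mxE.
  have e' y : V y -> map_mx conjc (t j i y) a b = conjc (t j i y a b) by rewrite mxE.
  rewrite (dz_ext k e' Vx) (dz_conj k (smt' a b) Vx).
  have := holt' k Vx => /matrixP /(_ a b); rewrite !mxE => ->.
  by rewrite conjc0.
have dext : dz_mx i k (G i) x = dz_mx i k (fun y => (t j i y)^T *m G j y *m map_mx conjc (t j i y)) x.
  by apply/matrixP => a b; rewrite [LHS]mxE [RHS]mxE; apply: dz_ext Vx => y /e ->.
rewrite dext (dz_mxM k hTG hc Vx) dc mulmx0 addr0 (dz_mxM k hT sGi Vx) e //.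
have tr1 : (t i j x)^T *m (t j i x)^T = 1%:M by rewrite -trmx_mul (mulmx1C (tt' Vx)) trmx1.
have -> : dz_mx i k (fun y => (t j i y)^T) x = (dz_mx i k (t j i) x)^T.
  apply/matrixP => a b; rewrite !mxE; apply: dz_ext Vx => y _; by rewrite mxE.
exact: gauge_algebra (mulVmx uj).
Qed.

(** The inhomogeneous term in the transformation law of the connection is
    holomorphic, so it disappears. *)
Lemma curv_transition q k x : V x -> curv i (G i) q k x =
  \sum_l \sum_m (jac j i x l k * conjc (jac j i x m q)) *:
    (t i j x *m curv j (G j) m l x *m t j i x).
Proof.
move=> Vx.
have hch l : smooth_mx j V (chern j (G j) l).
  by apply: smooth_mx_sub (smooth_chern hG j l) => y; exact: Vj.
have hchi l : smooth_mx i V (chern j (G j) l) by exact: smooth_mx_chart (hch l).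
have hJ : smooth_mx i V (jac j i) by exact: smooth_jac.
have h2 l : smooth_mx i V (fun y => t i j y *m chern j (G j) l y) by exact: smooth_mxM.
have h3 l : smooth_mx i V (fun y => t i j y *m chern j (G j) l y *m t j i y) by exact: smooth_mxM.
have h4 l : smooth_mx i V (fun y => jac j i y l k *: (t i j y *m chern j (G j) l y *m t j i y)).
  by apply: smooth_mxZ => //; exact: hJ.
have h5 : smooth_mx i V (fun y => \sum_l jac j i y l k *: (t i j y *m chern j (G j) l y *m t j i y)).
  exact: smooth_mx_sum.
have hd : smooth_mx i V (dz_mx i k (t j i)) by exact: smooth_dz_mx.
have h1 : smooth_mx i V (fun y => t i j y *m dz_mx i k (t j i) y) by exact: smooth_mxM.
have dd : dzb_mx i q (dz_mx i k (t j i)) x = 0.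
  apply/matrixP => a b; rewrite [LHS]mxE.
  have e y : V y -> dz_mx i k (t j i) y a b = dz i k (fun z => t j i z a b) y by rewrite mxE.
  rewrite (dzb_ext q e Vx) (dzb_dz q k (smt' a b) Vx).
  have z y : V y -> dzb i q (fun z => t j i z a b) y = 0.
    by move=> Vy; have := holt' q Vy => /matrixP /(_ a b); rewrite !mxE.
  by rewrite (dz_ext k z Vx) dz_cst mxE.
rewrite [LHS](dzb_mx_ext q (fun y => @chern_transition k y) Vx).
rewrite (dzb_mxD q h1 h5 Vx) (dzb_mxM q smt hd Vx) holt // dd mul0mx mulmx0 addr0 add0r.
rewrite (dzb_mx_sum q _ h4 Vx); apply: eq_bigr => l _.
rewrite (dzb_mxZ q (hJ l k) (h3 l) Vx) (dzb_mxM q (h2 l) smt' Vx) (dzb_mxM q smt (hchi l) Vx).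
rewrite holt // holt' // mul0mx mulmx0 add0r addr0.
have -> : dzb i q (fun y => jac j i y l k) x = 0.
  have h0 : dzb_mx i q (jac j i) x = 0 by exact: (jac_holomorphic q Vx).
  by move/matrixP: h0 => /(_ l k); rewrite [X in X = _]mxE [X in _ = X]mxE.
rewrite scale0r add0r (dzb_mx_chart q (hch l) Vx) mulmx_sumr mulmx_suml scaler_sumr.
by apply: eq_bigr => m _; rewrite -scalemxAr -scalemxAl scalerA.
Qed.
End Bundle.
End Jacobians.

(** * Transformation of the connection with torsion *)

Section ConnectionCovariance.
Context {R : realType} {X : topologicalType} {M : charts R X} {r : nat}.
Context {hA : complex_atlas M} {B : background M r} {hB : heterotic B}.
Notation C := R[i].
Notation qfib := ('rV[C]_3 * 'M[C]_r * 'cV[C]_3)%type.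
Implicit Types (i j : idx M) (x y : X) (s : X -> qfib).

(** From the frames of the chart [j] to those of the chart [i]. *)
Definition qtrans (j i : idx M) x (v : qfib) : qfib :=
  (kap v *m jac j i x, tE B i j x *m gam v *m tE B j i x, jac i j x *m tng v).

Context {i j : idx M} {V : set X} {cVi : chart_domain i V} {cVj : chart_domain j V}.

Let Vi x : V x -> dom i x. Proof. exact: domain_sub. Qed.
Let Vj x : V x -> dom j x. Proof. exact: domain_sub. Qed.
Let VI : V `<=` dom i `&` dom j.
Proof. by move=> x Vx; split; [exact: Vi|exact: Vj]. Qed.

Lemma jacK x : V x -> jac i j x *m jac j i x = 1%:M.
Proof.
by move=> Vx; have [ix jx] := (Vi Vx, Vj Vx); rewrite jac_cocycle // jac_id.
Qed.

Lemma jacVK x : V x -> jac j i x *m jac i j x = 1%:M.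
Proof. by move=> /jacK /mulmx1C. Qed.

Let sJ : smooth_mx i V (jac j i). Proof. exact: smooth_jac. Qed.

Lemma dzb_mx_eq0_chart m n (A : X -> 'M[C]_(m, n)) k x : smooth_mx j V A ->
  (forall l, dzb_mx j l A x = 0) -> V x -> dzb_mx i k A x = 0.
Proof.
move=> hs h0 Vx; rewrite (dzb_mx_chart (i := i) k hs Vx) big1 // => l _.
by rewrite h0 scaler0.
Qed.

Lemma smooth_jacV : smooth_mx i V (jac i j).
Proof. by apply: (smooth_mx_chart (i := j)); exact: smooth_jac. Qed.
Let sK := smooth_jacV.

Lemma jacV_holomorphic k x : V x -> dzb_mx i k (jac i j) x = 0.
Proof.
move=> Vx; apply: dzb_mx_eq0_chart (Vx); first exact: smooth_jac.
by move=> l; exact: (jac_holomorphic l Vx).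
Qed.

Lemma smooth_tE : smooth_mx i V (tE B i j).
Proof.
by move=> a b; apply: smooth_sub (bundle_holomorphic (het_bundle hB) i j a b).1.
Qed.

Lemma tE_holomorphic k x : V x -> dzb_mx i k (tE B i j) x = 0.
Proof.
move=> Vx; apply/matrixP => a b; rewrite !mxE.
by apply: (bundle_holomorphic (het_bundle hB) i j a b).2; exact: VI.
Qed.

Lemma smooth_tEV : smooth_mx i V (tE B j i).
Proof.
apply: (smooth_mx_chart (i := j)) => a b.
apply: smooth_sub (bundle_holomorphic (het_bundle hB) j i a b).1 => x Vx.
by split; [exact: Vj|exact: Vi].
Qed.

Lemma tEV_holomorphic k x : V x -> dzb_mx i k (tE B j i) x = 0.
Proof.
move=> Vx; apply: dzb_mx_eq0_chart (Vx).
  move=> a b; apply: smooth_sub (bundle_holomorphic (het_bundle hB) j i a b).1 => y Vy.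
  by split; [exact: Vj|exact: Vi].
move=> l; apply/matrixP => a b; rewrite !mxE.
by apply: (bundle_holomorphic (het_bundle hB) j i a b).2; split; [exact: Vj|exact: Vi].
Qed.

Lemma tEK x : V x -> tE B i j x *m tE B j i x = 1%:M.
Proof.
move=> Vx; have [ix jx] := (Vi Vx, Vj Vx).
by rewrite (bundle_cocycle (het_bundle hB)) // (bundle_id (het_bundle hB)).
Qed.

Lemma Gam_transition k x : V x -> Gam B i k x =
  jac i j x *m dz_mx i k (jac j i) x +
  \sum_l jac j i x l k *: (jac i j x *m Gam B j l x *m jac j i x).
Proof.
move=> Vx; apply: (chern_transition (het_metric hB) (V := V)) => //.
- exact: jacK.
- by move=> k' y Vy; exact: (jac_holomorphic k' Vy).
Qed.

Lemma Rm_transition q k x : V x -> Rm B i q k x =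
  \sum_l \sum_m (jac j i x l k * conjc (jac j i x m q)) *:
    (jac i j x *m Rm B j m l x *m jac j i x).
Proof.
move=> Vx; apply: (curv_transition (het_metric hB) (V := V)) => //.
- exact: jacK.
- by move=> k' y Vy; exact: (jacV_holomorphic k' Vy).
- by move=> k' y Vy; exact: (jac_holomorphic k' Vy).
Qed.

Lemma Fm_transition k q x : V x -> Fm B i k q x =
  \sum_l \sum_m (jac j i x l k * conjc (jac j i x m q)) *:
    (tE B i j x *m Fm B j l m x *m tE B j i x).
Proof.
move=> Vx; rewrite /Fm (curv_transition (het_bundle_metric hB) (V := V) (j := j)) //.
- rewrite -sumrN; apply: eq_bigr => l _; rewrite -sumrN; apply: eq_bigr => m _.
  by rewrite mulmxN mulNmx scalerN.
- exact: smooth_tE.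
- exact: smooth_tEV.
- exact: tEK.
- by move=> k' y Vy; exact: (tE_holomorphic k' Vy).
- by move=> k' y Vy; exact: (tEV_holomorphic k' Vy).
Qed.

(** Second derivatives of the coordinates are symmetric. *)
Lemma dz_jac_sym a b c x : V x ->
  dz i a (fun y => jac j i y c b) x = dz i b (fun y => jac j i y c a) x.
Proof.
move=> Vx; have hs : smooth_on i V (crdC j c) by exact: crdC_smooth.
have e b' y : V y -> jac j i y c b' = dz i b' (crdC j c) y by rewrite mxE.
by rewrite (dz_ext a (e b) Vx) (dz_ext b (e a) Vx) (dz_dz a b hs Vx).
Qed.

Let recombine (E E' K J A A' : 'M[C]_3) : E + E' = 0 ->
  (E + K *m A *m J) + (E' + K *m A' *m J) = K *m (A + A') *m J.
Proof. by move=> e; rewrite addrACA e add0r mulmxDr mulmxDl. Qed.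

Let cancel_col (D K J E : 'M[C]_3) (u w : 'cV[C]_3) b : w = J *m u ->
  D *m J + K *m E = 0 -> (D *m w) b 0 + (K *m E *m u) b 0 = 0.
Proof.
move=> -> e; have := congr1 (fun A : 'M[C]_3 => (A *m u) b 0) e.
by rewrite mul0mx mulmxDl mulmxA mxE => ->; rewrite mxE.
Qed.

(** Tensoriality of [nabla^+]: the derivative of the Jacobian and the
    inhomogeneous term of the connection combine to the derivative of the
    constant matrix [jac i j *m jac j i]. *)
Lemma nablap_transition (W : X -> 'cV[C]_3) x : smooth_mx j V W -> V x ->
  nablap_mx B i (fun y => jac i j y *m W y) x =
  jac i j x *m nablap_mx B j W x *m jac j i x.
Proof.
move=> hW Vx; have hWi : smooth_mx i V W by exact: smooth_mx_chart hW.
pose U x : 'cV[C]_3 := jac i j x *m W x.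
have WU : W x = jac j i x *m U x by rewrite mulmxA jacVK // mul1mx.
have dKJ c : dz_mx i c (jac i j) x *m jac j i x + jac i j x *m dz_mx i c (jac j i) x = 0.
  rewrite -(dz_mxM c sK sJ Vx); apply/matrixP => a b; rewrite !mxE.
  have e y : V y -> (jac i j y *m jac j i y) a b = (1%:M : 'M[C]_3) a b by move=> /jacK ->.
  by rewrite (dz_ext c e Vx) dz_cst.
have hD : \matrix_(b, c) dz i c (fun y => U y b 0) x =
    \matrix_(b, c) (dz_mx i c (jac i j) x *m W x) b 0 +
    jac i j x *m (\matrix_(b, c) dz j c (fun y => W y b 0) x) *m jac j i x.
  apply/matrixP => b c; rewrite [LHS]mxE [RHS]mxE [X in _ = X + _]mxE.
  have -> : dz i c (fun y => U y b 0) x = dz_mx i c U x b 0 by rewrite mxE.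
  rewrite (dz_mxM c sK hWi Vx) [LHS]mxE; congr (_ + _).
  rewrite (dz_mx_chart c hW Vx) mulmx_sumr summxE [RHS]mxE; apply: eq_bigr => l _.
  rewrite -scalemxAr mxE mulrC; congr (_ * _).
  by rewrite !mxE; apply: eq_bigr => m _; rewrite !mxE.
have hC (u : 'cV[C]_3) : W x = jac j i x *m u -> \sum_n u n 0 *: Gam B i n x =
    \matrix_(b, c) (jac i j x *m dz_mx i c (jac j i) x *m u) b 0 +
    jac i j x *m (\sum_l W x l 0 *: Gam B j l x) *m jac j i x.
  move=> Wu.
  apply: etrans (eq_bigr _ (fun n _ => etrans
    (congr1 (fun A => u n 0 *: A) (Gam_transition n Vx)) (scalerDr _ _ _))) _.
  rewrite big_split /=; congr (_ + _).
    apply/matrixP => b c; rewrite summxE mxE -mulmxA mxE.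
    under eq_bigr => n _ do rewrite mxE mxE mulr_sumr.
    rewrite exchange_big /=; apply: eq_bigr => m _.
    rewrite [X in _ = _ * X]mxE mulr_sumr; apply: eq_bigr => n _.
    have h : dz_mx i n (jac j i) x m c = dz_mx i c (jac j i) x m n.
      by rewrite [LHS]mxE [RHS]mxE; exact: dz_jac_sym.
    apply: etrans (congr1 (fun z => u n 0 * (jac i j x b m * z)) h) _.
    exact: (etrans (mulrCA _ _ _) (congr1 (fun z => jac i j x b m * z) (mulrC _ _))).
  under eq_bigr => n _ do rewrite scaler_sumr.
  rewrite exchange_big /= mulmx_sumr mulmx_suml; apply: eq_bigr => l _.
  under eq_bigr => n _ do rewrite scalerA.
  rewrite -scaler_suml -scalemxAr -scalemxAl Wu; congr (_ *: _).
  by rewrite mxE; apply: eq_bigr => n _; rewrite mulrC.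
apply: etrans (congr2 +%R hD (hC (U x) WU)) _; apply: recombine.
apply/matrixP => b c; rewrite [LHS]mxE [X in X + _]mxE [X in _ + X]mxE [RHS]mxE.
exact: cancel_col WU (dKJ c).
Qed.
End ConnectionCovariance.

(** * Covariance of Dbar *)

Section OperatorCovariance.
Context {R : realType} {X : topologicalType} {M : charts R X} {r : nat}.
Context {hA : complex_atlas M} {B : background M r} {hB : heterotic B}.
Notation C := R[i].
Notation qfib := ('rV[C]_3 * 'M[C]_r * 'cV[C]_3)%type.
Implicit Types (i j : idx M) (x y : X) (s : X -> qfib).
Context {i j : idx M} {V : set X} {cVi : chart_domain i V} {cVj : chart_domain j V}.

Let Vi x : V x -> dom i x. Proof. exact: domain_sub. Qed.
Let Vj x : V x -> dom j x. Proof. exact: domain_sub. Qed.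
Let sJ : smooth_mx i V (jac j i). Proof. exact: smooth_jac. Qed.

(** The derivative of the Jacobian drops out of [T] by antisymmetry. *)
Lemma T_transition a b k x : V x -> Tcomp B i a b k x =
  \sum_p \sum_q \sum_m jac j i x p a * jac j i x q b * conjc (jac j i x m k) *
    Tcomp B j p q m x.
Proof.
move=> Vx; have hG := het_metric hB; have [ix jx] := (Vi Vx, Vj Vx).
have sG : smooth_mx j V (gX B j).
  by apply: smooth_mx_sub (smooth_metric hG j) => y; exact: Vj.
have sGi : smooth_mx i V (gX B j) by exact: smooth_mx_chart sG.
have hT : smooth_mx i V (fun y => (jac j i y)^T) by exact: smooth_tr.
have hc : smooth_mx i V (fun y => map_mx conjc (jac j i y)) by exact: smooth_conj_mx.
have hTG : smooth_mx i V (fun y => (jac j i y)^T *m gX B j y) by exact: smooth_mxM.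
have dc c : dz_mx i c (fun y => map_mx conjc (jac j i y)) x = 0.
  apply/matrixP => p q; rewrite [LHS]mxE [RHS]mxE.
  have e' y : V y -> map_mx conjc (jac j i y) p q = conjc (jac j i y p q) by rewrite mxE.
  rewrite (dz_ext c e' Vx) (dz_conj c (sJ p q) Vx).
  have h0 : dzb_mx i c (jac j i) x = 0 by exact: (jac_holomorphic c Vx).
  have -> : dzb i c (fun y => jac j i y p q) x = 0.
    by move/matrixP: h0 => /(_ p q); rewrite [X in X = _]mxE [X in _ = X]mxE.
  by rewrite conjc0.
(* The derivatives and the Jacobian are abstracted; index algebra remains. *)
have [dJ dJE] : exists dJ : 'I_3 -> 'M[C]_3, forall c,
    dJ c = dz_mx i c (fun y => (jac j i y)^T) x by eexists.
have dG c a' b' : dz i c (fun y => gX B i y a' b') x =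
    (dJ c *m (gX B j x *m map_mx conjc (jac j i x))) a' b' +
    \sum_m jac j i x m c * ((jac j i x)^T *m dz_mx j m (gX B j) x *m map_mx conjc (jac j i x)) a' b'.
  have e y : V y -> gX B i y a' b' =
      ((jac j i y)^T *m gX B j y *m map_mx conjc (jac j i y)) a' b'.
    by move=> Vy; rewrite (metric_transition hG (Vj Vy) (Vi Vy)).
  rewrite (dz_ext c e Vx).
  have -> : dz i c (fun y => ((jac j i y)^T *m gX B j y *m map_mx conjc (jac j i y)) a' b') x =
    dz_mx i c (fun y => (jac j i y)^T *m gX B j y *m map_mx conjc (jac j i y)) x a' b' by rewrite [RHS]mxE.
  rewrite (dz_mxM c hTG hc Vx) dc mulmx0 addr0 (dz_mxM c hT sGi Vx) mulmxDl -dJE -mulmxA.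
  rewrite [LHS]mxE; congr (_ + _).
  rewrite (dz_mx_chart c sG Vx) mulmx_sumr mulmx_suml summxE; apply: eq_bigr => m _.
  by rewrite -scalemxAr -scalemxAl [LHS]mxE.
have dJ_sym u v p : dJ u v p = dJ v u p.
  have e u' v' : dJ u' v' p = dz i u' (fun y => jac j i y p v') x.
    by rewrite dJE [LHS]mxE; apply: dz_ext Vx => y _; rewrite mxE.
  by apply: etrans (e u v) (etrans _ (esym (e v u))); exact: dz_jac_sym.
have symJ c a' (H : 'M[C]_3) b' : (dJ c *m H) a' b' = (dJ a' *m H) c b'.
  rewrite [LHS]mxE [RHS]mxE; apply: eq_bigr => p _.
  exact: (congr1 (fun z => z * H p b') (dJ_sym c a' p)).
have [D DE] : exists D : 'I_3 -> 'M[C]_3, forall m, D m = dz_mx j m (gX B j) x by eexists.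
have [J JE] : exists J : 'M[C]_3, J = jac j i x by eexists.
have dG' c a' b' : dz i c (fun y => gX B i y a' b') x =
    (dJ c *m (gX B j x *m map_mx conjc J)) a' b' +
    \sum_p \sum_q \sum_m J p c * J q a' * conjc (J m b') * D p q m.
  rewrite dG -JE; congr (_ + _); apply: eq_bigr => p _; rewrite -DE.
  rewrite mxE mulr_sumr exchange_big /=; apply: eq_bigr => m _.
  by rewrite !mxE mulr_suml mulr_sumr; apply: eq_bigr => q _; rewrite !mxE; ring.
have DE' p q m : D p q m = dz j p (fun y => gX B j y q m) x by rewrite DE mxE.
rewrite (TcompE (hB := hB)) // !dG' symJ opprD addrACA subrr add0r -JE.
under [RHS]eq_bigr => p _ do under eq_bigr => q _ do
  under eq_bigr => m _ do rewrite (TcompE (hB := hB)) // -!DE' mulrBr.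
under [RHS]eq_bigr => p _ do under eq_bigr => q _ do rewrite sumrB.
under [RHS]eq_bigr => p _ do rewrite sumrB.
rewrite sumrB [X in _ = X - _]exchange_big /=; congr (_ - _).
by do 3 (apply: eq_bigr => ? _); ring.
Qed.

Let sK : smooth_mx i V (jac i j). Proof. exact: smooth_jacV. Qed.
Let st : smooth_mx i V (tE B i j). Proof. exact: smooth_tE. Qed.
Let st' : smooth_mx i V (tE B j i). Proof. exact: smooth_tEV. Qed.

Lemma smooth_qtrans s : smooth_q j V s ->
  smooth_q i V (fun y => qtrans (B := B) j i y (s y)).
Proof.
move=> [h1 h2 h3].
have k1 : smooth_mx i V (fun y => kap (s y)) by exact: smooth_mx_chart h1.
have k2 : smooth_mx i V (fun y => gam (s y)) by exact: smooth_mx_chart h2.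
have k3 : smooth_mx i V (fun y => tng (s y)) by exact: smooth_mx_chart h3.
by split; [apply: smooth_mxM|apply: smooth_mxM => //; apply: smooth_mxM|apply: smooth_mxM].
Qed.

Lemma qtrans_sum x (I : Type) (l : seq I) (c : I -> C) (v : I -> qfib) :
  \sum_(m <- l) c m *: qtrans (B := B) j i x (v m) =
  ((\sum_(m <- l) c m *: kap (v m)) *m jac j i x,
   tE B i j x *m (\sum_(m <- l) c m *: gam (v m)) *m tE B j i x,
   jac i j x *m (\sum_(m <- l) c m *: tng (v m))).
Proof.
elim: l => [|m l IH]; first by rewrite !big_nil mul0mx !mulmx0 mul0mx.
rewrite !big_cons IH mulmxDl !mulmxDr mulmxDl -!scalemxAl -!scalemxAr -scalemxAl.
by [].
Qed.

(** The transition functions are holomorphic, so that only the index of [dzbar^k]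
    feels the change of chart. *)
Lemma delbar_coef_trans k s x : smooth_q j V s -> V x ->
  delbar_coef i k (fun y => qtrans (B := B) j i y (s y)) x =
  \sum_m conjc (jac j i x m k) *: qtrans (B := B) j i x (delbar_coef j m s x).
Proof.
move=> [h1 h2 h3] Vx; rewrite qtrans_sum.
have k1 : smooth_mx i V (fun y => kap (s y)) by exact: smooth_mx_chart h1.
have k2 : smooth_mx i V (fun y => gam (s y)) by exact: smooth_mx_chart h2.
have k3 : smooth_mx i V (fun y => tng (s y)) by exact: smooth_mx_chart h3.
have k4 : smooth_mx i V (fun y => tE B i j y *m gam (s y)) by exact: smooth_mxM.
have dJ : dzb_mx i k (jac j i) x = 0 by exact: (jac_holomorphic k Vx).
have dK : dzb_mx i k (jac i j) x = 0 by exact: (jacV_holomorphic k Vx).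
have dt : dzb_mx i k (tE B i j) x = 0 by exact: (tE_holomorphic k Vx).
have dt' : dzb_mx i k (tE B j i) x = 0 by exact: (tEV_holomorphic k Vx).
have e1 : dzb_mx i k (fun y => kap (s y) *m jac j i y) x =
    (\sum_m conjc (jac j i x m k) *: dzb_mx j m (fun y => kap (s y)) x) *m jac j i x.
  by rewrite (dzb_mxM k k1 sJ Vx) dJ mulmx0 addr0 (dzb_mx_chart k h1 Vx).
have e2 : dzb_mx i k (fun y => tE B i j y *m gam (s y) *m tE B j i y) x =
    tE B i j x *m (\sum_m conjc (jac j i x m k) *: dzb_mx j m (fun y => gam (s y)) x) *m tE B j i x.
  rewrite (dzb_mxM k k4 st' Vx) dt' mulmx0 addr0 (dzb_mxM k st k2 Vx) dt mul0mx add0r.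
  by rewrite (dzb_mx_chart k h2 Vx).
have e3 : dzb_mx i k (fun y => jac i j y *m tng (s y)) x =
    jac i j x *m (\sum_m conjc (jac j i x m k) *: dzb_mx j m (fun y => tng (s y)) x).
  by rewrite (dzb_mxM k sK k3 Vx) dK mul0mx add0r (dzb_mx_chart k h3 Vx).
exact: (congr2 pair (congr2 pair e1 e2) e3).
Qed.

Let mxtrace_conj_mul n (u u' F c : 'M[C]_n) : u' *m u = 1%:M ->
  \tr (u *m F *m u' *m (u *m c *m u')) = \tr (F *m c).
Proof.
move=> uu; rewrite -!mulmxA (mulmxA u' u) uu mul1mx mxtrace_mulC.
by rewrite -!mulmxA uu mulmx1.
Qed.

Lemma opFgam_trans k (c : 'M[C]_r) x : V x ->
  \row_a \tr (Fm B i a k x *m (tE B i j x *m c *m tE B j i x)) =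
  (\sum_m conjc (jac j i x m k) *: \row_a \tr (Fm B j a m x *m c)) *m jac j i x.
Proof.
move=> Vx; have tK : tE B i j x *m tE B j i x = 1%:M by exact: tEK Vx.
have tVK := mulmx1C tK.
apply/rowP => a; rewrite [LHS]mxE [RHS]mxE (Fm_transition _ _ Vx) mulmx_suml raddf_sum.
apply: eq_bigr => l _; rewrite summxE mulmx_suml raddf_sum mulr_suml; apply: eq_bigr => m _ /=.
rewrite -scalemxAl mxtraceZ [X in _ = X * _]mxE [X in _ = _ * X * _]mxE.
have -> : \tr (tE B i j x *m Fm B j l m x *m tE B j i x *m (tE B i j x *m c *m tE B j i x)) =
   \tr (Fm B j l m x *m c).
  exact: mxtrace_conj_mul.
by rewrite -mulrA mulrC.
Qed.

Lemma opFtng_trans k (w : 'cV[C]_3) x : V x ->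
  \sum_a (jac i j x *m w) a 0 *: Fm B i a k x =
  tE B i j x *m (\sum_m conjc (jac j i x m k) *: \sum_a w a 0 *: Fm B j a m x) *m tE B j i x.
Proof.
move=> Vx; have JK : jac j i x *m jac i j x = 1%:M by exact: jacVK Vx.
have wl l : w l 0 = \sum_a jac j i x l a * (jac i j x *m w) a 0.
  by rewrite -[w in LHS]mul1mx -JK -mulmxA mxE.
move: (jac i j x *m w) wl => u wl.
have FE a : Fm B i a k x = \sum_l \sum_m (jac j i x l a * conjc (jac j i x m k)) *:
    (tE B i j x *m Fm B j l m x *m tE B j i x) by exact: Fm_transition Vx.
have [F FjE] : exists F : 'I_3 -> 'I_3 -> 'M[C]_r, forall l m, F l m = Fm B j l m x by eexists.
have -> : \sum_m conjc (jac j i x m k) *: (\sum_a w a 0 *: Fm B j a m x) =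
    \sum_m conjc (jac j i x m k) *: (\sum_a w a 0 *: F a m).
  by apply: eq_bigr => m _; congr (_ *: _); apply: eq_bigr => l _; rewrite FjE.
transitivity (\sum_a u a 0 *: \sum_l \sum_m (jac j i x l a * conjc (jac j i x m k)) *:
    (tE B i j x *m F l m *m tE B j i x)).
  apply: eq_bigr => a _; congr (_ *: _); apply: etrans (FE a) _.
  by apply: eq_bigr => l _; apply: eq_bigr => m _; rewrite FjE.
move: (jac j i x) wl => J wl {FE FjE}.
transitivity (\sum_a \sum_l \sum_m (u a 0 * (J l a * conjc (J m k))) *:
    (tE B i j x *m F l m *m tE B j i x)).
  apply: eq_bigr => a _; rewrite scaler_sumr; apply: eq_bigr => l _.
  by rewrite scaler_sumr; apply: eq_bigr => m _; rewrite scalerA.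
rewrite exchange_big mulmx_sumr mulmx_suml /=.
under eq_bigr => l _ do rewrite exchange_big /=.
rewrite exchange_big /=; apply: eq_bigr => m _.
rewrite -scalemxAr -scalemxAl mulmx_sumr mulmx_suml scaler_sumr; apply: eq_bigr => l _.
rewrite -scaler_suml -scalemxAr -scalemxAl scalerA; congr (_ *: _).
by rewrite wl mulr_sumr; apply: eq_bigr => a _; ring.
Qed.

Lemma opT_trans k (w : 'cV[C]_3) x : V x ->
  \row_a \sum_l Tcomp B i l a k x * (jac i j x *m w) l 0 =
  (\sum_m conjc (jac j i x m k) *: \row_a \sum_l Tcomp B j l a m x * w l 0) *m jac j i x.
Proof.
move=> Vx; have JK : jac j i x *m jac i j x = 1%:M by exact: jacVK Vx.
have wl l : w l 0 = \sum_a jac j i x l a * (jac i j x *m w) a 0.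
  by rewrite -[w in LHS]mul1mx -JK -mulmxA mxE.
move: (jac i j x *m w) wl => u wl.
have [J JE] : exists J : 'M[C]_3, J = jac j i x by eexists.
apply/rowP => a; rewrite [LHS]mxE [RHS]mxE -JE.
under eq_bigr => l _ do rewrite (T_transition _ _ _ Vx) -JE mulr_suml.
rewrite exchange_big /=.
have eR q : (\sum_m conjc (J m k) *: \row_a' \sum_l Tcomp B j l a' m x * w l 0) 0 q * J q a =
   \sum_p \sum_l \sum_m J p l * J q a * conjc (J m k) * Tcomp B j p q m x * u l 0.
  rewrite summxE mulr_suml.
  under eq_bigr => m _.
    rewrite [X in X * _]mxE [X in _ * X * _]mxE mulr_sumr mulr_suml.
    under eq_bigr => p _ do rewrite wl -JE !mulr_sumr mulr_suml.
    over.
  rewrite exchange_big /=; apply: eq_bigr => p _.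
  rewrite exchange_big /=; apply: eq_bigr => l _; apply: eq_bigr => m _.
  by move: (Tcomp _ _ _ _ _ _) (conjc _) => ? ?; ring.
under [RHS]eq_bigr => q _ do rewrite eR.
rewrite [RHS]exchange_big /=; apply: eq_bigr => p _.
under eq_bigr => l _ do rewrite mulr_suml.
rewrite exchange_big /=; apply: eq_bigr => q _; apply: eq_bigr => l _.
by rewrite mulr_suml.
Qed.

Lemma opRnabla_trans k (N : 'M[C]_3) x : V x ->
  \row_a \tr (Rm B i k a x *m (jac i j x *m N *m jac j i x)) =
  (\sum_m conjc (jac j i x m k) *: \row_a \tr (Rm B j m a x *m N)) *m jac j i x.
Proof.
move=> Vx; have JK : jac j i x *m jac i j x = 1%:M by exact: jacVK Vx.
apply/rowP => a; rewrite [LHS]mxE [RHS]mxE (Rm_transition _ _ Vx) mulmx_suml raddf_sum.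
apply: eq_bigr => l _; rewrite summxE mulmx_suml raddf_sum mulr_suml; apply: eq_bigr => m _ /=.
rewrite -scalemxAl mxtraceZ [X in _ = X * _]mxE [X in _ = _ * X * _]mxE.
have -> : \tr (jac i j x *m Rm B j m l x *m jac j i x *m (jac i j x *m N *m jac j i x)) =
   \tr (Rm B j m l x *m N).
  exact: mxtrace_conj_mul.
by rewrite -mulrA mulrC.
Qed.

(** All ingredients of [Dbar] are tensors, among them [nabla^+ W] by
    [nablap_transition]; the conjugate Jacobian belongs to the index of
    [dzbar^k]. *)
Lemma Dbar_coef_trans k s x : smooth_q j V s -> V x ->
  Dbar_coef B i k (fun y => qtrans (B := B) j i y (s y)) x =
  \sum_m conjc (jac j i x m k) *: qtrans (B := B) j i x (Dbar_coef B j m s x).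
Proof.
move=> hs Vx; have E := etrans (delbar_coef_trans k hs Vx) (qtrans_sum x _ _ _).
rewrite qtrans_sum.
have e1 := congr1 (fun v : qfib => v.1.1) E.
have e2 := congr1 (fun v : qfib => v.1.2) E.
have e3 := congr1 (fun v : qfib => v.2) E.
rewrite /= in e1 e2 e3.
rewrite /Dbar_coef e1 e2 e3.
have eN : nablap_mx B i (@tng _ _ \o (fun y => qtrans (B := B) j i y (s y))) x =
    jac i j x *m nablap_mx B j (@tng _ _ \o s) x *m jac j i x.
  exact: nablap_transition (smooth_tng hs) Vx.
rewrite opRnablaE eN (opRnabla_trans k _ Vx).
have -> : opFgam B i k (@gam _ _ \o (fun y => qtrans (B := B) j i y (s y))) x =
   (\sum_m conjc (jac j i x m k) *: opFgam B j m (@gam _ _ \o s) x) *m jac j i x.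
  exact: opFgam_trans.
have -> : opT B i k (@tng _ _ \o (fun y => qtrans (B := B) j i y (s y))) x =
   (\sum_m conjc (jac j i x m k) *: opT B j m (@tng _ _ \o s) x) *m jac j i x.
  exact: opT_trans.
have -> : opFtng B i k (@tng _ _ \o (fun y => qtrans (B := B) j i y (s y))) x =
   tE B i j x *m (\sum_m conjc (jac j i x m k) *: opFtng B j m (@tng _ _ \o s) x) *m tE B j i x.
  exact: opFtng_trans.
under [\sum_m _ *: \row_a \tr _]eq_bigr do rewrite -opRnablaE.
congr (_, _, _).
  rewrite !scalemxAl -!mulmxDl !scaler_sumr -!big_split /=; congr (_ *m _).
  apply: eq_bigr => m _.
  by rewrite !scalerDr !scalerA [conjc _ * al B]mulrC.
rewrite -mulmxDl -mulmxDr -big_split /=; congr (_ *m _ *m _).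
by apply: eq_bigr => m _; rewrite scalerDr.
Qed.
End OperatorCovariance.

(** * Transition functions of forms *)

Section FormTransitions.
Context {R : realType} {X : topologicalType} {M : charts R X} {r : nat}.
Context {hA : complex_atlas M} {B : background M r} {hB : heterotic B}.
Context {P : potentials M r} {hP : local_potentials B P}.
Notation C := R[i].
Notation qfib := ('rV[C]_3 * 'M[C]_r * 'cV[C]_3)%type.
Notation qtr := (qtrans (B := B)).
Implicit Types (i j l : idx M) (x y : X) (W : set X).

Lemma transQE p j i x (s : {ffun 'I_p -> 'I_3} -> qfib) K :
  transQ B j i x s K = \sum_(L : {ffun 'I_p -> 'I_3})
    (\prod_u conjc (jac j i x (L u) (K u))) *: qtr j i x (s L).
Proof. by []. Qed.

Lemma qtrans_lin j i x (c : C) (v w : qfib) :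
  qtr j i x (c *: v + w) = c *: qtr j i x v + qtr j i x w.
Proof.
rewrite /qtrans /kap /gam /tng /= !mulmxDr !mulmxDl -!scalemxAl -!scalemxAr -scalemxAl.
by [].
Qed.

Lemma qtrans0 j i x : qtr j i x 0 = 0.
Proof. by rewrite /qtrans /kap /gam /tng /= mul0mx !mulmx0 mul0mx. Qed.

Lemma qtrans_sumZ j i x (I : finType) (c : I -> C) (v : I -> qfib) :
  qtr j i x (\sum_m c m *: v m) = \sum_m c m *: qtr j i x (v m).
Proof.
by elim/big_rec2: _ => [|m w u _ <-]; [exact: qtrans0|exact: qtrans_lin].
Qed.

Lemma qtrans_id i x v : dom i x -> qtr i i x v = v.
Proof.
move=> ix; rewrite /qtrans jac_id // (bundle_id (het_bundle hB)) //.
by rewrite !mulmx1 !mul1mx; case: v => -[].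
Qed.

Lemma qtrans_cocycle i j l x v : dom i x -> dom j x -> dom l x ->
  qtr i l x (qtr j i x v) = qtr j l x v.
Proof.
move=> ix jx lx; have hE := het_bundle hB.
have e1 : kap v *m jac j i x *m jac i l x = kap v *m jac j l x.
  by rewrite -mulmxA jac_cocycle.
have e2 : tE B l i x *m (tE B i j x *m gam v *m tE B j i x) *m tE B i l x =
    tE B l j x *m gam v *m tE B j l x.
  by rewrite !mulmxA (bundle_cocycle hE lx ix jx) -[LHS]mulmxA (bundle_cocycle hE jx ix lx).
have e3 : jac l i x *m (jac i j x *m tng v) = jac l j x *m tng v.
  by rewrite mulmxA jac_cocycle.
exact: (congr2 pair (congr2 pair e1 e2) e3).
Qed.

Lemma transQ_lin p j i x (c : C) (s s' : {ffun 'I_p -> 'I_3} -> qfib) K :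
  transQ B j i x (fun K => c *: s K + s' K) K =
  c *: transQ B j i x s K + transQ B j i x s' K.
Proof.
rewrite !transQE scaler_sumr -big_split /=; apply: eq_bigr => L _.
by rewrite qtrans_lin scalerDr !scalerA mulrC.
Qed.

Lemma transQ_id p i x (s : {ffun 'I_p -> 'I_3} -> qfib) : dom i x -> transQ B i i x s = s.
Proof.
move=> ix; apply/funext => K; rewrite transQE (bigD1 K) //= qtrans_id // [X in _ + X]big1 => [|L LK].
  rewrite addr0 big1 ?scale1r // => u _.
  by rewrite jac_id // mxE eqxx conjc1.
suff [u uK] : exists u, L u != K u.
  by rewrite (bigD1 u) //= jac_id // mxE (negPf uK) conjc0 mul0r scale0r.
apply/existsP; apply: contraR LK => /existsPn h; apply/eqP/ffunP => u.
by apply/eqP; have := h u; rewrite negbK.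
Qed.

(** The product over the form indices of the cocycle identities [jac_cocycle],
    expanded by distributivity. *)
Lemma transQ_cocycle p i j l x (s : {ffun 'I_p -> 'I_3} -> qfib) :
  dom i x -> dom j x -> dom l x ->
  transQ B i l x (transQ B j i x s) = transQ B j l x s.
Proof.
move=> ix jx lx; apply/funext => K; rewrite !transQE.
transitivity (\sum_(L : {ffun 'I_p -> 'I_3}) \sum_(L' : {ffun 'I_p -> 'I_3})
    (\prod_u (conjc (jac i l x (L u) (K u)) * conjc (jac j i x (L' u) (L u)))) *:
    qtr j l x (s L')).
  apply: eq_bigr => L _; rewrite qtrans_sumZ scaler_sumr; apply: eq_bigr => L' _.
  by rewrite scalerA -big_split /= qtrans_cocycle.
rewrite exchange_big /=; apply: eq_bigr => L' _; rewrite -scaler_suml; congr (_ *: _).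
rewrite -(bigA_distr_bigA (fun u m => conjc (jac i l x m (K u)) * conjc (jac j i x (L' u) m))).
apply: eq_bigr => u _; rewrite -(jac_cocycle jx ix lx) mxE rmorph_sum.
by apply: eq_bigr => m _; rewrite rmorphM mulrC.
Qed.

(** The transposition is moved to the summation indices. *)
Lemma transQ_alternating p j i x (s : {ffun 'I_p -> 'I_3} -> qfib) :
  alternating s -> alternating (transQ B j i x s).
Proof.
move=> alt K u v uv; rewrite !transQE.
have tK (L : {ffun 'I_p -> 'I_3}) : [ffun w => [ffun w => L (tperm u v w)] (tperm u v w)] = L.
  by apply/ffunP => w; rewrite !ffunE tpermK.
rewrite (reindex_inj (h := fun L : {ffun 'I_p -> 'I_3} => [ffun w => L (tperm u v w)])) /=; last first.
  by move=> L L' e; rewrite -(tK L) -(tK L') e.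
rewrite -sumrN; apply: eq_bigr => L _; rewrite alt // -[- s L]scaleN1r.
have -> : qtr j i x (-1 *: s L) = - qtr j i x (s L).
  by have := qtrans_lin j i x (-1) (s L) 0; rewrite addr0 qtrans0 addr0 => ->; rewrite scaleN1r.
rewrite scalerN; congr (- (_ *: _)).
rewrite [RHS](reindex_inj (h := tperm u v)); last exact: perm_inj.
by apply: eq_bigr => w _; rewrite !ffunE.
Qed.

Lemma qtrans_traceless j i x v : dom i x -> dom j x -> \tr (gam v) = 0 ->
  \tr (gam (qtr j i x v)) = 0.
Proof.
move=> ix jx tr0; rewrite /qtrans {1}/gam /= mxtrace_mulC mulmxA.
by rewrite (bundle_cocycle (het_bundle hB)) // (bundle_id (het_bundle hB)) // mul1mx.
Qed.

Lemma gam_sum (I : finType) (v : I -> qfib) : gam (\sum_m v m) = \sum_m gam (v m).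
Proof. by elim/big_rec2: _ => // m w u _ <-. Qed.

Lemma ffun0_eq (T : Type) (K L : {ffun 'I_0 -> T}) : K = L.
Proof. by apply/ffunP => -[]. Qed.

Lemma transQ0 j i x (s : {ffun 'I_0 -> 'I_3} -> qfib) K : transQ B j i x s K = qtr j i x (s K).
Proof.
rewrite transQE (bigD1 K) //= big_ord0 scale1r big1 ?addr0 // => L.
by rewrite (ffun0_eq L K) eqxx.
Qed.

Lemma transQ1 j i x (s : {ffun 'I_1 -> 'I_3} -> qfib) K : transQ B j i x s K =
  \sum_m conjc (jac j i x m (K ord0)) *: qtr j i x (s [ffun=> m]).
Proof.
rewrite transQE (reindex (fun m : 'I_3 => [ffun=> m] : {ffun 'I_1 -> 'I_3})) /=.
  by apply: eq_bigr => m _; rewrite big_ord_recl big_ord0 mulr1 ffunE.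
exists (fun L : {ffun 'I_1 -> 'I_3} => L ord0) => [m _|L _]; first by rewrite ffunE.
by apply/ffunP => u; rewrite ffunE (ord1 u).
Qed.

Lemma dzbar_wedge0 (D : 'I_3 -> (X -> qfib) -> X -> qfib) s K x L :
  dzbar_wedge (p := 0) D s K x = D (K ord0) (s L) x.
Proof.
by rewrite /dzbar_wedge big_ord_recl big_ord0 addr0 expr0 scale1r (ffun0_eq (omit _ _) L).
Qed.

Lemma dzbar_wedge1 (D : 'I_3 -> (X -> qfib) -> X -> qfib) s (K : {ffun 'I_2 -> 'I_3}) x :
  dzbar_wedge (p := 1) D s K x =
  D (K ord0) (s [ffun=> K ord_max]) x - D (K ord_max) (s [ffun=> K ord0]) x.
Proof.
rewrite /dzbar_wedge !big_ord_recl big_ord0 addr0 expr0 scale1r expr1 scaleN1r.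
have -> : lift ord0 ord0 = ord_max :> 'I_2 by apply/val_inj.
congr (D _ (s _) x - D _ (s _) x); apply/ffunP => u; rewrite !ffunE; congr (K _);
  by apply/val_inj; rewrite (ord1 u).
Qed.
End FormTransitions.

(** * Sections *)

(** The vector space structures of forms and cochains are attached to these
    names, so that unification never unfolds them into iterated functions. *)
HB.instance Definition _ (R : realType) (X : topologicalType) (M : charts R X) (r p : nat) :=
  GRing.Lmodule.copy (@qform R X M r p)
    (X -> idx M -> {ffun 'I_p -> 'I_3} -> 'rV[R[i]]_3 * 'M[R[i]]_r * 'cV[R[i]]_3)%type.
HB.instance Definition _ (R : realType) (X : topologicalType) (M : charts R X) (r p : nat) :=
  GRing.Lmodule.copy (@cochains R X M r p) (('I_p.+1 -> idx M) -> @qform R X M r 0).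

Section FormSections.
Context {R : realType} {X : topologicalType} {M : charts R X} {r : nat}.
Context {hA : complex_atlas M} {B : background M r} {hB : heterotic B}.
Context {P : potentials M r} {hP : local_potentials B P}.
Notation C := R[i].
Notation qfib := ('rV[C]_3 * 'M[C]_r * 'cV[C]_3)%type.
Notation qtr := (qtrans (B := B)).
Notation qform := (@qform R X M r).
Implicit Types (i j l : idx M) (x y : X) (W : set X).

Lemma smooth_q_sub i (V V' : set X) (s : X -> qfib) :
  V' `<=` V -> smooth_q i V s -> smooth_q i V' s.
Proof. by move=> h [h1 h2 h3]; split; apply: smooth_mx_sub h _. Qed.

Lemma smooth_q_sum i V {cV : chart_domain i V} (I : Type) (l : seq I)
    (c : I -> X -> C) (s : I -> X -> qfib) :
  (forall m, smooth_on i V (c m)) -> (forall m, smooth_q i V (s m)) ->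
  smooth_q i V (fun x => \sum_(m <- l) c m x *: s m x).
Proof.
move=> hc hs; elim: l => [|m l IH].
  by apply: smooth_q_ext smooth_q0 => x _; rewrite big_nil.
apply: (smooth_q_ext (s := fun x => c m x *: s m x + \sum_(m <- l) c m x *: s m x)).
  by move=> x _; rewrite big_cons.
have [h1 h2 h3] := hs m; have [k1 k2 k3] := IH.
by split; apply: smooth_mxD => //; exact: smooth_mxZ.
Qed.

Lemma section_smooth p W (s : qform p) : sections B W s ->
  forall i K, smooth_q i (W `&` dom i) (fun x => s x i K).
Proof.
move=> hs i K; split.
- by move=> o a; rewrite (ord1 o); exact: (sec_smooth_kap hs).
- by move=> a b; exact: (sec_smooth_gam hs).
- by move=> a o; rewrite (ord1 o); exact: (sec_smooth_tng hs).
Qed.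

(** A section over an open part of a chart domain is given by its components
    in that chart. *)
Definition spread p j W (c : {ffun 'I_p -> 'I_3} -> X -> qfib) : qform p := fun x l =>
  if x \in W `&` dom l then transQ B j l x (c^~ x) else 0.

Lemma spread_at p j W (c : {ffun 'I_p -> 'I_3} -> X -> qfib) x :
  W x -> dom j x -> spread j W c x j = c^~ x.
Proof. by move=> Wx jx; rewrite /spread mem_set ?transQ_id. Qed.

Lemma alternating0 p : alternating (0 : {ffun 'I_p -> 'I_3} -> qfib).
Proof. by move=> K u v _; rewrite oppr0. Qed.

Lemma section_intro p W (s : qform p) :
  (forall x i, ~ (W `&` dom i) x -> s x i = 0) ->
  (forall i j x, W x -> dom i x -> dom j x -> s x i = transQ B j i x (s x j)) ->
  (forall x i, W x -> dom i x -> alternating (s x i)) ->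
  (forall x i K, W x -> dom i x -> \tr (gam (s x i K)) = 0) ->
  (forall i K, smooth_q i (W `&` dom i) (fun x => s x i K)) ->
  sections B W s.
Proof.
move=> out tr alt trl smq; split=> //.
- move=> x i; have [[Wx ix]|n] := pselect ((W `&` dom i) x); first exact: alt.
  by rewrite out //; exact: alternating0.
- move=> x i K; have [[Wx ix]|n] := pselect ((W `&` dom i) x); first exact: trl.
  by rewrite out // mxtrace0.
- by move=> i K a; have [h _ _] := smq i K; exact: h.
- by move=> i K a b; have [_ h _] := smq i K; exact: h.
- by move=> i K a; have [_ _ h] := smq i K; exact: h.
Qed.

Lemma spread_section p j W (c : {ffun 'I_p -> 'I_3} -> X -> qfib) :
  open W -> W `<=` dom j -> (forall K, smooth_q j W (c K)) ->
  (forall x, W x -> alternating (c^~ x)) ->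
  (forall x K, W x -> \tr (gam (c K x)) = 0) ->
  sections B W (spread j W c).
Proof.
move=> oW Wj hs halt htr.
have in_ x i : W x -> dom i x -> spread j W c x i = transQ B j i x (c^~ x).
  by move=> Wx ix; rewrite /spread mem_set.
have out x i : ~ (W `&` dom i) x -> spread j W c x i = 0.
  by move=> n; rewrite /spread memNset.
have smq i K : smooth_q i (W `&` dom i) (fun x => spread j W c x i K).
  have ci : chart_domain i (W `&` dom i) by exact: chart_domainI.
  have cj : chart_domain j (W `&` dom i).
    by split; [exact: (domain_open (chart_domain := ci))|move=> x [] /Wj].
  apply: (smooth_q_ext (s := fun x => \sum_(L : {ffun 'I_p -> 'I_3})
     (\prod_u conjc (jac j i x (L u) (K u))) *: qtr j i x (c L x))).
    by move=> x [Wx ix]; rewrite in_ // transQE.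
  apply: smooth_q_sum => L.
    by apply: smooth_prod => u; apply: smooth_conj; exact: smooth_jac.
  by apply: smooth_qtrans; apply: smooth_q_sub (hs L) => x [].
apply: section_intro => //.
- by move=> i i' x Wx ix i'x; rewrite !in_ // transQ_cocycle //; exact: Wj.
- by move=> x i Wx ix; rewrite in_ //; apply: transQ_alternating; exact: halt.
- move=> x i K Wx ix; rewrite in_ // transQE gam_sum raddf_sum big1 // => L _.
  apply: etrans (mxtraceZ _ (gam (qtr j i x (c L x)))) _.
  by rewrite qtrans_traceless ?mulr0 ?htr //; exact: Wj.
Qed.

Lemma section_spread p j W (s : qform p) : sections B W s -> W `<=` dom j ->
  s = spread j W (fun K x => s x j K).
Proof.
move=> hs Wj; apply/funext => x; apply/funext => l; rewrite /spread.
have [[Wx lx]|n] := pselect ((W `&` dom l) x); last first.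
  by rewrite memNset // (sec_support hs).
by rewrite mem_set // (sec_transition hs Wx lx (Wj _ Wx)).
Qed.

Lemma section_eq p j W (s s' : qform p) : W `<=` dom j -> sections B W s -> sections B W s' ->
  (forall x, W x -> s x j = s' x j) -> s = s'.
Proof.
move=> Wj hs hs' e; rewrite (section_spread hs Wj) (section_spread hs' Wj).
apply/funext => x; apply/funext => l; rewrite /spread; case: ifP => // /set_mem[Wx _].
by rewrite e.
Qed.

Lemma sections_lin p W (c : C) (s s' : qform p) : open W ->
  sections B W s -> sections B W s' -> sections B W (c *: s + s').
Proof.
move=> oW hs hs'.
apply: section_intro.
- move=> x i n; apply/funext => K; rewrite -[LHS]/(c *: s x i K + s' x i K).
  by rewrite (sec_support hs) // (sec_support hs') // scaler0 addr0.
- move=> i j x Wx ix jx; apply/funext => K; rewrite -[LHS]/(c *: s x i K + s' x i K).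
  rewrite (sec_transition hs Wx ix jx) (sec_transition hs' Wx ix jx).
  by apply/esym; exact: transQ_lin.
- move=> x i _ _ K u v uv; rewrite -[LHS]/(c *: s x i _ + s' x i _).
  by rewrite (sec_alternating hs) // (sec_alternating hs') // scalerN -opprD.
- move=> x i K _ _; apply: etrans (mxtraceD (c *: gam (s x i K)) (gam (s' x i K))) _.
  by rewrite mxtraceZ (sec_traceless hs) (sec_traceless hs') mulr0 addr0.
- move=> i K; have ci : chart_domain i (W `&` dom i) by exact: chart_domainI.
  apply: smooth_q_lin; exact: section_smooth.
Qed.

Lemma sections0 p W : open W -> sections B W (0 : qform p).
Proof.
move=> oW; apply: section_intro => //.
- move=> i j x Wx ix jx; apply/funext => K; rewrite transQE big1 // => L _.
  by rewrite qtrans0 scaler0.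
- by move=> x i _ _; exact: alternating0.
- by move=> x i K _ _; exact: mxtrace0.
- by move=> i K; exact: smooth_q0.
Qed.

Lemma sections_sub p W W' (s s' : qform p) : open W' -> W' `<=` W -> sections B W s ->
  (forall x i, ~ (W' `&` dom i) x -> s' x i = 0) ->
  (forall x i, W' x -> dom i x -> s' x i = s x i) -> sections B W' s'.
Proof.
move=> oW' WW hs out e; apply: section_intro => //.
- by move=> i j x Wx ix jx; rewrite !e // (sec_transition hs (WW _ Wx) ix jx).
- by move=> x i Wx ix; rewrite e //; exact: (sec_alternating hs).
- by move=> x i K Wx ix; rewrite e //; exact: (sec_traceless hs).
- move=> i K; have ci : chart_domain i (W' `&` dom i) by exact: chart_domainI.
  apply: (smooth_q_ext (s := fun x => s x i K)); first by move=> x [Wx ix]; rewrite e.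
  by apply: smooth_q_sub (section_smooth hs i K) => x [Wx ix]; split=> //; exact: WW.
Qed.

Lemma restr_section p W W' (s : qform p) : open W' -> W' `<=` W -> sections B W s ->
  sections B W' (restr W' s).
Proof.
move=> oW' WW hs; apply: (sections_sub oW' WW hs) => x i; last first.
  by move=> Wx ix; rewrite /restr mem_set.
move=> n; rewrite /restr; case: ifP => // /set_mem Wx.
by rewrite (sec_support hs) // => -[_ ix]; exact: n.
Qed.

(** * Gluing *)

Definition glue p (e : idx M -> qform p) : qform p := fun x l => e l x l.

Lemma glueE p (e : idx M -> qform p) :
  (forall i, sections B (dom i) (e i)) ->
  (forall i j x l, dom i x -> dom j x -> e i x l = e j x l) ->
  forall i x l, dom i x -> glue e x l = e i x l.
Proof.
move=> he agree i x l ix; have [lx|n] := pselect (dom l x); first exact: agree.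
by rewrite /glue (sec_support (he l)) ?(sec_support (he i)) // => -[].
Qed.

Lemma glue_section p (e : idx M -> qform p) :
  (forall i, sections B (dom i) (e i)) ->
  (forall i j x l, dom i x -> dom j x -> e i x l = e j x l) ->
  sections B [set: X] (glue e).
Proof.
move=> he agree; have gE := glueE he agree; apply: section_intro.
- by move=> x i n; rewrite /glue (sec_support (he i)) // => -[ix _]; exact: n.
- by move=> i j x _ ix jx; rewrite !(gE i) // (sec_transition (he i) ix ix jx).
- by move=> x i _ ix; exact: (sec_alternating (he i)).
- by move=> x i K _ ix; exact: (sec_traceless (he i)).
- move=> i K; apply: smooth_q_sub (section_smooth (he i) i K).
  by move=> x [_ ix].
Qed.

(** * The operators on sections *)

Lemma DbarE p W (s : qform p) x i K : W x -> dom i x ->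
  Dbar B W s x i K = dzbar_wedge (Dbar_coef B i) (fun L y => s y i L) K x.
Proof. by move=> Wx ix; rewrite /Dbar mem_set. Qed.

Lemma delbarE p W (s : qform p) x i K : W x -> dom i x ->
  delbar W s x i K = dzbar_wedge (delbar_coef i) (fun L y => s y i L) K x.
Proof. by move=> Wx ix; rewrite /delbar mem_set. Qed.

Lemma Dbar_out p W (s : qform p) x i : ~ (W `&` dom i) x -> Dbar B W s x i = 0.
Proof. by move=> n; apply/funext => K; rewrite /Dbar memNset. Qed.

Lemma delbar_out p W (s : qform p) x i : ~ (W `&` dom i) x -> delbar W s x i = 0.
Proof. by move=> n; apply/funext => K; rewrite /delbar memNset. Qed.

Lemma Dbar_lin p W (c : C) (s s' : qform p) : open W ->
  sections B W s -> sections B W s' ->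
  Dbar B W (c *: s + s') = c *: Dbar B W s + Dbar B W s'.
Proof.
move=> oW hs hs'; apply/funext => x; apply/funext => i; apply/funext => K.
rewrite -[RHS]/(c *: Dbar B W s x i K + Dbar B W s' x i K).
have [[Wx ix]|n] := pselect ((W `&` dom i) x); last by rewrite !Dbar_out // scaler0 addr0.
have ci : chart_domain i (W `&` dom i) by exact: chart_domainI.
rewrite !DbarE // /dzbar_wedge scaler_sumr -big_split /=; apply: eq_bigr => u _.
rewrite scalerA mulrC -scalerA -scalerDr; congr (_ *: _).
by apply: (Dbar_coef_lin (P := P)); [exact: section_smooth|exact: section_smooth|].
Qed.

Lemma Dbar_ext p W W' (s s' : qform p) x i K : open W -> W x -> W' x -> dom i x ->
  (forall y, W y -> dom i y -> s y i = s' y i) -> Dbar B W' s x i K = Dbar B W s' x i K.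
Proof.
move=> oW Wx W'x ix e; apply: etrans (DbarE s K W'x ix) (etrans _ (esym (DbarE s' K Wx ix))).
apply: eq_bigr => u _; congr (_ *: _).
have ci : chart_domain i (W `&` dom i) by exact: chart_domainI.
have Wix : (W `&` dom i) x by [].
by apply: Dbar_coef_ext Wix => y [Wy iy]; rewrite e.
Qed.

(** The curvature is the derivative of a trace-free potential. *)
Lemma trace_Fm i a k x : dom i x -> \tr (Fm B i a k x) = 0.
Proof.
move=> ix; rewrite -(Apot_eq hP a k ix).
have hs : smooth_mx i (dom i) (Apot P i a) by move=> b c; exact: (Apot_smooth hP).
rewrite -(dzb_mxtrace k hs ix).
have e y : dom i y -> \tr (Apot P i a y) = 0 by exact: (Apot_traceless hP).
by rewrite (dzb_ext k e ix) dzb_cst.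
Qed.

(** The transition law is the covariance of [Dbar], and the trace condition is
    [trace_Fm]. *)
Lemma Dbar_section W (s : qform 0) : open W -> sections B W s ->
  sections B W (Dbar B W s).
Proof.
move=> oW hs; pose e0 : {ffun 'I_0 -> 'I_3} := [ffun=> ord0].
have DE x i K : W x -> dom i x ->
    Dbar B W s x i K = Dbar_coef B i (K ord0) (fun y => s y i e0) x.
  by move=> Wx ix; rewrite DbarE // (dzbar_wedge0 _ _ _ _ e0).
apply: section_intro.
- exact: Dbar_out.
- move=> i j x Wx ix jx; apply/funext => K; rewrite DE // transQ1.
  pose V := W `&` (dom i `&` dom j).
  have oV : open V by do 2 apply: openI => //; exact: dom_open hA _.
  have ci : chart_domain i V by split=> // y [_ []].
  have cj : chart_domain j V by split=> // y [_ []].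
  have Vx : V x by [].
  have sj : smooth_q j V (fun y => s y j e0).
    by apply: smooth_q_sub (section_smooth hs j e0) => y [Wy [_ jy]].
  apply: etrans (etrans _ (Dbar_coef_trans (i := i) (K ord0) sj Vx)) _.
    apply: Dbar_coef_ext Vx => y [Wy [iy jy]].
    by rewrite (sec_transition hs Wy iy jy) transQ0.
  apply: eq_bigr => m _; apply: (congr1 (fun v => conjc (jac j i x m (K ord0)) *: qtr j i x v)).
  apply: etrans (esym (DE x j [ffun=> m] Wx jx)).
  by apply: (congr1 (fun k => Dbar_coef B j k (fun y => s y j e0) x)); rewrite ffunE.
- by move=> x i _ _ K u v; rewrite (ord1 u) (ord1 v) eqxx.
- move=> x i K Wx ix; rewrite DE //.
  have ci : chart_domain i (W `&` dom i) by exact: chart_domainI.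
  have [_ hg _] := section_smooth hs i e0.
  have Wix : (W `&` dom i) x by [].
  rewrite /Dbar_coef {1}/gam /= mxtraceD raddf_sum big1 ?addr0 => [|a _]; last first.
    by apply: etrans (mxtraceZ _ _) _; rewrite trace_Fm // mulr0.
  rewrite -(dzb_mxtrace (K ord0) hg Wix).
  have e y : (W `&` dom i) y -> \tr (gam (s y i e0)) = 0 by move=> _; exact: (sec_traceless hs).
  by rewrite (dzb_ext (K ord0) e Wix) dzb_cst.
- move=> i K; have ci : chart_domain i (W `&` dom i) by exact: chart_domainI.
  apply: (smooth_q_ext (s := Dbar_coef B i (K ord0) (fun y => s y i e0))).
    by move=> x [Wx ix]; rewrite DE.
  by apply: smooth_Dbar_coef; exact: section_smooth.
Qed.

Lemma DbarDbar W (s : qform 0) : open W -> sections B W s ->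
  Dbar B W (Dbar B W s) = 0.
Proof.
move=> oW hs; pose e0 : {ffun 'I_0 -> 'I_3} := [ffun=> ord0].
apply/funext => x; apply/funext => i.
have [[Wx ix]|n] := pselect ((W `&` dom i) x); last exact: Dbar_out.
apply/funext => K; rewrite DbarE // dzbar_wedge1.
have ci : chart_domain i (W `&` dom i) by exact: chart_domainI.
have Wix : (W `&` dom i) x by [].
have e k k' : Dbar_coef B i k (fun y => Dbar B W s y i [ffun=> k']) x =
    Dbar_coef B i k (Dbar_coef B i k' (fun y => s y i e0)) x.
  apply: Dbar_coef_ext Wix => y [Wy iy].
  by rewrite DbarE // (dzbar_wedge0 _ _ _ _ e0) ffunE.
rewrite !e; apply/eqP; rewrite subr_eq0; apply/eqP.
exact: (Dbar_coefC (P := P) _ _ (section_smooth hs i e0) Wix).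
Qed.
End FormSections.

(** * The local isomorphisms on sections *)

Section LocalIsomorphisms.
Context {R : realType} {X : topologicalType} {M : charts R X} {r : nat}.
Context {hA : complex_atlas M} {B : background M r} {hB : heterotic B}.
Context {P : potentials M r} {hP : local_potentials B P}.
Notation C := R[i].
Notation qfib := ('rV[C]_3 * 'M[C]_r * 'cV[C]_3)%type.
Notation qtr := (qtrans (B := B)).
Notation qform := (@qform R X M r).
Notation phi := (phi B P).
Notation phiV := (phiV B P).
Implicit Types (i j l : idx M) (x y : X) (W : set X).

Lemma section_smooth_sub p W W' j (s : qform p) K : sections B W' s ->
  W `<=` W' -> W `<=` dom j -> smooth_q j W (fun x => s x j K).
Proof.
move=> hs WW Wj; apply: smooth_q_sub (section_smooth hs j K) => x Wx.
by split; [exact: WW|exact: Wj].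
Qed.

Lemma phi_at p j W (s : qform p) x K : W x -> dom j x ->
  phi j W s x j K = phi_coef B P j (fun y => s y j K) x.
Proof.
move=> Wx jx.
exact: (congr1 (fun h => h K) (spread_at (fun K x => phi_coef B P j (fun y => s y j K) x) Wx jx)).
Qed.

Lemma phiV_at p j W (s : qform p) x K : W x -> dom j x ->
  phiV j W s x j K = phiV_coef B P j (fun y => s y j K) x.
Proof.
move=> Wx jx.
exact: (congr1 (fun h => h K) (spread_at (fun K x => phiV_coef B P j (fun y => s y j K) x) Wx jx)).
Qed.

Section Chart.
Variables (j : idx M) (W W' : set X).
Hypotheses (oW : open W) (WW : W `<=` W') (Wj : W `<=` dom j).
#[local] Instance chart_domain_W : chart_domain j W := ChartDomain oW Wj.

Lemma phi_coefN (s : X -> qfib) x : smooth_q j W s -> W x ->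
  phi_coef B P j (fun y => - s y) x = - phi_coef B P j s x.
Proof.
move=> hs Wx.
have := phi_coef_lin (-1) hs (@smooth_q0 _ _ _ r j W) Wx (B := B) (P := P).
rewrite phi_coef0 // addr0 scaleN1r => <-; congr (phi_coef _ _ _ _ x).
by apply/funext => y; rewrite addr0 scaleN1r.
Qed.

Lemma phiV_coefN (s : X -> qfib) x : smooth_q j W s -> W x ->
  phiV_coef B P j (fun y => - s y) x = - phiV_coef B P j s x.
Proof.
move=> hs Wx.
have := phiV_coef_lin (-1) hs (@smooth_q0 _ _ _ r j W) Wx (B := B) (P := P).
rewrite phiV_coef0 // addr0 scaleN1r => <-; congr (phiV_coef _ _ _ _ x).
by apply/funext => y; rewrite addr0 scaleN1r.
Qed.

Lemma trace_phi_gam (w : X -> 'cV[C]_3) x : W x -> \tr (phi_gam P j w x) = 0.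
Proof.
move=> Wx; rewrite raddf_sum big1 // => a _; apply: etrans (mxtraceZ _ _) _.
by rewrite (Apot_traceless hP) ?mulr0 //; exact: Wj.
Qed.

Lemma phi_section p (s : qform p) : sections B W' s -> sections B W (phi j W s).
Proof.
move=> hs; have sm K := section_smooth_sub K hs WW Wj.
apply: spread_section => //.
- by move=> K; exact: smooth_phi.
- move=> x Wx K u v uv; rewrite -(phi_coefN (sm K) Wx).
  by apply: phi_coef_ext Wx => y Wy; exact: (sec_alternating hs).
- move=> x K Wx; apply: etrans (mxtraceD _ _) _.
  by rewrite (sec_traceless hs) add0r; exact: trace_phi_gam.
Qed.

Lemma phiV_section p (s : qform p) : sections B W' s -> sections B W (phiV j W s).
Proof.
move=> hs; have sm K := section_smooth_sub K hs WW Wj.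
apply: spread_section => //.
- by move=> K; exact: smooth_phiV.
- move=> x Wx K u v uv; rewrite -(phiV_coefN (sm K) Wx).
  by apply: phiV_coef_ext Wx => y Wy; exact: (sec_alternating hs).
- move=> x K Wx; apply: etrans (mxtraceD _ _) _.
  by rewrite (sec_traceless hs) add0r raddfN /= trace_phi_gam // oppr0.
Qed.

Lemma phi_ext p (s s' : qform p) : (forall x, W x -> s x j = s' x j) ->
  phi j W s = phi j W s'.
Proof.
move=> e; apply/funext => x; apply/funext => l; rewrite /Defs.phi.
case: ifP => // /set_mem[Wx _]; congr (transQ _ _ _ _ _); apply/funext => K.
by apply: phi_coef_ext Wx => y Wy; rewrite e.
Qed.

Lemma phiV_ext p (s s' : qform p) : (forall x, W x -> s x j = s' x j) ->
  phiV j W s = phiV j W s'.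
Proof.
move=> e; apply/funext => x; apply/funext => l; rewrite /Defs.phiV.
case: ifP => // /set_mem[Wx _]; congr (transQ _ _ _ _ _); apply/funext => K.
by apply: phiV_coef_ext Wx => y Wy; rewrite e.
Qed.

Lemma phi_lin p W'' (c : C) (s s' : qform p) :
  sections B W' s -> W `<=` W'' -> sections B W'' s' ->
  phi j W (c *: s + s') = c *: phi j W s + phi j W s'.
Proof.
move=> hs WW'' hs'; apply/funext => x; apply/funext => l; apply/funext => K.
rewrite -[RHS]/(c *: phi j W s x l K + phi j W s' x l K) /Defs.phi.
case: ifP => [/set_mem[Wx _]|_]; last by rewrite scaler0 addr0.
apply: etrans _ (transQ_lin j l x c _ _ K); apply: (congr1 (fun h => transQ B j l x h K)).
apply/funext => L.
exact: phi_coef_lin (section_smooth_sub L hs WW Wj) (section_smooth_sub L hs' WW'' Wj) Wx.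
Qed.

Lemma phiV_lin p W'' (c : C) (s s' : qform p) :
  sections B W' s -> W `<=` W'' -> sections B W'' s' ->
  phiV j W (c *: s + s') = c *: phiV j W s + phiV j W s'.
Proof.
move=> hs WW'' hs'; apply/funext => x; apply/funext => l; apply/funext => K.
rewrite -[RHS]/(c *: phiV j W s x l K + phiV j W s' x l K) /Defs.phiV.
case: ifP => [/set_mem[Wx _]|_]; last by rewrite scaler0 addr0.
apply: etrans _ (transQ_lin j l x c _ _ K); apply: (congr1 (fun h => transQ B j l x h K)).
apply/funext => L.
exact: phiV_coef_lin (section_smooth_sub L hs WW Wj) (section_smooth_sub L hs' WW'' Wj) Wx.
Qed.

Lemma phiVK p (s : qform p) : sections B W' s -> forall U, W `<=` U ->
  phiV j W (phi j U s) = restr W s.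
Proof.
move=> hs U WU; apply/funext => x; apply/funext => l; rewrite /Defs.phiV /restr.
case: ifP => [/set_mem[Wx lx]|/negP n]; last first.
  case: ifP => // /set_mem Wx; rewrite (sec_support hs) // => -[_ lx].
  by apply: n; rewrite mem_set.
rewrite mem_set // (sec_transition hs (WW Wx) lx (Wj Wx)).
congr (transQ _ _ _ _ _); apply/funext => K.
rewrite -[RHS](congr1 (fun h => h x) (phi_coefK B P j (fun y => s y j K))).
apply: phiV_coef_ext Wx => y Wy; apply: phi_at; [exact: WU|exact: Wj].
Qed.

Lemma phiK p (s : qform p) : sections B W' s -> forall U, W `<=` U ->
  phi j W (phiV j U s) = restr W s.
Proof.
move=> hs U WU; apply/funext => x; apply/funext => l; rewrite /Defs.phi /restr.
case: ifP => [/set_mem[Wx lx]|/negP n]; last first.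
  case: ifP => // /set_mem Wx; rewrite (sec_support hs) // => -[_ lx].
  by apply: n; rewrite mem_set.
rewrite mem_set // (sec_transition hs (WW Wx) lx (Wj Wx)).
congr (transQ _ _ _ _ _); apply/funext => K.
rewrite -[RHS](congr1 (fun h => h x) (phiV_coefK B P j (fun y => s y j K))).
apply: phi_coef_ext Wx => y Wy; apply: phiV_at; [exact: WU|exact: Wj].
Qed.

Lemma restr_phi p (s : qform p) U : W `<=` U -> restr W (phi j U s) = phi j W s.
Proof.
move=> WU; apply/funext => x; apply/funext => l; rewrite /Defs.phi /restr.
case: (asboolP (W x)) => [Wx|n]; last by rewrite !memNset // => -[].
rewrite mem_set //; case: (asboolP (dom l x)) => [lx|n]; last by rewrite !memNset // => -[].
by rewrite !mem_set //; split=> //; exact: WU.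
Qed.

Lemma restr_phiV p (s : qform p) U : W `<=` U -> restr W (phiV j U s) = phiV j W s.
Proof.
move=> WU; apply/funext => x; apply/funext => l; rewrite /Defs.phiV /restr.
case: (asboolP (W x)) => [Wx|n]; last by rewrite !memNset // => -[].
rewrite mem_set //; case: (asboolP (dom l x)) => [lx|n]; last by rewrite !memNset // => -[].
by rewrite !mem_set //; split=> //; exact: WU.
Qed.

Lemma phiV_restr p (s : qform p) U : W `<=` U -> phiV j W (restr U s) = phiV j W s.
Proof. by move=> WU; apply: phiV_ext => x Wx; rewrite /restr mem_set //; exact: WU. Qed.

Lemma phi_restr p (s : qform p) U : W `<=` U -> phi j W (restr U s) = phi j W s.
Proof. by move=> WU; apply: phi_ext => x Wx; rewrite /restr mem_set //; exact: WU. Qed.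

Definition e0 : {ffun 'I_0 -> 'I_3} := [ffun=> ord0].

(** The transition functions are holomorphic, so that holomorphy may be tested
    in one chart. *)
Lemma delbar_eq0 (s : qform 0) : sections B W s ->
  (forall k x, W x -> delbar_coef j k (fun y => s y j e0) x = 0) -> delbar W s = 0.
Proof.
move=> hs h0; apply/funext => x; apply/funext => l.
have [[Wx lx]|n] := pselect ((W `&` dom l) x); last exact: delbar_out.
apply/funext => K; rewrite delbarE // (dzbar_wedge0 _ _ _ _ e0).
pose V := W `&` dom l.
have Vx : V x by [].
have cl : chart_domain l V by exact: chart_domainI.
have cj : chart_domain j V.
  by split; [exact: (domain_open (chart_domain := cl))|move=> y [] /Wj].
have sj : smooth_q j V (fun y => s y j e0).
  by apply: smooth_q_sub (section_smooth_sub e0 hs (fun x => id) Wj) => y [].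
apply: etrans (etrans _ (delbar_coef_trans (i := l) (K ord0) sj Vx)) _.
  apply: delbar_coef_ext Vx => y [Wy ly].
  by rewrite (sec_transition hs Wy ly (Wj Wy)) transQ0.
by rewrite big1 // => m _; rewrite h0 // qtrans0 scaler0.
Qed.
End Chart.

Lemma delbar_phi_eq0 j W (s : qform 0) : open W -> W `<=` dom j ->
  sections B W s -> Dbar B W s = 0 ->
  delbar W (phi j W s) = 0.
Proof.
move=> oW Wj hs ds; have cW : chart_domain j W := ChartDomain oW Wj.
have sm : smooth_q j W (fun x => s x j e0) := section_smooth_sub e0 hs (fun x => id) Wj.
apply: (delbar_eq0 oW Wj); first exact: (phi_section oW (fun x => id) Wj hs).
move=> k x Wx; rewrite -(phi_coef0 (B := B) (P := P) Wx).
apply: etrans (etrans _ (delbar_phi k sm Wx)) _.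
  by apply: delbar_coef_ext Wx => y Wy; apply: phi_at => //; exact: Wj.
apply: phi_coef_ext Wx => y Wy.
apply: etrans _ (congr1 (fun h : qform 1 => h y j [ffun=> k]) ds).
by rewrite DbarE ?(dzbar_wedge0 _ _ _ _ e0) ?ffunE //; exact: Wj.
Qed.

Lemma Dbar_phiV_eq0 j W (s : qform 0) : open W -> W `<=` dom j ->
  sections B W s -> delbar W s = 0 ->
  Dbar B W (phiV j W s) = 0.
Proof.
move=> oW Wj hs ds; have cW : chart_domain j W := ChartDomain oW Wj.
have sm : smooth_q j W (fun x => s x j e0) := section_smooth_sub e0 hs (fun x => id) Wj.
have hV : sections B W (phiV j W s) by exact: (phiV_section oW (fun x => id) Wj hs).
have hD : sections B W (Dbar B W (phiV j W s)) by exact: (Dbar_section oW hV).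
apply: (section_eq Wj hD); first exact: sections0.
move=> x Wx; apply/funext => K; rewrite DbarE //; last exact: Wj.
rewrite (dzbar_wedge0 _ _ _ _ e0).
apply: etrans (etrans _ (Dbar_phiV (P := P) (K ord0) sm Wx)) _.
  by apply: Dbar_coef_ext Wx => y Wy; apply: phiV_at => //; exact: Wj.
apply: etrans _ (phiV_coef0 (B := B) (P := P) Wx).
apply: phiV_coef_ext Wx => y Wy.
apply: etrans _ (congr1 (fun h : qform 1 => h y j K) ds).
by rewrite delbarE ?(dzbar_wedge0 _ _ _ _ e0) //; exact: Wj.
Qed.

Lemma psi_phi p i j W W' (s : qform p) : open W -> W `<=` dom i -> W `<=` dom j ->
  sections B W' s -> W `<=` W' -> forall U, W `<=` U ->
  psi B P i j W (phi j U s) = phi i W s.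
Proof.
move=> oW Wi Wj hs WW U WU; rewrite /psi (phiVK oW WW Wj hs WU).
by rewrite phi_restr.
Qed.
End LocalIsomorphisms.

(** * Local primitives *)

Section Poincare.
Context {R : realType} {X : topologicalType} {M : charts R X} {r : nat}.
Context {hA : complex_atlas M} {B : background M r} {hB : heterotic B}.
Context {P : potentials M r} {hP : local_potentials B P}.
Notation C := R[i].
Notation qfib := ('rV[C]_3 * 'M[C]_r * 'cV[C]_3)%type.
Notation qform := (@qform R X M r).
Notation phi := (phi B P).
Notation phiV := (phiV B P).
Implicit Types (x y : X) (j : idx M).

(** The linear functional [h] selects a scalar component of Q. *)
Lemma component_primitive j (h : qfib -> C) (f : {ffun 'I_1 -> 'I_3} -> X -> qfib) :
  dbar_poincare j ->
  (forall c v w, h (c *: v + w) = c * h v + h w) ->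
  (forall K, smooth_on j (dom j) (fun x => h (f K x))) ->
  (forall k (s : X -> qfib) x, h (delbar_coef j k s x) = dzb j k (fun y => h (s y)) x) ->
  (forall K x, dom j x -> dzbar_wedge (delbar_coef j) f K x = 0) ->
  exists b : X -> C, smooth_on j (dom j) b /\
    forall k x, dom j x -> dzb j k b x = h (f [ffun=> k] x).
Proof.
move=> pj hlin sm hd closed.
have h0 : h 0 = 0.
  by have := hlin (-1) 0 0; rewrite scaler0 addr0 mulN1r addNr.
have [||b [sb _] bE] := pj 0 (fun K x => h (f K x)).
- by split=> // x _ K u v; rewrite (ord1 u) (ord1 v) eqxx.
- move=> K x jx; rewrite -h0 -(closed K x jx) /dzbar_wedge.
  elim/big_rec2: _ => [|u y v _ ->]; first by rewrite h0.
  by rewrite hlin hd.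
exists (b e0); split=> // k x jx; rewrite -bE //.
rewrite /dzbar_wedge big_ord_recl big_ord0 addr0 expr0 scale1r ffunE.
by rewrite (ffun0_eq (omit _ _) e0).
Qed.

(** The Poincare lemma is applied to each component separately, which loses the
    trace condition; it is restored afterwards. *)
Lemma dbar_poincareQ j (f : qform 1) : dbar_poincare j -> sections B (dom j) f ->
  (forall K x, dom j x -> dzbar_wedge (delbar_coef j) (fun L y => f y j L) K x = 0) ->
  exists2 b : qform 0, sections B (dom j) b &
    forall k x, dom j x -> delbar_coef j k (fun y => b y j e0) x = f x j [ffun=> k].
Proof.
move=> pj hf closed; have sm K := section_smooth hf j K.
have oj : open (dom j) by exact: dom_open.
have smj K : smooth_q j (dom j) (fun x => f x j K) by apply: smooth_q_sub (sm K) => x.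
have /choice[bk bkP] a : exists b : X -> C, smooth_on j (dom j) b /\
    forall k x, dom j x -> dzb j k b x = kap (f x j [ffun=> k]) 0 a.
  apply: (component_primitive (h := fun v => kap v 0 a) pj) closed => //.
  - by move=> c v w; rewrite /kap /= !mxE.
  - by move=> K; have [h _ _] := smj K; exact: h.
  - by move=> k s x; rewrite /kap /= mxE.
have /choice[bg bgP] ab : exists b : X -> C, smooth_on j (dom j) b /\
    forall k x, dom j x -> dzb j k b x = gam (f x j [ffun=> k]) ab.1 ab.2.
  apply: (component_primitive (h := fun v => gam v ab.1 ab.2) pj) closed => //.
  - by move=> c v w; rewrite /gam /= !mxE.
  - by move=> K; have [_ h _] := smj K; exact: h.
  - by move=> k s x; rewrite /gam /= mxE.
have /choice[bt btP] a : exists b : X -> C, smooth_on j (dom j) b /\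
    forall k x, dom j x -> dzb j k b x = tng (f x j [ffun=> k]) a 0.
  apply: (component_primitive (h := fun v => tng v a 0) pj) closed => //.
  - by move=> c v w; rewrite /tng /= !mxE.
  - by move=> K; have [_ _ h] := smj K; exact: h.
  - by move=> k s x; rewrite /tng /= mxE.
pose G x : 'M[C]_r := \matrix_(a, b) bg (a, b) x.
have sG : smooth_mx j (dom j) G.
  by move=> a b; apply: smooth_ext (bgP (a, b)).1 => x _; rewrite mxE.
have dG k x : dom j x -> dzb_mx j k G x = gam (f x j [ffun=> k]).
  move=> jx; apply/matrixP => a b; rewrite [LHS]mxE; apply: etrans _ ((bgP (a, b)).2 k x jx).
  by apply: dzb_ext jx => y _; rewrite mxE.
(* The trace of the primitive is holomorphic, so that it can be subtracted. *)
pose t x := r%:R^-1 * \tr (G x).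
have st : smooth_on j (dom j) t.
  by apply: smoothM (smooth_mxtrace sG); exact: smooth_cst.
have dt k x : dom j x -> dzb j k t x = 0.
  move=> jx; have hc : smooth_on j (dom j) (fun=> r%:R^-1 : C) by exact: smooth_cst.
  rewrite (dzbM k hc (smooth_mxtrace sG) jx) dzb_cst mul0r add0r (dzb_mxtrace k sG jx).
  by rewrite dG // (sec_traceless hf) mulr0.
pose c x : qfib := (\row_a bk a x, G x - (t x)%:M, \col_a bt a x).
have sc : smooth_q j (dom j) c.
  split.
  - by move=> o a; apply: smooth_ext (bkP a).1 => x _; rewrite mxE.
  - apply: smooth_mxD => //; apply: smooth_mxN => a b.
    case: (altP (a =P b)) => [->|ab].
      by apply: smooth_ext st => x _; rewrite mxE eqxx.
    by apply: smooth_ext (smooth_cst 0) => x _; rewrite mxE (negPf ab).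
  - by move=> a o; apply: smooth_ext (btP a).1 => x _; rewrite mxE.
have tc x : \tr (gam (c x)) = 0.
  rewrite /gam /= raddfB /= mxtrace_scalar /t.
  have [r0|r0] := eqVneq (r%:R : C) 0.
    (* for rank 0 the trace is an empty sum *)
    rewrite r0 invr0 mul0r mul0rn subr0.
    move/eqP: r0; rewrite pnatr_eq0 => /eqP r0.
    by rewrite /mxtrace big1 // => a; exfalso; have := ltn_ord a; rewrite [X in (_ < X)%N]r0.
  by rewrite -[(_ * _) *+ r]mulr_natl mulrA mulfV // mul1r subrr.
have Wj : dom j `<=` dom j by [].
exists (spread (B := B) j (dom j) (fun _ => c)).
  by apply: spread_section => // x _ K [].
move=> k x jx.
have e y : dom j y -> spread (B := B) j (dom j) (fun _ => c) y j e0 = c y.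
  by move=> jy; rewrite spread_at.
rewrite (delbar_coef_ext k e jx) [RHS]surjective_pairing [X in (X, _)]surjective_pairing.
have e1 : dzb_mx j k (fun y => kap (c y)) x = kap (f x j [ffun=> k]).
  apply/rowP => a; rewrite [LHS]mxE; apply: etrans _ ((bkP a).2 k x jx).
  by apply: dzb_ext jx => y _; rewrite mxE.
have e2 : dzb_mx j k (fun y => gam (c y)) x = gam (f x j [ffun=> k]).
  rewrite -(dG k x jx); apply/matrixP => a b; rewrite [LHS]mxE [RHS]mxE.
  have dd : smooth_on j (dom j) (fun y => - ((t y)%:M : 'M[C]_r) a b) /\
      dzb j k (fun y => - ((t y)%:M : 'M[C]_r) a b) x = 0.
    have sN : smooth_on j (dom j) (fun y => - t y) by exact: smoothN.
    have dN : dzb j k (fun y => - t y) x = 0.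
      have hc : smooth_on j (dom j) (fun=> -1 : C) by exact: smooth_cst.
      have ee y : dom j y -> - t y = -1 * t y by rewrite mulN1r.
      by rewrite (dzb_ext k ee jx) (dzbM k hc st jx) dzb_cst dt // mul0r mulr0 addr0.
    case: (altP (a =P b)) => [->|ab].
      have ee y : dom j y -> - t y = - ((t y)%:M : 'M[C]_r) b b by rewrite mxE eqxx.
      by split; [apply: smooth_ext ee sN|rewrite -(dzb_ext k ee jx)].
    have ee y : dom j y -> 0 = - ((t y)%:M : 'M[C]_r) a b by rewrite mxE (negPf ab) oppr0.
    by split; [apply: smooth_ext ee (smooth_cst 0)|rewrite -(dzb_ext k ee jx) dzb_cst].
  rewrite -[RHS]addr0 -dd.2 -(dzbD k (sG a b) dd.1 jx).
  by apply: dzb_ext jx => y _; rewrite /gam /= mxE [X in _ + X]mxE.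
have e3 : dzb_mx j k (fun y => tng (c y)) x = tng (f x j [ffun=> k]).
  apply/colP => a; rewrite [LHS]mxE; apply: etrans _ ((btP a).2 k x jx).
  by apply: dzb_ext jx => y _; rewrite mxE.
exact: (congr2 pair (congr2 pair e1 e2) e3).
Qed.

(** Conjugate by [phi] and apply the Poincare lemma. *)
Lemma Dbar_primitive j (s : qform 1) : dbar_poincare j -> sections B [set: X] s ->
  Dbar B [set: X] s = 0 ->
  exists2 a : qform 0, sections B (dom j) a &
    forall x l, dom j x -> s x l = Dbar B (dom j) a x l.
Proof.
move=> pj hs ds; have oj : open (dom j) by exact: dom_open.
have jT : dom j `<=` [set: X] by [].
have jj : dom j `<=` dom j by [].
have sm K : smooth_q j (dom j) (fun x => s x j K) := section_smooth_sub K hs jT jj.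
have hf : sections B (dom j) (phi j (dom j) s) by exact: (phi_section oj jT jj hs).
have closed K x : dom j x ->
    dzbar_wedge (delbar_coef j) (fun L y => phi j (dom j) s y j L) K x = 0.
  move=> jx; rewrite dzbar_wedge1.
  have e k L : delbar_coef j k (fun y => phi j (dom j) s y j L) x =
      phi_coef B P j (Dbar_coef B j k (fun y => s y j L)) x.
    apply: etrans (delbar_phi k (sm L) jx).
    by apply: delbar_coef_ext jx => y jy; exact: phi_at.
  have sD k L : smooth_q j (dom j) (Dbar_coef B j k (fun y => s y j L)).
    by apply: smooth_Dbar_coef; exact: sm.
  rewrite !e addrC -scaleN1r.
  apply: etrans (esym (phi_coef_lin (-1) (sD _ _) (sD _ _) jx)) _.
  rewrite -(phi_coef0 (B := B) (P := P) jx).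
  apply: phi_coef_ext jx => y jy.
  apply: etrans _ (congr1 (fun h : qform 2 => h y j K) ds).
  by apply: esym; rewrite DbarE // dzbar_wedge1 scaleN1r addrC.
have [b hb bE] := dbar_poincareQ pj hf closed.
have ha : sections B (dom j) (phiV j (dom j) b) by exact: (phiV_section oj jj jj hb).
exists (phiV j (dom j) b) => //.
have hD : sections B (dom j) (Dbar B (dom j) (phiV j (dom j) b)).
  exact: (Dbar_section oj ha).
have hr : sections B (dom j) (restr (dom j) s) by exact: (restr_section oj jT hs).
suff e : restr (dom j) s = Dbar B (dom j) (phiV j (dom j) b).
  by move=> x l jx; rewrite -e /restr mem_set.
apply: (section_eq jj hr hD) => x jx; apply/funext => K.
rewrite /restr mem_set // DbarE // (dzbar_wedge0 _ _ _ _ e0).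
have smb : smooth_q j (dom j) (fun y => b y j e0) := section_smooth_sub e0 hb jj jj.
have eK : [ffun=> K ord0] = K by apply/ffunP => u; rewrite ffunE (ord1 u).
rewrite -[LHS](congr1 (fun h => h x) (phi_coefK B P j (fun y => s y j K))).
apply: etrans (etrans _ (esym (Dbar_phiV (P := P) (K ord0) smb jx))) _.
  apply: phiV_coef_ext jx => y jy; rewrite bE // eK.
  by apply: esym; exact: phi_at.
by apply: Dbar_coef_ext jx => y jy; apply: esym; exact: phiV_at.
Qed.
End Poincare.

(** * Partitions of unity *)

Section PartitionOfUnity.
Context {R : realType} {X : topologicalType} {M : charts R X}.
Context {hA : complex_atlas M}.
Notation C := R[i].
Implicit Types (i l : idx M) (x y : X).
Hypothesis hausX : hausdorff_space X.

(** This support condition makes the product with a section over [dom i] extend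
    by zero. *)
Definition locally_zero_off i (f : X -> C) : Prop :=
  forall x, ~ dom i x -> exists U, [/\ open U, U x & forall y, U y -> f y = 0].

(** Take exp(-1/t) at t = e^2 - |z - z0|^2 in the chart, extended by zero.  It
    vanishes off the image of a compact box, which is closed in X because X is
    Hausdorff; this makes the extension smooth in every chart. *)
Lemma bump_function i x0 : dom i x0 -> exists chi : X -> R,
  [/\ forall x, 0 <= chi x,
      exists O, [/\ open O, O x0 & forall x, O x -> 0 < chi x],
      forall l, smooth_on l (dom l) (fun x => (chi x)%:C%C) &
      locally_zero_off i (fun x => (chi x)%:C%C)].
Proof.
move=> ix0; pose z0 := crd i x0.
have oI : open (crd i @` dom i) by exact: crd_open.
have : nbhs z0 (crd i @` dom i) by apply: open_nbhs_nbhs; split=> //; exists x0.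
move=> /nbhs_ballP[d /= d0 ballI].
pose e := d / 2; have e0 : 0 < e by rewrite divr_gt0.
pose q (z : model R) : R := \sum_a (z.1 0 a - z0.1 0 a) * (z.1 0 a - z0.1 0 a) +
                            \sum_a (z.2 0 a - z0.2 0 a) * (z.2 0 a - z0.2 0 a).
pose A (v : 'rV[R]_3) := [set w : 'rV[R]_3 | forall a, `[v 0 a - e, v 0 a + e]%classic (w 0 a)].
pose box : set (model R) := A z0.1 `*` A z0.2.
have boxI : box `<=` crd i @` dom i.
  have near (a b : R) : `[a - e, a + e]%classic b -> ball a d b.
    rewrite /= in_itv /= => /andP[h1 h2]; rewrite /ball /= ltr_norml.
    by rewrite /e in h1 h2; lra.
  by move=> z [h1 h2]; apply: ballI; split; split=> // o a; rewrite (ord1 o);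
    apply: near; [exact: h1|exact: h2].
have cbox : compact box.
  have cA v : compact (A v).
    apply: (@rV_compact R 3 (fun a => `[v 0 a - e, v 0 a + e]%classic)) => a.
    exact: segment_compact.
  exact: (compact_setX (cA _) (cA _)).
pose K := crdV i @` box.
have cK : closed K.
  apply: compact_closed => //; apply: continuous_compact => //.
  apply: continuous_in_subspaceT => z /set_mem /boxI; exact: crdV_continuous.
have sq_le (I : finType) (u : I -> R) a : u a * u a <= \sum_b u b * u b.
  rewrite (bigD1 a) //= lerDl sumr_ge0 // => b _; exact: sqr_ge0.
have ss_ge0 (I : finType) (u : I -> R) : 0 <= \sum_b u b * u b.
  by apply: sumr_ge0 => b _; exact: sqr_ge0.
have off z : ~ box z -> e ^+ 2 - q z <= 0.
  move=> n; rewrite leNgt; apply/negP => lt; apply: n.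
  have coord (c w : R) : (w - c) * (w - c) < e ^+ 2 -> `[c - e, c + e]%classic w.
    move=> h; rewrite /= in_itv /=; apply/andP.
    by split; rewrite leNgt; apply/negP => h'; nra.
  have lt' : q z < e ^+ 2 by rewrite -subr_gt0.
  split=> a; apply: coord; apply: le_lt_trans lt'.
    apply: le_trans (sq_le _ (fun a => z.1 0 a - z0.1 0 a) a) _.
    by rewrite /q lerDl; exact: (ss_ge0 _ (fun a => z.2 0 a - z0.2 0 a)).
  apply: le_trans (sq_le _ (fun a => z.2 0 a - z0.2 0 a) a) _.
  by rewrite /q lerDr; exact: (ss_ge0 _ (fun a => z.1 0 a - z0.1 0 a)).
pose chi x := if pselect (dom i x) then flat 0 (e ^+ 2 - q (crd i x)) else 0.
have chi_in x : dom i x -> chi x = flat 0 (e ^+ 2 - q (crd i x)).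
  by rewrite /chi; case: pselect.
have chi_out x : ~ dom i x -> chi x = 0 by rewrite /chi; case: pselect.
have chi_K x : ~ K x -> chi x = 0.
  move=> n; have [ix|/chi_out //] := pselect (dom i x).
  rewrite chi_in // flat_le0 //; apply: off => bx; apply: n.
  by exists (crd i x) => //; rewrite (crdK hA).
have sm_i : smooth_on i (dom i) (fun x => (chi x)%:C%C).
  move=> n; split; last by apply: Ck_ext oI _ (Ck_cst n _ 0) => z _.
  have cp a : Ck n (crd i @` dom i) (fun z => (crd i (crdV i z)).1 0 a).
    by have := (crd_holomorphic hA i i a).1 n; rewrite setIid => -[].
  have cq a : Ck n (crd i @` dom i) (fun z => (crd i (crdV i z)).2 0 a).
    by have := (crd_holomorphic hA i i a).1 n; rewrite setIid => -[].
  have sqC (u : 'I_3 -> model R -> R) (c : 'I_3 -> R) : (forall a, Ck n (crd i @` dom i) (u a)) ->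
      Ck n (crd i @` dom i) (fun z => \sum_a (u a z - c a) * (u a z - c a)).
    move=> hu; apply: Ck_sum => // a.
    by apply: CkM => //; apply: CkD => //; exact: Ck_cst.
  have hq : Ck n (crd i @` dom i) (fun z => e ^+ 2 - q (crd i (crdV i z))).
    apply: CkD => //; first exact: Ck_cst.
    by apply: CkN => //; apply: CkD => //; exact: sqC.
  apply: Ck_ext oI _ (Ck_flat 0 oI hq) => z iz /=.
  by rewrite chi_in //; exact: (crdV_img _ iz).
have zeroK x : ~ K x -> exists U, [/\ open U, U x & forall y, U y -> (chi y)%:C%C = 0].
  move=> nK; exists (~` K); split => //; first exact: closed_openC.
  by move=> y /chi_K ->.
have KI : K `<=` dom i.
  by move=> _ [z /boxI [x ix <-] <-]; rewrite (crdK hA).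
exists chi; split.
- move=> x; have [ix|/chi_out-> //] := pselect (dom i x).
  by rewrite chi_in //; exact: flat_ge0.
- have pos0 : 0 < chi x0.
    rewrite chi_in // flat0_gt0 //; have -> : q (crd i x0) = 0.
      by rewrite /q !big1 ?addr0 // => a _; rewrite subrr mul0r.
    by rewrite subr0 exprn_gt0.
  have cont x : dom i x -> {for x, continuous chi}.
    move=> ix; have h0 := (sm_i 0).1 _ (ex_intro2 _ _ x ix erefl).
    have h1 := continuous_comp (crd_continuous hA ix) h0.
    rewrite /prop_for /continuous_at.
    have ee : (fun y => complex.Re ((chi (crdV i (crd i y)))%:C%C)) x = chi x.
      by rewrite /= (crdK hA).
    rewrite -[X in _ --> X]ee; apply: cvg_trans h1; apply: near_eq_cvg.
    apply: filterS (open_nbhs_nbhs (conj (dom_open hA i) ix)) => y iy.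
    by rewrite /= (crdK hA).
  exists (dom i `&` [set x | 0 < chi x]); split=> //; last by move=> x [].
  rewrite openE => x [ix px]; apply: filterI.
    by apply: open_nbhs_nbhs; split=> //; exact: dom_open.
  have := cont x ix; rewrite /prop_for /continuous_at => /cvgr_gt; exact.
- move=> l.
  apply: smooth_local => x lx; have [ix|nx] := pselect (dom i x).
    exists (dom i `&` dom l); first by split=> //; apply: openI; exact: dom_open.
    have ci : chart_domain i (dom i `&` dom l) by split=> [|y []//]; apply: openI; exact: dom_open.
    have cl : chart_domain l (dom i `&` dom l) by split=> [|y []//]; apply: openI; exact: dom_open.
    by apply: (smooth_chart (i := i)); apply: smooth_sub sm_i => y [].
  have nK : ~ K x by move=> /KI.
  have oV : open (~` K `&` dom l) by apply: openI; [exact: closed_openC|exact: dom_open].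
  exists (~` K `&` dom l); first by split.
  have cl : chart_domain l (~` K `&` dom l) by split=> // y [].
  by apply: smooth_ext (smooth_cst 0) => y [/chi_K ->].
- by move=> x nx; apply: zeroK => /KI.
Qed.

Hypothesis compactX : compact [set: X].

(** By compactness finitely many bump functions have a positive sum, by which they
    are divided. *)
Lemma partition_of_unity : exists (s : seq X) (k : X -> idx M) (rho : X -> X -> C),
  [/\ forall m l, smooth_on l (dom l) (rho m),
      forall m, locally_zero_off (k m) (rho m) &
      forall x, \sum_(m <- s) rho m x = 1].
Proof.
have /choice[k kP] : forall x, exists i, dom i x by exact: atlas_cover.
have /choice[chi chiP] := fun x => bump_function (kP x).
have /choice[N NP] : forall x, exists N, [/\ open N, N x & forall y, N y -> 0 < chi x y].
  by move=> x; have [_ h _ _] := chiP x.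
have [[x0 _]|noX] := pselect (exists x : X, True); last first.
  exists [::], k, (fun _ _ => 0); split.
  - by move=> m; exfalso; apply: noX; exists m.
  - by move=> m; exfalso; apply: noX; exists m.
  - by move=> m; exfalso; apply: noX; exists m.
(* a base point turns [X] into a pointed space, to which covers apply *)
pose pX : ptopologicalType := HB.pack X (isPointed.Build X x0).
have cX : @cover_compact X [set: X].
  have h : @compact pX [set: X] by exact: compactX.
  by rewrite compact_cover in h; exact: h.
have [x _|x _|s _ cov] := cX _ [set: X] N; first by have [] := NP x.
  by exists x => //; have [] := NP x.
pose S x : C := \sum_(m <- finmap.enum_fset s) (chi m x)%:C%C.
have S_neq0 x : S x != 0.
  have [m ms Nmx] := cov x I.
  have pos : 0 < \sum_(m <- finmap.enum_fset s) chi m x.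
    rewrite (big_rem m) //=; apply: ltr_pwDl; first by have [_ _] := NP m; exact.
    by apply: sumr_ge0 => m' _; have [h _ _ _] := chiP m'; exact: h.
  by rewrite /S -rmorph_sum /= fmorph_eq0 gt_eqF //; exact: pos.
have sS l : smooth_on l (dom l) S.
  by apply: (smooth_sum _ (Q := xpredT)) => m _; have [_ _ h _] := chiP m; exact: h.
exists (finmap.enum_fset s), k, (fun m x => (chi m x)%:C%C / S x); split.
- move=> m l; apply: smoothM; first by have [_ _ h _] := chiP m; exact: h.
  by apply: smoothV => [x _|]; [exact: S_neq0|exact: sS].
- move=> m x nx; have [_ _ _ h] := chiP m; have [U [oU Ux hU]] := h x nx.
  exists U; split=> //; move=> y Uy.
  exact: (etrans (congr1 (fun z => z / S y) (hU y Uy)) (mul0r _)).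
- by move=> x; rewrite -mulr_suml; apply: mulfV; exact: S_neq0.
Qed.
End PartitionOfUnity.

(** * Isomorphisms of quotients from linear relations *)

Section Isomorphism.
Context {K : pzRingType} (H H' : subquot K).
Variable Rel : amb H -> amb H' -> Prop.
Hypothesis Rel_num : forall x x', Rel x x' -> num H x /\ num H' x'.
Hypothesis Rel_lin : forall a x y x' y',
  Rel x x' -> Rel y y' -> Rel (a *: x + y) (a *: x' + y').
Hypothesis Rel_total : forall x, num H x -> exists x', Rel x x'.
Hypothesis Rel_onto : forall x', num H' x' -> exists x, Rel x x'.
Hypothesis Rel_den : forall x x', Rel x x' -> (den H x <-> den H' x').
Hypothesis den0 : den H 0.
Hypothesis den_lin : forall a x y, den H x -> den H y -> den H (a *: x + y).

Let Rel_sub x y x' y' : Rel x x' -> Rel y y' -> Rel (x - y) (x' - y').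
Proof.
move=> rx ry; have := Rel_lin (-1) ry rx.
by rewrite !scaleN1r addrC [- y' + _]addrC.
Qed.

Let den_add x y : den H x -> den H y -> den H (x + y).
Proof. by move=> dx dy; rewrite -[x]scale1r; exact: den_lin. Qed.

Let den_swap x y : den H (x - y) -> den H (y - x).
Proof. by move=> d; rewrite -opprB -scaleN1r -[_ *: _]addr0; exact: den_lin. Qed.

Let coset_eq x y : den H (x - y) -> coset_in H x = coset_in H y.
Proof.
have sub u v : den H (u - v) -> coset_in H u `<=` coset_in H v.
  by move=> d z [nz dz]; split=> //; rewrite -(subrKA u); exact: den_add.
by move=> d; apply/seteqP; split; apply: sub => //; exact: den_swap.
Qed.

Let coset_eq' x y x' y' : Rel x x' -> Rel y y' -> den H (x - y) ->
  coset_in H' x' = coset_in H' y'.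
Proof.
have sub u v u' v' : Rel u u' -> Rel v v' -> den H (u - v) ->
    coset_in H' u' `<=` coset_in H' v'.
  move=> ru rv d z' [nz dz]; split=> //; have [z rz] := Rel_onto nz.
  apply: (Rel_den (Rel_sub rz rv)).1; rewrite -(subrKA u); apply: den_add => //.
  exact: (Rel_den (Rel_sub rz ru)).2.
move=> rx ry d; apply/seteqP; split; first exact: sub rx ry d.
by apply: sub ry rx _; exact: den_swap.
Qed.

Let Phi (A : set (amb H)) : set (amb H') :=
  [set y' | exists x x', [/\ A x, Rel x x' & coset_in H' x' y']].

Let coset_self x x' : Rel x x' -> coset_in H x x /\ coset_in H' x' x'.
Proof.
move=> rx; have [nx nx'] := Rel_num rx; have d : den H (x - x) by rewrite subrr.
by do 2 split=> //; exact: (Rel_den (Rel_sub rx rx)).1.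
Qed.

Let PhiE x x' : Rel x x' -> Phi (coset_in H x) = coset_in H' x'.
Proof.
move=> rx; apply/seteqP; split=> y'.
  by move=> [y [y1 [[ny dy] ry]]]; rewrite (coset_eq' ry rx dy).
by move=> h; exists x, x'; split=> //; exact: (coset_self rx).1.
Qed.

(** A coset is sent to the coset of any element related to one of its members.
    This is well defined and injective because the relation matches the two
    denominators. *)
Lemma isomorphic_of_relation : isomorphic H H'.
Proof.
exists Phi; split.
  split.
  - move=> _ [x nx <-]; have [x' rx] := Rel_total nx.
    by rewrite (PhiE rx); exists x' => //; exact: (Rel_num rx).2.
  - move=> A A' /set_mem[x nx <-] /set_mem[y ny <-].
    have [x' rx] := Rel_total nx; have [y' ry] := Rel_total ny.
    rewrite (PhiE rx) (PhiE ry) => e; apply: coset_eq.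
    apply: (Rel_den (Rel_sub rx ry)).2.
    by have := (coset_self rx).2; rewrite e => -[].
  - move=> _ [x' nx' <-]; have [x rx] := Rel_onto nx'.
    by exists (coset_in H x); [exists x => //; exact: (Rel_num rx).1|exact: PhiE].
move=> a x y x' y' nx ny nx' ny' ex ey.
have [x1 rx] := Rel_total nx; have [y1 ry] := Rel_total ny.
have [u ru] := Rel_onto nx'; have [v rv] := Rel_onto ny'.
rewrite (PhiE rx) in ex; rewrite (PhiE ry) in ey.
rewrite (PhiE (Rel_lin a rx ry)).
apply: coset_eq' (Rel_lin a rx ry) (Rel_lin a ru rv) _.
have dx : den H (x - u).
  by apply: (Rel_den (Rel_sub rx ru)).2; have := (coset_self rx).2; rewrite ex => -[].
have dy : den H (y - v).
  by apply: (Rel_den (Rel_sub ry rv)).2; have := (coset_self ry).2; rewrite ey => -[].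
by rewrite opprD addrACA -scalerBr; exact: den_lin.
Qed.
End Isomorphism.

(** * Comparison of the two cohomologies *)

Lemma telescope (V : zmodType) (a b c : V) : (- b + c) + (- (- a + c) + (- a + b)) = 0.
Proof.
rewrite opprD opprK (addrC (- a) b) (addrC (a - c)) subrKA (addrC (- b)).
by rewrite subrKA subrr.
Qed.

Section DolbeaultCech.
Context {R : realType} {X : topologicalType} {M : charts R X} {r : nat}.
Context {hA : complex_atlas M} {B : background M r} {hB : heterotic B}.
Context {P : potentials M r} {hP : local_potentials B P}.
Notation C := R[i].
Notation qfib := ('rV[C]_3 * 'M[C]_r * 'cV[C]_3)%type.
Notation qform := (@qform R X M r).
Notation cochains := (@cochains R X M r).
Notation phi := (phi B P).
Notation phiV := (phiV B P).
Implicit Types (i j k l : idx M) (x y : X) (W U : set X).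

Lemma inter_open n (J : 'I_n -> idx M) : open (inter J).
Proof.
rewrite openE => x Jx; apply: filter_forall => u.
by apply: open_nbhs_nbhs; split; [exact: dom_open|exact: Jx].
Qed.

Lemma inter_sub n (J : 'I_n -> idx M) u : inter J `<=` dom (J u).
Proof. by move=> x; apply. Qed.

Lemma inter_comp n m (J : 'I_n -> idx M) (f : 'I_m -> 'I_n) : inter J `<=` inter (J \o f).
Proof. by move=> x Jx u; exact: Jx. Qed.

Lemma restrE p W (s : qform p) x l : W x -> restr W s x l = s x l.
Proof. by move=> Wx; rewrite /restr mem_set. Qed.

Lemma restr_id p W (s : qform p) : sections B W s -> restr W s = s.
Proof.
move=> hs; apply/funext => x; apply/funext => l; rewrite /restr.
case: (asboolP (W x)) => [Wx|n]; first by rewrite mem_set.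
by rewrite memNset // (sec_support hs) // => -[].
Qed.

Lemma restr_lin p W (c : C) (s s' : qform p) :
  restr W (c *: s + s') = c *: restr W s + restr W s'.
Proof.
apply/funext => x; apply/funext => l; rewrite /restr.
rewrite -[RHS]/(c *: (if x \in W then s x l else 0) + (if x \in W then s' x l else 0)).
by case: ifP => // _; rewrite scaler0 addr0.
Qed.

Lemma Dbar_restr p W U (s : qform p) x l : open W -> W `<=` U -> W x ->
  Dbar B W (restr W s) x l = Dbar B U s x l.
Proof.
move=> oW WU Wx; have [lx|n] := pselect (dom l x); last by rewrite !Dbar_out // => -[].
apply/funext => K; apply: etrans (Dbar_ext (s' := s) K oW Wx Wx lx _) _.
  by move=> y Wy _; rewrite restrE.
by rewrite (DbarE s K Wx lx) (DbarE s K (WU x Wx) lx).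
Qed.

Section RestrSub.
Variables (W U U' : set X) (s s' : qform 0).
Hypotheses (oW : open W) (WU : W `<=` U) (WU' : W `<=` U').
Hypotheses (hs : sections B U s) (hs' : sections B U' s').

Let hr : sections B W (restr W s). Proof. exact: (restr_section oW WU hs). Qed.
Let hr' : sections B W (restr W s'). Proof. exact: (restr_section oW WU' hs'). Qed.

Lemma restr_sub_section : sections B W (restr W (-1 *: s + s')).
Proof. by rewrite restr_lin; exact: (sections_lin (-1) oW hr hr'). Qed.

Lemma Dbar_restr_sub : (forall x l, W x -> Dbar B U s x l = Dbar B U' s' x l) ->
  Dbar B W (restr W (-1 *: s + s')) = 0.
Proof.
move=> e; rewrite restr_lin (Dbar_lin (-1) oW hr hr') scaleN1r.
apply/funext => x; apply/funext => l; apply/funext => K.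
rewrite -[LHS]/(- Dbar B W (restr W s) x l K + Dbar B W (restr W s') x l K).
have [[Wx lx]|n] := pselect ((W `&` dom l) x); last by rewrite !Dbar_out // addNr.
by rewrite (Dbar_restr _ _ oW WU Wx) (Dbar_restr _ _ oW WU' Wx) e // addNr.
Qed.
End RestrSub.

(** The cochain of local primitives before [phi] moves it to the holomorphic
    frame of the first chart. *)
Definition difference (a : idx M -> qform 0) (J : 'I_2 -> idx M) : qform 0 :=
  restr (inter J) (- 1 *: a (J ord0) + a (J ord_max)).

Lemma difference_section a J : (forall i, sections B (dom i) (a i)) ->
  sections B (inter J) (difference a J).
Proof.
move=> ha; apply: (restr_sub_section _ _ _ (ha _) (ha _)); first exact: inter_open.
  exact: inter_sub.
exact: inter_sub.
Qed.

(** The graph of the comparison.  As a relation it involves no choice of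
    primitives. *)
Definition dolbeault_cech (s : qform 1) (eta : cochains 1) : Prop :=
  exists a : idx M -> qform 0, [/\ forall i, sections B (dom i) (a i),
    forall i x l, dom i x -> s x l = Dbar B (dom i) (a i) x l &
    forall J, eta J = phi (J ord0) (inter J) (difference a J)].

(** The derivatives of the primitives glue to [s], and [Dbar] squares to zero. *)
Lemma primitive_agree (a : idx M -> qform 0) (s : qform 1) :
  (forall i, sections B (dom i) (a i)) ->
  (forall i x l, dom i x -> s x l = Dbar B (dom i) (a i) x l) ->
  sections B [set: X] s /\ Dbar B [set: X] s = 0.
Proof.
move=> ha sE.
have hD i : sections B (dom i) (Dbar B (dom i) (a i)).
  by apply: Dbar_section (ha i); exact: dom_open.
have agree i j x l : dom i x -> dom j x ->
    Dbar B (dom i) (a i) x l = Dbar B (dom j) (a j) x l.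
  by move=> ix jx; rewrite -(sE _ _ _ ix) -(sE _ _ _ jx).
have e : s = glue (fun i => Dbar B (dom i) (a i)).
  apply/funext => x; apply/funext => l; have [i ix] := atlas_cover hA x.
  by rewrite (glueE hD agree _ ix) (sE _ _ _ ix).
split; first by rewrite e; exact: glue_section.
apply/funext => x; apply/funext => l.
have [lx|n] := pselect (dom l x); last by apply: Dbar_out => -[].
apply/funext => K.
have oT : open (dom l) by exact: dom_open.
apply: etrans (Dbar_ext (W' := [set: X]) (s' := Dbar B (dom l) (a l)) K oT lx I lx _) _.
  by move=> y ly _; exact: sE.
by rewrite (DbarDbar oT (ha l)).
Qed.

Lemma difference_closed a s J : (forall i, sections B (dom i) (a i)) ->
  (forall i x l, dom i x -> s x l = Dbar B (dom i) (a i) x l) ->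
  Dbar B (inter J) (difference a J) = 0.
Proof.
move=> ha sE; apply: (Dbar_restr_sub _ _ _ (ha _) (ha _)); first exact: inter_open.
- exact: inter_sub.
- exact: inter_sub.
- by move=> x l Jx; rewrite -!sE; [|exact: Jx|exact: Jx].
Qed.

Lemma I2_max (k : 'I_2) : k != ord0 -> k = ord_max.
Proof. by case: k => -[|[|]] // ? _; apply/val_inj. Qed.

Lemma psiV p i j W U (s : qform p) : open W -> W `<=` dom i -> W `<=` dom j ->
  W `<=` U -> sections B U s -> phiV i W (psi B P i j W s) = phiV j W s.
Proof.
move=> oW Wi Wj WU hs.
have hj : sections B W (phiV j W s) by exact: (phiV_section oW WU Wj hs).
by rewrite /psi (phiVK oW (fun x => id) Wi hj (fun x => id)) restr_id.
Qed.

Lemma phi_difference a J j W : (forall i, sections B (dom i) (a i)) ->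
  open W -> W `<=` inter J -> W `<=` dom j ->
  phi j W (difference a J) = - phi j W (a (J ord0)) + phi j W (a (J ord_max)).
Proof.
move=> ha oW WJ Wj; rewrite /difference phi_restr //.
have Wu u : W `<=` dom (J u) by move=> x /WJ.
by rewrite (phi_lin oW (Wu _) Wj _ (ha _) (Wu _) (ha _)) scaleN1r.
Qed.

Lemma lift_ord0 n (k : 'I_n.+2) : k != ord0 -> lift k ord0 = ord0.
Proof. by case: k => -[|k] // ? _; apply/val_inj. Qed.

Lemma sum_not_first_2 (V : nmodType) (F : 'I_2 -> V) :
  \sum_(k < 2 | k != ord0) F k = F (lift ord0 ord0).
Proof. by rewrite big_mkcond !big_ord_recl big_ord0 /= add0r addr0. Qed.

Lemma sum_not_first_3 (V : nmodType) (F : 'I_3 -> V) :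
  \sum_(k < 3 | k != ord0) F k = F (lift ord0 ord0) + F (lift ord0 (lift ord0 ord0)).
Proof. by rewrite big_mkcond !big_ord_recl big_ord0 /= add0r addr0. Qed.

Lemma sign_1 (V : lmodType C) (v : V) : (-1) ^+ lift ord0 (ord0 : 'I_2) *: v = - v.
Proof. by rewrite expr1 scaleN1r. Qed.

Lemma sign_2 (V : lmodType C) (v : V) :
  (-1) ^+ lift ord0 (lift ord0 (ord0 : 'I_1)) *: v = v.
Proof. by rewrite /= expr2 mulrNN mulr1 scale1r. Qed.

Lemma cech_d0E (c : cochains 0) J : cech_d B P c J =
  psi B P (J ord0) (J (lift ord0 ord0)) (inter J) (c (J \o lift ord0)) -
  restr (inter J) (c (J \o lift (lift ord0 ord0))).
Proof.
apply/funext => x; apply/funext => l; apply/funext => K.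
rewrite /cech_d sum_not_first_2.
exact: (congr1 (fun v => psi B P (J ord0) (J (lift ord0 ord0)) (inter J)
  (c (J \o lift ord0)) x l K + v) (scaleN1r _)).
Qed.

Lemma cech_d1E (eta : cochains 1) J : cech_d B P eta J =
  psi B P (J ord0) (J (lift ord0 ord0)) (inter J) (eta (J \o lift ord0)) +
  (- restr (inter J) (eta (J \o lift (lift ord0 ord0))) +
  restr (inter J) (eta (J \o lift (lift ord0 (lift ord0 ord0))))).
Proof.
apply/funext => x; apply/funext => l; apply/funext => K.
rewrite /cech_d sum_not_first_3.
apply: (congr1 (fun v => psi B P (J ord0) (J (lift ord0 ord0)) (inter J)
  (eta (J \o lift ord0)) x l K + v)).
exact: (congr2 +%R (sign_1 _) (sign_2 _)).
Qed.

(** Antisymmetry of a 1-cochain only involves the exchange of its two indices. *)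
Lemma cech_cochain1 (eta : cochains 1) :
  (forall J, sections B (inter J) (eta J)) ->
  (forall J, delbar (inter J) (eta J) = 0) ->
  (forall J, eta J = - psi B P (J ord0) (J ord_max) (inter J) (eta (J \o tperm ord0 ord_max))) ->
  cech_cochain B P eta.
Proof.
move=> h1 h2 h3; split.
- exact: h1.
- move=> J; apply/funext => x; apply/funext => l; apply/funext => K.
  by rewrite h2.
- move=> J k l kl k0 l0; exfalso; move: kl.
  by rewrite (I2_max k0) (I2_max l0) eqxx.
- move=> J l /I2_max ->; apply/funext => x; apply/funext => k'; apply/funext => K.
  rewrite h3 -[RHS]/(- psi B P (J ord0) (J ord_max) (inter J) (eta (J \o tperm ord0 ord_max)) x k' K).
  by [].
Qed.

Lemma lift01 : lift ord0 ord0 = ord_max :> 'I_2.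
Proof. by apply/val_inj. Qed.

(** In the frame of the first chart the cocycle condition is a telescoping sum;
    [psi] only moves the remaining term to that frame. *)
Lemma difference_cochain a s (eta : cochains 1) : (forall i, sections B (dom i) (a i)) ->
  (forall i x l, dom i x -> s x l = Dbar B (dom i) (a i) x l) ->
  (forall J, eta J = phi (J ord0) (inter J) (difference a J)) ->
  cech_cochain B P eta /\ cech_d B P eta = 0.
Proof.
move=> ha sE etaE; have hd J := difference_section J ha.
have oJ n (J : 'I_n -> idx M) := inter_open J.
split.
  apply: cech_cochain1.
  - by move=> J; rewrite etaE; exact: (phi_section (oJ _ J) (fun x => id) (@inter_sub _ J _) (hd J)).
  - move=> J; rewrite etaE; apply: (delbar_phi_eq0 (oJ _ J) (@inter_sub _ J _) (hd J)).
    exact: (difference_closed J ha sE).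
  - move=> J; set t := tperm _ _.
    have oW := oJ _ J.
    have t0 : t ord0 = ord_max by rewrite tpermL.
    have t1 : t ord_max = ord0 by rewrite tpermR.
    have WJt : inter J `<=` inter (J \o t) by exact: inter_comp.
    have -> : psi B P (J ord0) (J ord_max) (inter J) (eta (J \o t)) =
        phi (J ord0) (inter J) (difference a (J \o t)).
      rewrite etaE /= t0.
      exact: (psi_phi oW (@inter_sub _ J _) (@inter_sub _ J _) (hd (J \o t)) WJt WJt).
    rewrite etaE !(phi_difference ha oW _ (@inter_sub _ J _)) //= t0 t1.
    by rewrite opprD opprK addrC.
apply/funext => J; have oW := oJ _ J.
have WJ (f : 'I_2 -> 'I_3) : inter J `<=` inter (J \o f) by exact: inter_comp.
have W0 := @inter_sub _ J ord0.
have rE (k : 'I_3) : k != ord0 -> restr (inter J) (eta (J \o lift k)) =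
    phi (J ord0) (inter J) (difference a (J \o lift k)).
  move=> k0; apply: etrans (congr1 (restr (inter J)) (etaE _)) _.
  rewrite [(J \o lift k) ord0](congr1 J (lift_ord0 k0)).
  by apply: restr_phi; exact: WJ.
have pE : psi B P (J ord0) (J (lift ord0 ord0)) (inter J) (eta (J \o lift ord0)) =
    phi (J ord0) (inter J) (difference a (J \o lift ord0)).
  rewrite etaE; exact: (psi_phi oW W0 (@inter_sub _ J _) (hd _) (WJ _) (WJ _)).
have e1 : lift (lift ord0 ord0) ord_max = lift ord0 (lift ord0 ord0) :> 'I_3 by apply/val_inj.
have e2 : lift ord0 ord_max = lift ord0 (lift ord0 ord0) :> 'I_3 by apply/val_inj.
have e3 : lift (lift ord0 (lift ord0 ord0)) ord_max = lift ord0 ord0 :> 'I_3 by apply/val_inj.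
have f1 : lift (lift ord0 ord0) ord0 = ord0 :> 'I_3 by apply/val_inj.
have f2 : lift (lift ord0 (lift ord0 ord0)) ord0 = ord0 :> 'I_3 by apply/val_inj.
have dE (f : 'I_2 -> 'I_3) u v : f ord0 = u -> f ord_max = v ->
    phi (J ord0) (inter J) (difference a (J \o f)) =
    - phi (J ord0) (inter J) (a (J u)) + phi (J ord0) (inter J) (a (J v)).
  by move=> <- <-; exact: (phi_difference ha oW (WJ f) W0).
have D0 := dE _ _ _ erefl e2; have D1 := dE _ _ _ f1 e1; have D2 := dE _ _ _ f2 e3.
rewrite cech_d1E (etrans pE D0) (etrans (rE (lift ord0 ord0) isT) D1).
rewrite (etrans (rE (lift ord0 (lift ord0 ord0)) isT) D2).
exact: telescope.
Qed.

(** Near a point off [dom k], where [s] is zero by convention but need not be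
    continuous, the function [rho] vanishes. *)
Lemma cutoff_section i k (rho : X -> C) (s : qform 0) :
  (forall l, smooth_on l (dom l) rho) -> locally_zero_off k rho ->
  sections B (dom i `&` dom k) s ->
  sections B (dom i) (fun x l K => rho x *: s x l K).
Proof.
move=> srho zrho hs; have oi : open (dom i) by exact: dom_open.
have out x l : ~ dom k x -> s x l = 0.
  by move=> nk; apply: (sec_support hs) => -[[]].
apply: section_intro.
- move=> x l n; apply/funext => K.
  rewrite (sec_support hs); first by rewrite scaler0.
  by move=> -[[ix _] lx]; exact: n.
- move=> l j x ix lx jx; apply/funext => K; rewrite transQ0.
  have -> : s x l = transQ B j l x (s x j).
    have [kx|nk] := pselect (dom k x); first exact: (sec_transition hs).
    rewrite !out //; apply/funext => K'.
    by rewrite transQ0 qtrans0.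
  by rewrite transQ0 -[in RHS](addr0 (_ *: _)) qtrans_lin qtrans0 addr0.
- by move=> x l _ _ K u; case: u.
- move=> x l K _ _; apply: etrans (mxtraceZ _ (gam (s x l K))) _.
  by rewrite (sec_traceless hs) mulr0.
- move=> l K; have cl : chart_domain l (dom i `&` dom l) by exact: chart_domainI.
  have sm (h : qfib -> C) : (forall c v, h (c *: v) = c * h v) ->
      smooth_on l (dom i `&` dom k `&` dom l) (fun x => h (s x l K)) ->
      smooth_on l (dom i `&` dom l) (fun x => h (rho x *: s x l K)).
    move=> hZ hs'.
    have h0 : h 0 = 0 by rewrite -(scale0r (0 : qfib)) hZ mul0r.
    apply: smooth_local => x [ix lx]; have [kx|nk] := pselect (dom k x).
      have ok : open (dom i `&` dom k) by apply: openI; exact: dom_open.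
      have cV : chart_domain l (dom i `&` dom k `&` dom l) by exact: chart_domainI.
      exists (dom i `&` dom k `&` dom l).
        by split=> //; exact: (domain_open (chart_domain := cV)).
      apply: (smooth_ext (f := fun y => rho y * h (s y l K))); first by move=> y _; rewrite hZ.
      by apply: smoothM => //; apply: smooth_sub (srho l) => y [].
    have [U [oU Ux rU]] := zrho x nk.
    have cV : chart_domain l (U `&` dom l) by exact: chart_domainI.
    exists (U `&` dom l); first by split=> //; exact: (domain_open (chart_domain := cV)).
    by apply: smooth_ext (smooth_cst 0) => y [/rU -> _]; rewrite scale0r h0.
  have [h1 h2 h3] := section_smooth hs l K; split=> a b.
  - by apply: (sm (fun v => kap v a b)) => [c v|]; [rewrite /kap /= mxE|exact: h1].
  - by apply: (sm (fun v => gam v a b)) => [c v|]; [rewrite /gam /= mxE|exact: h2].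
  - by apply: (sm (fun v => tng v a b)) => [c v|]; [rewrite /tng /= mxE|exact: h3].
Qed.

Lemma sections_sum p W (I : Type) (m : seq I) (f : I -> qform p) : open W ->
  (forall n, sections B W (f n)) -> sections B W (\sum_(n <- m) f n).
Proof.
move=> oW hf; elim: m => [|n m IH]; first by rewrite big_nil; exact: sections0.
by rewrite big_cons -[f n]scale1r; exact: sections_lin.
Qed.

Lemma sum_at p (I : Type) (m : seq I) (f : I -> qform p) x l K :
  (\sum_(n <- m) f n) x l K = \sum_(n <- m) f n x l K.
Proof. by elim: m => [|n m IH]; rewrite ?big_nil // !big_cons -IH. Qed.

Let opp_opp_sub (V : lmodType C) (u v : V) : - (-1 *: u + 0) + (-1 *: v + 0) = u - v.
Proof. by rewrite !scaleN1r !addr0 opprK. Qed.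

(** With a partition of unity rho_m subordinate to charts k_m, the sections
    a_i = - sum_m rho_m e_(i, k_m) have the required differences, by the cocycle
    condition for the indices i, j, k_m. *)
Lemma cocycle_splits (e : idx M -> idx M -> qform 0) :
  hausdorff_space X -> compact [set: X] ->
  (forall i k, sections B (dom i `&` dom k) (e i k)) ->
  (forall i j k x, dom i x -> dom j x -> dom k x -> e i k x = e i j x + e j k x) ->
  exists2 a : idx M -> qform 0, forall i, sections B (dom i) (a i) &
    forall i j x, dom i x -> dom j x -> e i j x = - a i x + a j x.
Proof.
move=> hX cX he cocycle.
have [m [k [rho [srho zrho sum1]]]] := partition_of_unity hX cX.
pose f i n : qform 0 := fun x l K => rho n x *: e i (k n) x l K.
have hf i n : sections B (dom i) (f i n).
  by apply: (cutoff_section (srho n) (zrho n)); exact: he.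
exists (fun i => -1 *: \sum_(n <- m) f i n + 0) => [i|i j x ix jx].
  have oi : open (dom i) by exact: dom_open.
  by apply: sections_lin => //; [exact: sections_sum|exact: sections0].
apply/funext => l; apply/funext => K.
apply: etrans _ (esym (opp_opp_sub ((\sum_(n <- m) f i n) x l K) ((\sum_(n <- m) f j n) x l K))).
apply: etrans (esym (scale1r (e i j x l K))) _.
apply: etrans (congr1 (fun c => c *: e i j x l K) (esym (sum1 x))) _; rewrite scaler_suml.
rewrite !sum_at -sumrB; apply: eq_bigr => n _; rewrite /f -scalerBr.
have [kx|/(zrho n)[U [_ Ux ->]] //] := pselect (dom (k n) x); last by rewrite !scale0r.
congr (_ *: _); rewrite (cocycle i j (k n) x ix jx kx).
by rewrite -[(_ + _) l K]/(e i j x l K + e j (k n) x l K) addrK.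
Qed.

Lemma dolbeault_cech_lin c (s s' : qform 1) (eta eta' : cochains 1) :
  dolbeault_cech s eta -> dolbeault_cech s' eta' ->
  dolbeault_cech (c *: s + s') (c *: eta + eta').
Proof.
move=> [a [ha sE etaE]] [a' [ha' sE' etaE']].
have oi i : open (dom i) by exact: dom_open.
exists (fun i => c *: a i + a' i); split.
- by move=> i; apply: sections_lin.
- move=> i x l ix; rewrite (Dbar_lin c (oi i) (ha i) (ha' i)).
  by rewrite -[LHS]/(c *: s x l + s' x l) (sE i) // (sE' i).
- move=> J; rewrite -[LHS]/(c *: eta J + eta' J) etaE etaE'.
  have oJ : open (inter J) by exact: inter_open.
  have J0 : inter J `<=` dom (J ord0) by exact: inter_sub.
  have -> : difference (fun i => c *: a i + a' i) J = c *: difference a J + difference a' J.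
    rewrite /difference -restr_lin; congr (restr _ _).
    by rewrite !scalerDr addrACA !scalerA mulrC.
  by rewrite (phi_lin oJ (fun x => id) J0 c (difference_section J ha) (fun x => id)
    (difference_section J ha')).
Qed.

Lemma dolbeault_cech_num (s : qform 1) (eta : cochains 1) : dolbeault_cech s eta ->
  [/\ sections B [set: X] s, Dbar B [set: X] s = 0, cech_cochain B P eta & cech_d B P eta = 0].
Proof.
move=> [a [ha sE etaE]]; have [h1 h2] := primitive_agree ha sE.
by have [h3 h4] := difference_cochain ha sE etaE.
Qed.

Lemma dolbeault_cech_total (s : qform 1) : (forall i, dbar_poincare i) ->
  sections B [set: X] s -> Dbar B [set: X] s = 0 -> exists eta, dolbeault_cech s eta.
Proof.
move=> hp hs ds.
have /choice[a aP] i : exists a : qform 0, sections B (dom i) a /\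
    forall x l, dom i x -> s x l = Dbar B (dom i) a x l.
  by have [a h1 h2] := Dbar_primitive (P := P) (hp i) hs ds; exists a.
exists (fun J => phi (J ord0) (inter J) (difference a J)), a; split=> //.
- by move=> i; have [] := aP i.
- by move=> i x l ix; have [_ h] := aP i; exact: h.
Qed.

Definition index_pair i k (u : 'I_2) : idx M := if u == ord0 then i else k.

Lemma index_pairE (J : 'I_2 -> idx M) : J = index_pair (J ord0) (J ord_max).
Proof.
by apply/funext => u; rewrite /index_pair; case: eqP => [->//|/eqP/I2_max->].
Qed.

Lemma inter_index_pair i k : inter (index_pair i k) = dom i `&` dom k.
Proof.
apply/seteqP; split=> x; first by move=> h; split; [exact: (h ord0)|exact: (h ord_max)].
by move=> [ix kx] u; rewrite /index_pair; case: ifP.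
Qed.

(** Applying the inverse of [phi] for the first index removes the transition
    operator [psi] from the cocycle condition. *)
Lemma cocycle_untwisted (eta : cochains 1) i j k x : cech_cochain B P eta ->
  cech_d B P eta = 0 -> dom i x -> dom j x -> dom k x ->
  phiV i (inter (index_pair i k)) (eta (index_pair i k)) x =
  phiV i (inter (index_pair i j)) (eta (index_pair i j)) x +
  phiV j (inter (index_pair j k)) (eta (index_pair j k)) x.
Proof.
move=> ce de ix jx kx.
pose J (u : 'I_3) := if u == ord0 then i else if u == lift ord0 ord0 then j else k.
pose W := inter J; have oW : open W by exact: inter_open.
have Wx : W x by move=> u; rewrite /J; case: ifP => // _; case: ifP.
have Wi : W `<=` dom i by move=> y /(_ ord0).
have Wj : W `<=` dom j by move=> y /(_ (lift ord0 ord0)).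
have Wk : W `<=` dom k by move=> y /(_ (lift ord0 (lift ord0 ord0))).
have Wp i' k' : W `<=` dom i' -> W `<=` dom k' -> W `<=` inter (index_pair i' k').
  by move=> h h'; rewrite inter_index_pair => y Wy; split; [exact: h|exact: h'].
have Wij := Wp _ _ Wi Wj; have Wik := Wp _ _ Wi Wk; have Wjk := Wp _ _ Wj Wk.
have J0 : J \o lift ord0 = index_pair j k.
  by apply/funext => u; case: (eqVneq u ord0) => [->|/I2_max->].
have J1 : J \o lift (lift ord0 ord0) = index_pair i k.
  by apply/funext => u; case: (eqVneq u ord0) => [->|/I2_max->].
have J2 : J \o lift (lift ord0 (lift ord0 ord0)) = index_pair i j.
  by apply/funext => u; case: (eqVneq u ord0) => [->|/I2_max->].
have hs I : sections B (inter I) (eta I) by exact: (cech_section ce).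
have eJ : (- restr W (eta (index_pair i k)) + restr W (eta (index_pair i j))) +
    psi B P i j W (eta (index_pair j k)) = 0.
  have h := cech_d1E eta J; rewrite J0 J1 J2 in h.
  by apply: etrans (addrC _ _) (etrans (esym h) _); rewrite de.
have e : psi B P i j W (eta (index_pair j k)) =
    -1 *: restr W (eta (index_pair i j)) + restr W (eta (index_pair i k)).
  by rewrite scaleN1r -(addr0_eq eJ) opprD opprK addrC.
have := congr1 (phiV i W) e; rewrite (psiV oW Wi Wj Wjk (hs _)).
have hr I : W `<=` inter I -> sections B W (restr W (eta I)).
  by move=> WI; exact: (restr_section oW WI (hs I)).
rewrite (phiV_lin oW (fun x => id) Wi (-1) (hr _ Wij) (fun x => id) (hr _ Wik)).
rewrite !phiV_restr // scaleN1r => h.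
have rE i' I : W `<=` inter I -> phiV i' (inter I) (eta I) x = phiV i' W (eta I) x.
  move=> WI; apply/funext => l; rewrite -(restr_phiV i' (eta I) WI).
  by rewrite restrE.
rewrite (rE i _ Wik) (rE i _ Wij) (rE j _ Wjk).
apply/funext => l; apply/funext => K.
have hK : phiV j W (eta (index_pair j k)) x l K =
    - phiV i W (eta (index_pair i j)) x l K + phiV i W (eta (index_pair i k)) x l K.
  exact: (congr1 (fun s => s x l K) h).
apply: esym; apply: etrans (congr1 (fun v => phiV i W (eta (index_pair i j)) x l K + v) hK) _.
exact: addNKr.
Qed.

Lemma cech_closed p (eta : cochains p) (J : 'I_p.+1 -> idx M) : cech_cochain B P eta ->
  delbar (inter J) (eta J) = 0 :> qform 1.
Proof.
move=> ce; apply/funext => x; apply/funext => l; apply/funext => K.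
by apply: esym; rewrite (cech_holomorphic ce).
Qed.

(** Split the untwisted cocycle.  The derivatives of the pieces agree on overlaps,
    since the cocycle is [Dbar]-closed, and glue to the required form. *)
Lemma dolbeault_cech_onto (eta : cochains 1) : hausdorff_space X -> compact [set: X] ->
  cech_cochain B P eta -> cech_d B P eta = 0 -> exists s, dolbeault_cech s eta.
Proof.
move=> hX cX ce de; pose e i k := phiV i (inter (index_pair i k)) (eta (index_pair i k)).
have op (J : 'I_2 -> idx M) : open (inter J) by exact: inter_open.
have hs J : sections B (inter J) (eta J) by exact: (cech_section ce).
have pi i k : inter (index_pair i k) `<=` dom i by rewrite inter_index_pair => x [].
have hV i k : sections B (inter (index_pair i k)) (e i k).
  exact: (phiV_section (op _) (fun x => id) (pi i k) (hs _)).
have he i k : sections B (dom i `&` dom k) (e i k) by rewrite -inter_index_pair.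
have [a ha aE] := cocycle_splits hX cX he
  (fun i j k x => cocycle_untwisted ce de (i := i) (j := j) (k := k) (x := x)).
have eE i k : e i k = difference a (index_pair i k).
  apply: (section_eq (pi i k) (hV i k) (difference_section _ ha)) => x Wx.
  have [ix kx] : (dom i `&` dom k) x by rewrite -inter_index_pair.
  apply/funext => K; rewrite /difference restrE // (aE i k x ix kx) scaleN1r.
  by [].
have De i k : Dbar B (inter (index_pair i k)) (e i k) = 0.
  apply: (Dbar_phiV_eq0 (op _) (pi i k) (hs _)).
  exact: (cech_closed (index_pair i k) ce).
have oi i : open (dom i) by exact: dom_open.
have hD i : sections B (dom i) (Dbar B (dom i) (a i)) by exact: (Dbar_section (oi i) (ha i)).
have agree i j x l : dom i x -> dom j x ->
    Dbar B (dom i) (a i) x l = Dbar B (dom j) (a j) x l.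
  move=> ix jx; have [lx|n] := pselect (dom l x); last by rewrite !Dbar_out // => -[].
  pose W := inter (index_pair i j); have Wx : W x by rewrite /W inter_index_pair.
  have Wi := pi i j; have Wj : W `<=` dom j by rewrite /W inter_index_pair => y [].
  have hr k : W `<=` dom k -> sections B W (restr W (a k)).
    by move=> Wk; exact: (restr_section (op _) Wk (ha k)).
  rewrite -(Dbar_restr (a i) l (op _) Wi Wx) -(Dbar_restr (a j) l (op _) Wj Wx).
  apply: esym; apply/funext => K.
  have := De i j; rewrite eE /difference restr_lin.
  rewrite (Dbar_lin (-1) (op _) (hr i Wi) (hr j Wj)) scaleN1r addrC.
  move=> /(congr1 (fun s => s x l K)) h; apply/eqP; rewrite -subr_eq0; apply/eqP.
  exact: h.
exists (glue (fun i => Dbar B (dom i) (a i))); exists a; split; first exact: ha.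
- by move=> i x l ix; exact: (glueE hD agree).
- move=> J; rewrite [in LHS](index_pairE J) [in RHS](index_pairE J).
  set i := J ord0; set k := J ord_max.
  rewrite -eE.
  apply: etrans (esym (restr_id (hs _))) _; apply: esym.
  exact: (phiK (op (index_pair i k)) (fun x => id) (pi i k) (hs (index_pair i k)) (fun x => id)).
Qed.

Lemma cech_cochain0 (c : cochains 0) :
  (forall J, sections B (inter J) (c J)) ->
  (forall J, delbar (inter J) (c J) = 0) -> cech_cochain B P c.
Proof.
move=> h1 h2; split.
- exact: h1.
- move=> J; apply/funext => x; apply/funext => l; apply/funext => K.
  by rewrite h2.
- by move=> J k l kl k0; exfalso; move: k0; rewrite (ord1 k).
- by move=> J k k0; exfalso; move: k0; rewrite (ord1 k).
Qed.

(** The local primitives differ from a global one by [Dbar]-closed sections; these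
    form the 0-cochain. *)
Lemma exact_to_coboundary (s : qform 1) (eta : cochains 1) (u : qform 0) :
  dolbeault_cech s eta -> sections B [set: X] u -> Dbar B [set: X] u = s ->
  exists2 c : cochains 0, cech_cochain B P c & cech_d B P c = eta.
Proof.
move=> [a [ha sE etaE]] hu us.
have op n (J : 'I_n -> idx M) : open (inter J) by exact: inter_open.
pose b (J : 'I_1 -> idx M) := restr (inter J) (-1 *: u + a (J ord0)).
have J0 (J : 'I_1 -> idx M) : inter J `<=` dom (J ord0) by exact: inter_sub.
have JT (J : 'I_1 -> idx M) : inter J `<=` [set: X] by [].
have hb J : sections B (inter J) (b J).
  exact: (restr_sub_section (op _ J) (JT J) (J0 J) hu (ha _)).
have Db J : Dbar B (inter J) (b J) = 0.
  apply: (Dbar_restr_sub (op _ J) (JT J) (J0 J) hu (ha _)) => x l Jx.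
  by rewrite us; exact: (sE _ _ _ (Jx ord0)).
pose c : cochains 0 := fun J => phi (J ord0) (inter J) (b J).
exists c.
  apply: cech_cochain0 => J; first exact: (phi_section (op _ J) (fun x => id) (J0 J) (hb J)).
  exact: (delbar_phi_eq0 (op _ J) (J0 J) (hb J) (Db J)).
apply/funext => J.
have oW := op _ J; have W0 : inter J `<=` dom (J ord0) by exact: inter_sub.
have W1 : inter J `<=` dom (J (lift ord0 ord0)) by exact: inter_sub.
have WJ (f : 'I_1 -> 'I_2) : inter J `<=` inter (J \o f) by exact: inter_comp.
have bE (f : 'I_1 -> 'I_2) : phi (J ord0) (inter J) (b (J \o f)) =
    - phi (J ord0) (inter J) u + phi (J ord0) (inter J) (a (J (f ord0))).
  rewrite /b (phi_restr oW W0 _ (WJ f)).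
  have Wf : inter J `<=` dom (J (f ord0)) by exact: inter_sub.
  by rewrite (phi_lin oW (@subsetT _ _) W0 (-1) hu Wf (ha _)) scaleN1r.
have pE : psi B P (J ord0) (J (lift ord0 ord0)) (inter J)
    (c (J \o lift ord0)) =
    phi (J ord0) (inter J) (b (J \o lift ord0)).
  exact: (psi_phi oW W0 W1 (hb _) (WJ _) (WJ _)).
have rE : restr (inter J) (c (J \o lift (lift ord0 ord0))) =
    phi (J ord0) (inter J) (b (J \o lift (lift ord0 ord0))).
  have e : (J \o lift (lift ord0 ord0)) ord0 = J ord0.
    exact: (congr1 J (lift_ord0 (k := lift ord0 ord0) isT)).
  by rewrite /c e; apply: restr_phi; exact: WJ.
rewrite cech_d0E pE rE !bE etaE (phi_difference ha oW (fun x => id) W0).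
rewrite (lift_ord0 (k := lift ord0 ord0) isT) lift01.
move: (phi _ _ u) (phi _ _ (a (J ord0))) (phi _ _ (a (J ord_max))) => U A0 A1.
by rewrite opprD opprK addrACA addNr add0r addrC.
Qed.

Let cross_diff (V : lmodType C) (u u' v v' : V) : - u + u' = - v + v' ->
  -1 *: v + u = -1 *: v' + u'.
Proof.
move=> e; apply/eqP; rewrite !scaleN1r -subr_eq0 opprD opprK addrACA -e.
by rewrite addrACA addrN addNr addr0.
Qed.

(** Once the 0-cochain is subtracted, the local primitives agree on overlaps. *)
Lemma coboundary_to_exact (s : qform 1) (eta : cochains 1) (c : cochains 0) :
  dolbeault_cech s eta -> cech_cochain B P c -> cech_d B P c = eta ->
  exists2 u : qform 0, sections B [set: X] u & Dbar B [set: X] u = s.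
Proof.
move=> rel cc ce; have [hs _ _ _] := dolbeault_cech_num rel.
have [a [ha sE etaE]] := rel.
have op n (J : 'I_n -> idx M) : open (inter J) by exact: inter_open.
have oi i : open (dom i) by exact: dom_open.
pose o i (_ : 'I_1) : idx M := i.
have oE i : inter (o i) = dom i.
  by apply/seteqP; split=> x; [move=> /(_ ord0)|move=> ix u].
have hc i : sections B (dom i) (c (o i)) by rewrite -[X in sections _ X]oE; exact: (cech_section cc).
have dc i : delbar (dom i) (c (o i)) = 0 :> qform 1.
  by rewrite -[X in delbar X]oE; exact: (cech_closed (o i) cc).
have ii i : dom i `<=` dom i by [].
pose f i := phiV i (dom i) (c (o i)).
have hf i : sections B (dom i) (f i) by exact: (phiV_section (oi i) (ii i) (ii i) (hc i)).
have Df i : Dbar B (dom i) (f i) = 0 by exact: (Dbar_phiV_eq0 (oi i) (ii i) (hc i) (dc i)).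
pose v i := -1 *: f i + a i.
have hv i : sections B (dom i) (v i) by apply: sections_lin.
have agree i j x l : dom i x -> dom j x -> v i x l = v j x l.
  move=> ix jx; pose J := index_pair i j; pose W := inter J.
  have Wx : W x by rewrite /W inter_index_pair.
  have oW : open W by exact: op.
  have Wi : W `<=` dom i by rewrite /W inter_index_pair => y [].
  have Wj : W `<=` dom j by rewrite /W inter_index_pair => y [].
  have e0 : J \o lift ord0 = o j by apply/funext => k; rewrite (ord1 k).
  have e1 : J \o lift (lift ord0 ord0) = o i.
    by apply/funext => k; rewrite (ord1 k).
  have hd : sections B W (difference a J) by exact: difference_section.
  have eqW : phi i W (difference a J) = -1 *: restr W (c (o i)) + psi B P i j W (c (o j)).
    have h := cech_d0E c J; rewrite e0 e1 ce in h.
    by apply: etrans (esym (etaE J)) (etrans h _); rewrite scaleN1r addrC.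
  have hp : sections B W (psi B P i j W (c (o j))).
    have h : sections B W (phiV j W (c (o j))) by exact: (phiV_section oW Wj Wj (hc j)).
    exact: (phi_section oW (fun x => id) Wi h).
  have hr : sections B W (restr W (c (o i))) by exact: (restr_section oW Wi (hc i)).
  have := congr1 (phiV i W) eqW.
  rewrite (phiVK oW (fun x => id) Wi hd (fun x => id)) (restr_id hd).
  rewrite (phiV_lin oW (fun x => id) Wi (-1) hr (fun x => id) hp).
  rewrite (psiV oW Wi Wj Wj (hc j)) phiV_restr // => h.
  have fE k : W `<=` dom k -> f k x l = phiV k W (c (o k)) x l.
    by move=> Wk; rewrite -(restr_phiV k (c (o k)) Wk) restrE.
  apply/funext => K.
  have hK : - a i x l K + a j x l K = - f i x l K + f j x l K.
    rewrite (fE i Wi) (fE j Wj) -[- a i x l K]scaleN1r -[- phiV i W _ x l K]scaleN1r.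
    apply: etrans _ (congr1 (fun s => s x l K) h).
    by rewrite /difference restrE.
  exact: (cross_diff hK).
have gE := glueE hv agree.
exists (glue v); first exact: glue_section.
apply/funext => x; apply/funext => l.
have [lx|n] := pselect (dom l x); last by rewrite Dbar_out ?(sec_support hs) // => -[].
apply/funext => K.
apply: etrans (Dbar_ext (W' := [set: X]) (s' := v l) K (oi l) lx I lx _) _.
  by move=> y ly _; exact: gE.
have D : Dbar B (dom l) (v l) = Dbar B (dom l) (a l).
  by rewrite (Dbar_lin (-1) (oi l) (hf l) (ha l)) Df scaler0 add0r.
by rewrite (sE _ _ _ lx) -D !DbarE.
Qed.

(** The operations on the ambient spaces of the two cohomology groups come from
    unfolding forms and cochains to functions; this lemma and the next four
    identify them with the structures attached to [qform] and [cochains]. *)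
Lemma num_DbarE (s : qform 1) :
  num (H_Dbar B 0) s <-> sections B [set: X] s /\ Dbar B [set: X] s = 0.
Proof.
split=> -[h e]; split; first exact: h.
- apply/funext => x; apply/funext => l; apply/funext => K.
  by apply: esym; rewrite e.
- exact: h.
- apply/funext => x; apply/funext => l; apply/funext => K.
  by rewrite e.
Qed.

Lemma num_CechE (eta : cochains 1) :
  num (H_Cech B P 0) eta <-> cech_cochain B P eta /\ cech_d B P eta = 0.
Proof.
split=> -[h e]; split; first exact: h.
- apply/funext => J; apply/funext => x; apply/funext => l; apply/funext => K.
  by apply: esym; rewrite e.
- exact: h.
- apply/funext => J; apply/funext => x; apply/funext => l; apply/funext => K.
  by rewrite e.
Qed.

Lemma lin_DbarE (c : R[i]) (s s' : amb (H_Dbar B 0)) :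
  c *: s + s' = (c *: (s : qform 1) + (s' : qform 1) : qform 1).
Proof. by apply/funext => x; apply/funext => l; apply/funext => K. Qed.

Lemma lin_CechE (c : R[i]) (eta eta' : amb (H_Cech B P 0)) : c *: eta + eta' =
  (c *: (eta : cochains 1) + (eta' : cochains 1) : cochains 1).
Proof.
apply/funext => J; apply/funext => x; apply/funext => l; apply/funext => K.
have e : (c *: (eta : cochains 1) + eta') J x l K =
  c *: (eta : cochains 1) J x l K + (eta' : cochains 1) J x l K by [].
by rewrite -[LHS]/(c *: (eta : cochains 1) J x l K +
  (eta' : cochains 1) J x l K) -e.
Qed.

Lemma zero_DbarE : (0 : amb (H_Dbar B 0)) = (0 : qform 1).
Proof. by apply/funext => x; apply/funext => l; apply/funext => K. Qed.
End DolbeaultCech.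

Theorem theorem1p7 (R : realType) (X : topologicalType) (M : charts R X)
    (r : nat) (B : background M r) (P : potentials M r)
    (hausX : hausdorff_space X) (compactX : compact [set: X])
    (atlasM : complex_atlas M)
    (poincareM : forall i : idx M, dbar_poincare i)
    (hetB : heterotic B)
    (potP : local_potentials B P) :
  isomorphic (H_Dbar B 0) (H_Cech B P 0).
Proof.
have oT : open [set: X] by exact: openT.
apply: (isomorphic_of_relation (H := H_Dbar B 0) (H' := H_Cech B P 0)
  (Rel := dolbeault_cech (B := B) (P := P))).
- move=> s eta rel; have [h1 h2 h3 h4] := dolbeault_cech_num rel.
  by split; [apply/num_DbarE|apply/num_CechE].
- move=> c s s' eta eta' h h'; rewrite lin_DbarE lin_CechE.
  exact: dolbeault_cech_lin h h'.
- by move=> s /num_DbarE[hs ds]; exact: dolbeault_cech_total.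
- by move=> eta /num_CechE[ce de]; exact: dolbeault_cech_onto.
- move=> s eta rel; split=> [[u hu us]|[c cc ce]].
    by have [c cc ce] := exact_to_coboundary rel hu us; exists c.
  by have [u hu us] := coboundary_to_exact rel cc ce; exists u.
- rewrite zero_DbarE; exists 0; first exact: sections0.
  have h0 : sections B [set: X] (0 : @qform R X M r 0) by exact: sections0.
  have := Dbar_lin (-1) oT h0 h0; rewrite scaleN1r addNr => ->.
  by rewrite scaleN1r addNr.
- move=> c _ _ [u hu <-] [u' hu' <-]; rewrite lin_DbarE.
  by exists (c *: u + u'); [exact: sections_lin|exact: Dbar_lin].
Qed.
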